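(* Let $n\in\{2,3\}$. Let $\Gamma\subset\mathbb{R}^{n-1}$ and $\Gamma_j\subset\mathbb{R}^{n-1}$ ($j\in\mathbb{N}_0$) be non-empty, bounded and open, with $\widetilde H^{-1/2}(\Gamma)=H^{-1/2}_{\overline{\Gamma}}$. Suppose there exist non-empty, bounded, open sets $\Gamma_j^-\subset\mathbb{R}^{n-1}$ and non-empty compact sets $\Gamma_j^+\subset\mathbb{R}^{n-1}$ ($j\in\mathbb{N}_0$) such that $\Gamma_j^-\subset\Gamma_{j+1}^-$, $\Gamma_j^+\supset\Gamma_{j+1}^+$ and $\Gamma_j^-\subset\Gamma_j\subset\Gamma_j^+$ for all $j\in\mathbb{N}_0$, and $\Gamma=\bigcup_{j\in\mathbb{N}_0}\Gamma_j^-$, $\overline{\Gamma}=\bigcap_{j\in\mathbb{N}_0}\Gamma_j^+$. For each $j$ let $M_j$ be a pre-convex mesh on $\Gamma_j$ with mesh size $h_j$, and let $V_j^h$ be the space of piecewise constant functions on $M_j$. If $h_j\to0$ as $j\to\infty$, then BEM convergence holds, i.e. $V_j^h$ Mosco-converges to $\widetilde H^{-1/2}(\Gamma)$ in $H^{-1/2}(\mathbb{R}^{n-1})$.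
   Context: Sobolev spaces: for $m\in\mathbb{N}$ and $s\in\mathbb{R}$, $H^s(\mathbb{R}^m)$ is the Hilbert space of tempered distributions $u$ whose Fourier transform $\hat u$ (with $\hat u(\xi)=(2\pi)^{-m/2}\int e^{-\mathrm{i}\xi\cdot x}u(x)\,dx$ for test functions) is locally integrable with $\|u\|_{H^s(\mathbb{R}^m)}^2=\int_{\mathbb{R}^m}(1+|\xi|^2)^s|\hat u(\xi)|^2\,d\xi<\infty$. For $F\subset\mathbb{R}^m$ closed, $H^s_F=\{u\in H^s(\mathbb{R}^m):\operatorname{supp}u\subset F\}$. For $\Omega\subset\mathbb{R}^m$ non-empty and open, $\widetilde H^s(\Omega)$ is the closure of $C_0^\infty(\Omega)$ in $H^s(\mathbb{R}^m)$. Mosco convergence: closed subspaces $W_j$ of a Hilbert space $H$ Mosco-converge to a closed subspace $W$ of $H$ if (i) for every $w\in W$ there exist $w_j\in W_j$ with $\|w_j-w\|_H\to0$; and (ii) if $(W_{j_m})$ is a subsequence of $(W_j)$, $w_m\in W_{j_m}$ for $m\in\mathbb{N}$, and $w_m\rightharpoonup w$ weakly in $H$, then $w\in W$. Pre-convex mesh: a pre-convex mesh on a non-empty bounded open set $\Omega\subset\mathbb{R}^m$ is a finite collection $M=\{T_1,\dots,T_N\}$ of non-empty open subsets $T_l\subset\Omega$ whose convex hulls are pairwise disjoint, such that each $\partial T_l$ has zero $m$-dimensional Lebesgue measure and $\Omega$ is the interior of $\bigcup_{l=1}^N\overline{T_l}$. Its mesh size is $h=\max_l\operatorname{diam}(T_l)$.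 The space of piecewise constant functions on $M$ consists of the (a.e. equivalence classes of) functions that are constant on each $T_l$ and zero outside $\Omega$; it is a finite-dimensional subspace of $L^2(\mathbb{R}^m)\subset H^{-1/2}(\mathbb{R}^m)$. *)

(* Defs.v *)
From HB Require Import structures.
From mathcomp Require Import all_boot all_order all_algebra.
From mathcomp Require Import complex.
From mathcomp Require Import all_classical all_reals all_analysis.

Set Implicit Arguments.
Unset Strict Implicit.
Unset Printing Implicit Defensive.

Import Order.TTheory GRing.Theory Num.Theory.
Import numFieldNormedType.Exports.
Import ComplexField.Normc.

Local Open Scope classical_set_scope.
Local Open Scope ring_scope.
Local Open Scope complex_scope.

(* The sigma-algebra below is the product one, i.e. the Borel sets of [R^m];
   the construction is that of the library for [n.-tuple T]. *)

Definition rV_display : measure_display. Proof. exact: default_measure_display. Qed.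

Section rV_measurable.
Context {R : realType} (m : nat).

Let coord : 'I_m -> 'rV[R]_m -> R := fun i x => x ord0 i.

Let rV_set0 : g_sigma_preimage coord set0.
Proof. exact: sigma_algebra0. Qed.

Let rV_setC A : g_sigma_preimage coord A -> g_sigma_preimage coord (~` A).
Proof. exact: sigma_algebraC. Qed.

Let rV_bigcup (F : (set 'rV[R]_m)^nat) :
  (forall i, g_sigma_preimage coord (F i)) ->
  g_sigma_preimage coord (\bigcup_i (F i)).
Proof. exact: sigma_algebra_bigcup. Qed.

HB.instance Definition _ := @isMeasurable.Build rV_display
  'rV[R]_m (g_sigma_preimage coord) rV_set0 rV_setC rV_bigcup.

Lemma measurable_coord (i : 'I_m) :
  measurable_fun [set: 'rV[R]_m] (fun x : 'rV[R]_m => x ord0 i).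
Proof.
move=> _ Y mY; rewrite setTI; apply: sub_sigma_algebra => /=.
rewrite -bigcup_seq/=; exists i => /=; first by rewrite mem_index_enum.
by exists Y => //; rewrite setTI.
Qed.

Lemma measurable_fun_coordP d (T : measurableType d) (f : T -> 'rV[R]_m) :
  (forall i, measurable_fun [set: T] (fun t => f t ord0 i)) ->
  measurable_fun [set: T] f.
Proof.
move=> mf _ A mA; rewrite setTI; move: A mA.
pose G := [set A | measurable (f @^-1` A)].
have sG : sigma_algebra [set: 'rV[R]_m] G.
  split.
  - by rewrite /G /= preimage_set0.
  - by move=> A; rewrite /G /= setTD preimage_setC; exact: measurableC.
  - by move=> F; rewrite /G /= preimage_bigcup; exact: bigcupT_measurable.
suff : g_sigma_preimage coord `<=` G by [].
apply: smallest_sub => // A; rewrite -bigcup_seq => -[i _ [B mB <-]].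
by have := mf i measurableT B mB; rewrite /G /= !setTI.
Qed.

End rV_measurable.

Section lebesgue_rV.
Context {R : realType}.

Definition rV_cons m (xv : measurableTypeR R * 'rV[R]_m) : 'rV[R]_m.+1 :=
  row_mx (const_mx xv.1 : 'rV[R]_1) xv.2.

Lemma measurable_rV_cons m : measurable_fun [set: measurableTypeR R * 'rV[R]_m] (@rV_cons m).
Proof.
apply: measurable_fun_coordP => i.
case: (split_ordP (i : 'I_(1 + m))) => j ij.
  apply: (eq_measurable_fun fst) => // x _.
  by rewrite ij; apply/esym/(etrans (row_mxEl _ _ _ _)); rewrite mxE.
apply: (eq_measurable_fun (fun x : measurableTypeR R * 'rV[R]_m => x.2 ord0 j)) => //.
  by move=> x _; rewrite ij; exact/esym/row_mxEr.
exact: (measurableT_comp (measurable_coord j) measurable_snd).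
Qed.

Definition rV_uncons m (v : 'rV[R]_(1 + m)) : measurableTypeR R * 'rV[R]_m :=
  (v ord0 (lshift m ord0), rsubmx v).

Lemma rV_consK m : cancel (@rV_cons m) (@rV_uncons m).
Proof.
case=> x v; rewrite /rV_uncons /rV_cons /=; congr (_, _); last exact: row_mxKr.
by apply: (etrans (row_mxEl _ _ _ _)); rewrite mxE.
Qed.

Lemma measurable_rV_uncons m : measurable_fun [set: 'rV[R]_m.+1] (@rV_uncons m).
Proof.
apply: measurable_fun_pair; first exact: measurable_coord.
apply: measurable_fun_coordP => i /=.
apply: (eq_measurable_fun (fun v : 'rV[R]_(1 + m) => v ord0 (rshift 1 i))).
  by move=> v _; rewrite /= mxE.
exact: measurable_coord.
Qed.

Section step.
Context m (mu : {sigma_finite_measure set 'rV[R]_m -> \bar R}).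

Definition lebesgue_cons : set 'rV[R]_m.+1 -> \bar R :=
  pushforward (lebesgue_measure \x mu)%E (@rV_cons m).

Let mcons (A : set 'rV[R]_m.+1) :
  measurable A -> measurable (@rV_cons m @^-1` A).
Proof.
by move=> mA; have := @measurable_rV_cons m measurableT A mA; rewrite setTI.
Qed.

Let lebesgue_cons0 : lebesgue_cons set0 = 0%E.
Proof. by rewrite /lebesgue_cons /pushforward preimage_set0 measure0. Qed.

Let lebesgue_cons_ge0 A : (0 <= lebesgue_cons A)%E.
Proof. exact: (measure_ge0 (lebesgue_measure \x mu)%E). Qed.

Let lebesgue_cons_sigma_additive : semi_sigma_additive lebesgue_cons.
Proof.
move=> F mF tF mUF; rewrite /lebesgue_cons /pushforward preimage_bigcup.
apply: measure_semi_sigma_additive.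
- by move=> n; exact: mcons.
- apply/trivIsetP => /= i j _ _ ij; rewrite -preimage_setI.
  by move/trivIsetP : tF => /(_ _ _ _ _ ij) ->//; rewrite preimage_set0.
- by rewrite -preimage_bigcup; exact: mcons.
Qed.

HB.instance Definition _ := isMeasure.Build _ _ _ lebesgue_cons
  lebesgue_cons0 lebesgue_cons_ge0 lebesgue_cons_sigma_additive.

Let lebesgue_cons_sigma_finite : sigma_finite setT lebesgue_cons.
Proof.
have /sigma_finiteP[F [FT ndF Foo]] := sigma_finiteT (@lebesgue_measure R).
have /sigma_finiteP[G [GT ndG Goo]] := sigma_finiteT mu.
exists (fun n => @rV_uncons m @^-1` (F n `*` G n)).
  apply/esym; rewrite -subTset => v _.
  have [i _ Fi] : (\bigcup_i F i) (rV_uncons v).1 by rewrite -FT.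
  have [j _ Gj] : (\bigcup_i G i) (rV_uncons v).2 by rewrite -GT.
  exists (maxn i j) => //; split.
    by move: Fi; exact/subsetPset/ndF/leq_maxl.
  by move: Gj; exact/subsetPset/ndG/leq_maxr.
move=> n; have [mF Fy] := Foo n; have [mG Gy] := Goo n; split.
  have := @measurable_rV_uncons m measurableT _ (measurableX mF mG).
  by rewrite setTI.
rewrite /lebesgue_cons /pushforward -comp_preimage.
rewrite (_ : _ \o _ = id); last by apply/funext => x; exact: rV_consK.
rewrite preimage_id product_measure1E//.
by rewrite lte_mul_pinfty// ge0_fin_numE.
Qed.

HB.instance Definition _ := Measure_isSigmaFinite.Build _ _ _ lebesgue_cons
  lebesgue_cons_sigma_finite.

End step.

Let lebesgue0 : {sigma_finite_measure set 'rV[R]_0 -> \bar R} :=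
  [the {sigma_finite_measure set 'rV[R]_0 -> \bar R} of
   \d_(0 : 'rV[R]_0)].

(* Up to [rV_cons], the [m]-fold product of the one-dimensional measure. *)
Fixpoint lebesgue_rV m : {sigma_finite_measure set 'rV[R]_m -> \bar R} :=
  if m is m'.+1 then
    [the {sigma_finite_measure set 'rV[R]_m'.+1 -> \bar R} of
     lebesgue_cons (lebesgue_rV m')]
  else lebesgue0.

End lebesgue_rV.

Section functions.
Context {R : realType} {m : nat}.
Local Notation V := 'rV[R]_m.
Local Notation C := R[i].
Implicit Types (f g phi psi : V -> C) (x y xi : V).

Definition dotp x y : R := \sum_i x ord0 i * y ord0 i.

(* The library norm on ['rV[R]_m] is the sup norm. *)
Definition enorm x : R := Num.sqrt (dotp x x).

Definition diam (A : set V) : R :=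
  sup [set enorm (p.1 - p.2) | p in A `*` A].

Definition boundary (A : set V) : set V := closure A `\` A°.

Definition convex_hull (A : set V) : set V := smallest (@convex_set R V) A.

Definition cmeasurable (D : set V) f :=
  measurable_fun D (fun x => complex.Re (f x)) /\
  measurable_fun D (fun x => complex.Im (f x)).

Definition cintegrable (D : set V) f :=
  (lebesgue_rV m).-integrable D (fun x => (complex.Re (f x))%:E) /\
  (lebesgue_rV m).-integrable D (fun x => (complex.Im (f x))%:E).

Definition cintegral f : C :=
  (\int[lebesgue_rV m]_x complex.Re (f x)) +i*
  (\int[lebesgue_rV m]_x complex.Im (f x)).

Definition loc_integrable f := forall K : set V, compact K -> cintegrable K f.

Definition cpartial (i : 'I_m) f : V -> C := fun x =>
  'D_(delta_mx ord0 i) (fun y => complex.Re (f y)) x +i*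
  'D_(delta_mx ord0 i) (fun y => complex.Im (f y)) x.

Definition cpartials (s : seq 'I_m) f : V -> C := foldr cpartial f s.

Definition ccontinuous f :=
  continuous (fun x => complex.Re (f x)) /\
  continuous (fun x => complex.Im (f x)).

Definition has_partials f := forall (i : 'I_m) x,
  derivable (fun y => complex.Re (f y)) x (delta_mx ord0 i) /\
  derivable (fun y => complex.Im (f y)) x (delta_mx ord0 i).

Definition smooth f := forall s : seq 'I_m,
  ccontinuous (cpartials s f) /\ has_partials (cpartials s f).

Definition fun_supp f : set V := closure [set x | f x != 0].

Definition test_function (Omega : set V) phi :=
  [/\ smooth phi, compact (fun_supp phi) & fun_supp phi `<=` Omega].

(* [c] bounds the Schwartz seminorm
   max_(|s| <= N) sup_x (1 + |x|^2)^N |d^s phi(x)|. *)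
Definition schwartz_bound (N : nat) phi (c : R) :=
  forall (s : seq 'I_m) x, (size s <= N)%N ->
    (1 + enorm x ^+ 2) ^+ N * normc (cpartials s phi x) <= c.

Definition schwartz phi :=
  smooth phi /\ forall N, exists c, schwartz_bound N phi c.

Definition expi (t : R) : C := cos t +i* sin t.

Definition fourier phi : V -> C := fun xi =>
  ((2 * pi) `^ (- (m%:R / 2)))%:C *
  cintegral (fun x => expi (- dotp xi x) * phi x).

End functions.

(* A tempered distribution is encoded as a functional on all functions
   [R^m -> C] that vanishes outside the Schwartz space; thus equality of
   distributions is Leibniz equality, and sums and scalar multiples are those
   of the function space. *)

Section distributions.
Context {R : realType} {m : nat}.
Local Notation V := 'rV[R]_m.
Local Notation C := R[i].
Local Notation dist := ((V -> C) -> C).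
Implicit Types (f g phi psi : V -> C) (u v : dist) (s : R).

Definition on_schwartz u : dist :=
  fun phi => if `[< schwartz phi >] then u phi else 0.

Definition tempered u :=
  [/\ forall phi, ~ schwartz phi -> u phi = 0,
      forall (a : C) phi psi, schwartz phi -> schwartz psi ->
        u (a *: phi + psi) = a * u phi + u psi &
      exists (N : nat) (k : R), forall phi c, schwartz phi ->
        schwartz_bound N phi c -> normc (u phi) <= k * c].

(* Regular distributions; both L^2 functions and test functions are viewed as
   distributions through this map. *)
Definition reg_dist f : dist :=
  on_schwartz (fun phi => cintegral (fun x => f x * phi x)).

Definition fourier_dist u : dist := on_schwartz (fun phi => u (fourier phi)).

Definition is_fourier_density u g :=
  loc_integrable g /\ fourier_dist u = reg_dist g.

(* Determined only up to a null set. *)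
Definition fourier_density u : V -> C :=
  xget (fun=> 0) [set g | is_fourier_density u g].

(* Extended-real valued, so that [Hs_norm s u < +oo] entails that the Fourier
   transform of [u] is a locally integrable function and no statement about
   norms depends on a default value. *)
Definition Hs_norm s u : \bar R :=
  if `[< exists g, is_fourier_density u g >] then
    ((\int[lebesgue_rV m]_xi ((1 + enorm xi ^+ 2) `^ s *
        normc (fourier_density u xi) ^+ 2)%:E) `^ (2^-1)%R)%E
  else +oo%E.

Definition Hs s : set dist :=
  [set u | tempered u /\ (Hs_norm s u < +oo)%E].

Definition dist_supp u : set V :=
  ~` \bigcup_(U in [set U | open U /\
        forall phi, test_function U phi -> u phi = 0]) U.

Definition Hs_supp s (F : set V) : set dist :=
  [set u | Hs s u /\ dist_supp u `<=` F].

Definition Hs_tilde s (Omega : set V) : set dist :=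
  [set u | Hs s u /\ forall e : R, 0 < e ->
    exists2 phi, test_function Omega phi &
      (Hs_norm s (u - reg_dist phi)%R < e%:E)%E].

End distributions.

(* The ambient Hilbert space is the set [H] of vectors of [E] with the norm
   [nrm]. *)

Section mosco.
Context {R : realType} {E : lmodType R[i]} (H : set E) (nrm : E -> \bar R).

Definition bounded_functional (l : E -> R[i]) :=
  (forall (a : R[i]) u v, H u -> H v -> l (a *: u + v) = a * l u + l v) /\
  exists k : R, forall u, H u -> ((normc (l u))%:E <= k%:E * nrm u)%E.

Definition weakly_converges (u_ : nat -> E) (u : E) :=
  [/\ forall k, H (u_ k), H u &
      forall l, bounded_functional l ->
        normc (l (u_ k) - l u) @[k --> \oo] --> 0].

Definition mosco_converges (W_ : nat -> set E) (W : set E) :=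
  (forall w, W w -> exists2 w_ : nat -> E,
     forall j, W_ j (w_ j) & nrm (w_ j - w) @[j --> \oo] --> 0%E) /\
  (forall (sigma : nat -> nat) (w_ : nat -> E) (w : E),
     {homo sigma : i j / (i < j)%N} ->
     (forall k, W_ (sigma k) (w_ k)) -> weakly_converges w_ w -> W w).

End mosco.

Section mesh.
Context {R : realType} {m : nat}.
Local Notation V := 'rV[R]_m.
Local Notation C := R[i].

Record preconvex_mesh (Omega : set V) := PreconvexMesh {
  mesh_card : nat;
  mesh_cell : 'I_mesh_card -> set V;
  mesh_cell_nonempty : forall l, mesh_cell l !=set0;
  mesh_cell_open : forall l, open (mesh_cell l);
  mesh_cell_sub : forall l, mesh_cell l `<=` Omega;
  mesh_cell_hulls : forall k l, k != l ->
    convex_hull (mesh_cell k) `&` convex_hull (mesh_cell l) = set0;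
  mesh_cell_boundary : forall l,
    lebesgue_rV m (boundary (mesh_cell l)) = 0%E;
  mesh_cover : Omega = (\bigcup_l closure (mesh_cell l))° }.

Arguments mesh_cell {Omega} _ _.

Context (Omega : set V) (M : preconvex_mesh Omega).

Definition mesh_size : R := \big[Num.max/0]_l diam (mesh_cell M l).

Definition piecewise_constant (f : V -> C) :=
  (forall l x y, mesh_cell M l x -> mesh_cell M l y -> f x = f y) /\
  (forall x, ~ Omega x -> f x = 0).

(* Measurability only selects representatives: the values on the null set
   outside the cells are otherwise unconstrained. *)
Definition pc_space : set ((V -> C) -> C) :=
  [set reg_dist f | f in
    [set f | cmeasurable setT f /\ piecewise_constant f]].

End mesh.

(* Main.v *)
(* Both halves of Mosco convergence are reduced to the Fourier side.

   Recovery sequences: a test function phi on Gamma is the a.e. limit of its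
   piecewise constant interpolants f_j on the meshes, and these are dominated,
   so f_j -> phi in L^2 (the boundaries of the cells are null).  The inequality
   |F f|_2 <= C |f|_2, proved by Abel summation with the Poisson kernel and
   Schur's test, turns this into convergence in H^(-1/2); a diagonal selection
   gives the recovery sequence for a general element.

   Weak limits: for a test function phi, the functional u |-> u(phi) is bounded
   on H^(-1/2), because F is onto the Schwartz space (F^4 = id by the inversion
   theorem, again via the Poisson kernel) and u(F psi) is the pairing of psi with
   the density of the Fourier transform of u.  Hence the weak limit vanishes off
   every Gamma_j^+, i.e. it is supported in the closure of Gamma, and the
   hypothesis on Gamma applies.

   Since the norm is defined through an arbitrarily chosen density, both parts
   need that a locally integrable density is unique up to a null set. *)

Require Import Defs.
From HB Require Import structures.
From mathcomp Require Import all_boot all_order all_algebra.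
From mathcomp Require Import complex ring lra.
From mathcomp Require Import all_classical all_reals all_analysis.
From mathcomp Require Import measurable_realfun.

Set Implicit Arguments.
Unset Strict Implicit.
Unset Printing Implicit Defensive.

Import Order.TTheory GRing.Theory Num.Theory.
Import numFieldNormedType.Exports.
Import ComplexField.Normc.

Local Open Scope classical_set_scope.
Local Open Scope ring_scope.
Local Open Scope complex_scope.

(** * Complex-valued integrals *)

(** The Abel factor is exp(-e |x_i|) in every coordinate rather than a Gaussian: its transform, and
    the mass of that transform, come from elementary primitives on two half-lines, and the product
    form carries both to dimension m by Fubini. Divergent integrals have default values, so
    additivity and Fubini have to be earned each time. Explicit majorants do this, mostly products
    of the functions 1 / (1 + x_i^2). Constants are not sharp: the modulus of a complex integral is
    estimated through real and imaginary parts, at the price of a factor 2, so the L^2 inequality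
    carries a 4 where Plancherel has 1. It reaches H^(-1/2) because the weight of that norm is at
    most 1. The meshes live on Gamma_j while a test function lives on Gamma. A point where it does
    not vanish lies in some Gamma_j^-, hence in all later Gamma_j; at other points its continuity on
    the whole space takes over. Every interpolant vanishes outside Gamma_0^+, whose compactness
    supplies the dominating function. *)

Section complex_norm.
Context {R : realType}.
Implicit Types z w : R[i].

Lemma normcD z w : normc (z + w) <= normc z + normc w.
Proof. exact: le_normcD. Qed.

Lemma normc_ge0 z : 0 <= normc z.
Proof. by case: z => a b; exact: sqrtr_ge0. Qed.

Lemma Re_add z w : complex.Re (z + w) = complex.Re z + complex.Re w.
Proof. by case: z; case: w. Qed.

Lemma Im_add z w : complex.Im (z + w) = complex.Im z + complex.Im w.
Proof. by case: z; case: w. Qed.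

Lemma Re_opp z : complex.Re (- z) = - complex.Re z.
Proof. by case: z. Qed.

Lemma Im_opp z : complex.Im (- z) = - complex.Im z.
Proof. by case: z. Qed.

Lemma Re_mul z w : complex.Re (z * w) =
  complex.Re z * complex.Re w - complex.Im z * complex.Im w.
Proof. by case: z; case: w. Qed.

Lemma Im_mul z w : complex.Im (z * w) =
  complex.Re z * complex.Im w + complex.Im z * complex.Re w.
Proof. by case: z; case: w. Qed.

Lemma complex_ext z w :
  complex.Re z = complex.Re w -> complex.Im z = complex.Im w -> z = w.
Proof. by case: z; case: w => a b c d /= -> ->. Qed.

Lemma sqr_normcE z : normc z ^+ 2 = complex.Re z ^+ 2 + complex.Im z ^+ 2.
Proof. by case: z => a b /=; rewrite sqr_sqrtr// addr_ge0// sqr_ge0. Qed.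

Lemma normc_sqrtE z : normc z = Num.sqrt (complex.Re z ^+ 2 + complex.Im z ^+ 2).
Proof. by case: z. Qed.

Lemma ler_Re z : `|complex.Re z| <= normc z.
Proof.
rewrite -(ler_pXn2r (ltn0Sn 1)) ?nnegrE ?normc_ge0//.
by rewrite sqr_normcE real_normK ?num_real// lerDl sqr_ge0.
Qed.

Lemma ler_Im z : `|complex.Im z| <= normc z.
Proof.
rewrite -(ler_pXn2r (ltn0Sn 1)) ?nnegrE ?normc_ge0//.
by rewrite sqr_normcE real_normK ?num_real// lerDr sqr_ge0.
Qed.

Lemma normc_le z : normc z <= `|complex.Re z| + `|complex.Im z|.
Proof.
rewrite -(ler_pXn2r (ltn0Sn 1)) ?nnegrE ?normc_ge0 ?addr_ge0//.
rewrite sqr_normcE -(real_normK (num_real (complex.Re z))).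
rewrite -(real_normK (num_real (complex.Im z))) sqrrD.
by rewrite lerD2r lerDl mulrn_wge0// mulr_ge0.
Qed.

Lemma normc_real (x : R) : normc x%:C = `|x|.
Proof. by rewrite /= expr0n addr0 sqrtr_sqr. Qed.

Lemma normcB z w : normc (z - w) <= normc z + normc w.
Proof. by rewrite -(normcN w); exact: normcD. Qed.

Lemma normc_eq0 z : (normc z == 0) = (z == 0).
Proof.
apply/eqP/eqP => [|->]; [exact: eq0_normc | exact: normc0].
Qed.

Lemma sqr_normc_conj z : (normc z ^+ 2)%:C = z * z^*.
Proof.
rewrite sqr_normcE; case: z => a b; apply: complex_ext => /=; ring.
Qed.

Lemma normc_conj z : normc z^* = normc z.
Proof. by case: z => a b /=; rewrite sqrrN. Qed.

End complex_norm.

Section complex_integral.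
Context {R : realType} {d} {T : measurableType d}.
Implicit Types (f g : T -> R[i]) (mu : {measure set T -> \bar R}).

Definition cmeas f :=
  measurable_fun setT (fun x => complex.Re (f x)) /\
  measurable_fun setT (fun x => complex.Im (f x)).

Definition cintg mu f :=
  mu.-integrable setT (fun x => (complex.Re (f x))%:E) /\
  mu.-integrable setT (fun x => (complex.Im (f x))%:E).

Definition cint mu f : R[i] :=
  (\int[mu]_x complex.Re (f x)) +i* (\int[mu]_x complex.Im (f x)).

Lemma cmeas_cst (c : R[i]) : cmeas (fun=> c).
Proof. by split; exact: measurable_cst. Qed.

Lemma cmeas_real (h : T -> R) : measurable_fun setT h -> cmeas (fun x => (h x)%:C).
Proof. by split => //=; exact: measurable_cst. Qed.

Lemma cmeasD f g : cmeas f -> cmeas g -> cmeas (fun x => f x + g x).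
Proof.
move=> [rf jf] [rg jg]; split.
- under eq_fun do rewrite Re_add; exact: measurable_funD.
- under eq_fun do rewrite Im_add; exact: measurable_funD.
Qed.

Lemma cmeasM f g : cmeas f -> cmeas g -> cmeas (fun x => f x * g x).
Proof.
move=> [rf jf] [rg jg]; split.
- by under eq_fun do rewrite Re_mul; apply: measurable_funB; exact: measurable_funM.
- by under eq_fun do rewrite Im_mul; apply: measurable_funD; exact: measurable_funM.
Qed.

Lemma cmeasN f : cmeas f -> cmeas (fun x => - f x).
Proof.
move=> [rf jf]; split.
- by under eq_fun do rewrite Re_opp; exact: measurable_funN.
- by under eq_fun do rewrite Im_opp; exact: measurable_funN.
Qed.

Lemma cmeasB f g : cmeas f -> cmeas g -> cmeas (fun x => f x - g x).
Proof. by move=> mf mg; apply: cmeasD => //; exact: cmeasN. Qed.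

Lemma cmeasJ f : cmeas f -> cmeas (fun x => (f x)^*).
Proof.
move=> [rf jf]; split.
- by apply: (eq_measurable_fun (fun x => complex.Re (f x))) => // x _; case: (f x).
- apply: (eq_measurable_fun (fun x => - complex.Im (f x))).
    by move=> x _; case: (f x).
  exact: measurable_funN.
Qed.

Lemma cmeas_prod (I : Type) (r : seq I) (F : I -> T -> R[i]) :
  (forall i, cmeas (F i)) -> cmeas (fun x => \prod_(i <- r) F i x).
Proof.
move=> mF; elim: r => [|i r IH].
  by under eq_fun do rewrite big_nil; exact: cmeas_cst.
by under eq_fun do rewrite big_cons; exact: cmeasM.
Qed.

Lemma measurable_normc f : cmeas f -> measurable_fun setT (fun x => normc (f x)).
Proof.
move=> [rf jf]; under eq_fun do rewrite normc_sqrtE.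
apply: (measurableT_comp (continuous_measurable_fun (@sqrt_continuous R))).
by apply: measurable_funD; exact: measurable_funX.
Qed.

Section fixed_measure.
Variable mu : {measure set T -> \bar R}.

Lemma cintg_meas f : cintg mu f -> cmeas f.
Proof.
by move=> [/integrableP[/measurable_EFinP mr _] /integrableP[/measurable_EFinP mi _]].
Qed.

Lemma le_cintg f (h : T -> R) : cmeas f -> mu.-integrable setT (EFin \o h) ->
  (forall x, normc (f x) <= h x) -> cintg mu f.
Proof.
move=> [mr mi] ih fh; split; apply: le_integrable ih => //.
- exact/measurable_EFinP.
- move=> x _; rewrite /= lee_fin; apply: le_trans (ler_Re _) _.
  exact: le_trans (fh x) (ler_norm _).
- exact/measurable_EFinP.
- move=> x _; rewrite /= lee_fin; apply: le_trans (ler_Im _) _.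
  exact: le_trans (fh x) (ler_norm _).
Qed.

Lemma cintg_normc f : cintg mu f -> mu.-integrable setT (fun x => (normc (f x))%:E).
Proof.
move=> cf; have mf := cintg_meas cf; case: cf => ir ii.
have := integrableD measurableT (integrable_norm ir) (integrable_norm ii).
apply: le_integrable => //; first by apply/measurable_EFinP; exact: measurable_normc.
move=> x _; rewrite /= lee_fin ger0_norm ?normc_ge0//.
apply: le_trans (normc_le _) _; exact: ler_norm.
Qed.

Lemma cintgD f g : cintg mu f -> cintg mu g -> cintg mu (fun x => f x + g x).
Proof.
move=> [rf jf] [rg jg]; split.
- by under eq_fun do rewrite Re_add EFinD; exact: integrableD.
- by under eq_fun do rewrite Im_add EFinD; exact: integrableD.
Qed.

Lemma cintgZ (c : R[i]) f : cintg mu f -> cintg mu (fun x => c * f x).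
Proof.
move=> cf; apply: (@le_cintg _ (fun x => normc c * normc (f x))).
- by apply: cmeasM; [exact: cmeas_cst | exact: cintg_meas cf].
- rewrite /comp; under eq_fun do rewrite EFinM.
  by apply: integrableZl => //; exact: cintg_normc.
- by move=> x; rewrite normcM.
Qed.

Lemma cintgN f : cintg mu f -> cintg mu (fun x => - f x).
Proof.
by move=> /(cintgZ (-1)); under eq_fun do rewrite mulN1r.
Qed.

Lemma cintgB f g : cintg mu f -> cintg mu g -> cintg mu (fun x => f x - g x).
Proof. by move=> cf cg; apply: cintgD => //; exact: cintgN. Qed.

Lemma cintD f g : cintg mu f -> cintg mu g ->
  cint mu (fun x => f x + g x) = cint mu f + cint mu g.
Proof.
move=> [rf jf] [rg jg]; apply: complex_ext; rewrite /cint /=.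
- by under eq_Rintegral do rewrite Re_add; exact: RintegralD.
- by under eq_Rintegral do rewrite Im_add; exact: RintegralD.
Qed.

Lemma cintZ (c : R[i]) f : cintg mu f -> cint mu (fun x => c * f x) = c * cint mu f.
Proof.
move=> [rf jf]; apply: complex_ext; rewrite /cint.
- have ia (a : R) (h : T -> R) : mu.-integrable setT (EFin \o h) ->
    mu.-integrable setT (EFin \o (fun x => a * h x)).
    by move=> ih; rewrite /comp; under eq_fun do rewrite EFinM; exact: integrableZl.
  rewrite Re_mul /=; under eq_Rintegral do rewrite Re_mul.
  by rewrite RintegralB// ?RintegralZl//; exact: ia.
- have ia (a : R) (h : T -> R) : mu.-integrable setT (EFin \o h) ->
    mu.-integrable setT (EFin \o (fun x => a * h x)).
    by move=> ih; rewrite /comp; under eq_fun do rewrite EFinM; exact: integrableZl.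
  rewrite Im_mul /=; under eq_Rintegral do rewrite Im_mul.
  by rewrite RintegralD// ?RintegralZl//; exact: ia.
Qed.

Lemma cintN f : cintg mu f -> cint mu (fun x => - f x) = - cint mu f.
Proof.
by move=> /(cintZ (-1)); under eq_fun do rewrite mulN1r; rewrite mulN1r.
Qed.

Lemma cintB f g : cintg mu f -> cintg mu g ->
  cint mu (fun x => f x - g x) = cint mu f - cint mu g.
Proof. by move=> cf cg; rewrite cintD ?cintN//; exact: cintgN. Qed.

Lemma cintJ f : cintg mu f -> cint mu (fun x => (f x)^*) = (cint mu f)^*.
Proof.
move=> [rf jf]; rewrite /cint; apply: complex_ext => /=.
  by apply: eq_Rintegral => x _; case: (f x).
rewrite -mulN1r -RintegralZl//.
by apply: eq_Rintegral => x _; case: (f x) => a b /=; rewrite mulN1r.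
Qed.

(** Real and imaginary parts are estimated separately, which costs the factor 2; most factors 2 in
    later constants originate here. *)
Lemma normc_cint f (h : T -> R) : cmeas f ->
  mu.-integrable setT (EFin \o h) -> (forall x, normc (f x) <= h x) ->
  normc (cint mu f) <= 2 * \int[mu]_x h x.
Proof.
move=> mf ih fh; have [rf jf] := le_cintg mf ih fh.
apply: le_trans (normc_le _) _; rewrite mulr_natl mulr2n; apply: lerD => /=.
- apply: le_trans (le_normr_Rintegral _ _) _ => //.
  apply: le_Rintegral => //; first exact: integrable_norm.
  by move=> x _; exact: le_trans (ler_Re _) _.
- apply: le_trans (le_normr_Rintegral _ _) _ => //.
  apply: le_Rintegral => //; first exact: integrable_norm.
  by move=> x _; exact: le_trans (ler_Im _) _.
Qed.

Lemma eq_cint f g : f =1 g -> cint mu f = cint mu g.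
Proof. by move=> /funext ->. Qed.

Lemma cint_real (h : T -> R) : cint mu (fun x => (h x)%:C) = (\int[mu]_x h x)%:C.
Proof.
by rewrite /cint /real_complex_def /=; congr (_ +i* _); rewrite Rintegral_cst// mul0r.
Qed.

Lemma cintg_real (h : T -> R) : mu.-integrable setT (EFin \o h) ->
  cintg mu (fun x => (h x)%:C).
Proof. by move=> ih; split => //=; exact: integrable0. Qed.

Lemma cint_dominated (F : nat -> T -> R[i]) f (h : T -> R) :
  (forall n, cmeas (F n)) -> cmeas f ->
  (forall x, complex.Re (F n x) @[n --> \oo] --> complex.Re (f x)) ->
  (forall x, complex.Im (F n x) @[n --> \oo] --> complex.Im (f x)) ->
  mu.-integrable setT (EFin \o h) ->
  (forall n x, normc (F n x) <= h x) ->
  complex.Re (cint mu (F n)) @[n --> \oo] --> complex.Re (cint mu f) /\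
  complex.Im (cint mu (F n)) @[n --> \oo] --> complex.Im (cint mu f).
Proof.
move=> mF [mr mi] Fr Fi ih Fh.
have key (p : R[i] -> R) : (forall z, `|p z| <= normc z) ->
    (forall n, measurable_fun setT (p \o F n)) -> measurable_fun setT (p \o f) ->
    (forall x, p (F n x) @[n --> \oo] --> p (f x)) ->
    \int[mu]_x p (F n x) @[n --> \oo] --> \int[mu]_x p (f x).
  move=> pb mpF mpf pF.
  have [ipf _ L] := @dominated_convergence _ _ _ mu setT measurableT
    (fun n x => (p (F n x))%:E) (fun x => (p (f x))%:E) (EFin \o h)
    (fun n => proj2 (measurable_EFinP _ _) (mpF n)) (proj2 (measurable_EFinP _ _) mpf)
    ltac:(by apply: aeW => x _; apply: cvg_EFin; [exact: nearW | exact: pF])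
    ih ltac:(by apply: aeW => x n _; rewrite lee_fin; exact: le_trans (pb _) (Fh n x)).
  apply: fine_cvg; rewrite /Rintegral fineK//.
  exact: integrable_fin_num.
by split; apply: key => //; [exact: ler_Re | move=> n; have [] := mF n
  | exact: ler_Im | move=> n; have [] := mF n].
Qed.

End fixed_measure.
End complex_integral.

Lemma cmeas_comp {R : realType} d d' (T : measurableType d) (T' : measurableType d')
    (f : T' -> R[i]) (g : T -> T') :
  cmeas f -> measurable_fun setT g -> cmeas (fun x => f (g x)).
Proof.
by move=> [rf jf] mg; split; [exact: measurableT_comp rf mg | exact: measurableT_comp jf mg].
Qed.

Section complex_fubini.
Context {R : realType} d1 d2 (T1 : measurableType d1) (T2 : measurableType d2).
Variables (m1 : {sigma_finite_measure set T1 -> \bar R}).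
Variables (m2 : {sigma_finite_measure set T2 -> \bar R}).

(* All slices are assumed integrable: the real-valued integral of a slice that
   is not takes a junk value. *)
Lemma Rintegral_fubini (f : T1 * T2 -> R) :
  (m1 \x m2)%E.-integrable setT (EFin \o f) ->
  (forall x, m2.-integrable setT (fun y => (f (x, y))%:E)) ->
  (forall y, m1.-integrable setT (fun x => (f (x, y))%:E)) ->
  \int[(m1 \x m2)%E]_z f z = \int[m1]_x \int[m2]_y f (x, y) /\
  \int[(m1 \x m2)%E]_z f z = \int[m2]_y \int[m1]_x f (x, y).
Proof.
move=> fi f1 f2; split; congr fine.
- rewrite -integral12_prod_meas1//; apply: eq_integral => x _.
  by rewrite /fubini_F /Rintegral fineK//; exact: integrable_fin_num.
- rewrite -integral21_prod_meas1//; apply: eq_integral => x _.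
  by rewrite /fubini_G /Rintegral fineK//; exact: integrable_fin_num.
Qed.

Lemma cint_fubini (f : T1 * T2 -> R[i]) :
  cintg (m1 \x m2)%E f ->
  (forall x, cintg m2 (fun y => f (x, y))) ->
  (forall y, cintg m1 (fun x => f (x, y))) ->
  cint (m1 \x m2)%E f = cint m1 (fun x => cint m2 (fun y => f (x, y))) /\
  cint (m1 \x m2)%E f = cint m2 (fun y => cint m1 (fun x => f (x, y))).
Proof.
move=> [rf jf] f1 f2.
have [r1 r2] := Rintegral_fubini rf (fun x => (f1 x).1) (fun x => (f2 x).1).
have [i1 i2] := Rintegral_fubini jf (fun x => (f1 x).2) (fun x => (f2 x).2).
by split; apply: complex_ext.
Qed.

Lemma integrable_tensor (a : T1 -> R) (b : T2 -> R) :
  m1.-integrable setT (EFin \o a) -> m2.-integrable setT (EFin \o b) ->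
  (m1 \x m2)%E.-integrable setT (fun z => (a z.1 * b z.2)%:E).
Proof.
move=> ia ib; have [ma _] := integrableP _ _ _ ia; have [mb ob] := integrableP _ _ _ ib.
apply/integrable12ltyP.
  apply/measurable_EFinP; apply: measurable_funM.
    exact: (measurableT_comp (proj1 (measurable_EFinP _ _) ma) measurable_fst).
  exact: (measurableT_comp (proj1 (measurable_EFinP _ _) mb) measurable_snd).
under eq_integral.
  move=> x _; under eq_integral do rewrite /= normrM EFinM.
  rewrite ge0_integralZl//; last first.
    by apply/measurable_EFinP; apply: measurableT_comp => //; exact/measurable_EFinP.
  over.
rewrite /=.
have fb : (\int[m2]_x `|b x|%:E)%E \is a fin_num.
  by rewrite ge0_fin_numE//; exact: integral_ge0.
rewrite -(fineK fb) ge0_integralZr//.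
- rewrite fineK//; apply: lte_mul_pinfty.
  + exact: integral_ge0.
  + rewrite ge0_fin_numE; last exact: integral_ge0.
    by have [] := integrableP _ _ _ ia.
  + by rewrite -ge0_fin_numE//; exact: integral_ge0.
- by apply/measurable_EFinP; apply: measurableT_comp => //; exact/measurable_EFinP.
- by rewrite lee_fin fine_ge0//; exact: integral_ge0.
Qed.

Lemma cintg_tensor (h : T1 * T2 -> R[i]) (a : T1 -> R) (b : T2 -> R) :
  cmeas h ->
  m1.-integrable setT (EFin \o a) -> m2.-integrable setT (EFin \o b) ->
  (forall x y, normc (h (x, y)) <= a x * b y) ->
  cintg (m1 \x m2)%E h.
Proof.
move=> mh ia ib hab.
by apply: le_cintg (integrable_tensor ia ib) _ => // -[x y]; exact: hab.
Qed.

Lemma cmeas_xsec (h : T1 * T2 -> R[i]) x : cmeas h -> cmeas (fun y => h (x, y)).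
Proof. by move=> mh; apply: (cmeas_comp mh); exact: measurable_pair1. Qed.

Lemma cmeas_ysec (h : T1 * T2 -> R[i]) y : cmeas h -> cmeas (fun x => h (x, y)).
Proof. by move=> mh; apply: (cmeas_comp mh); exact: measurable_pair2. Qed.

(** A majorant in tensor form makes every slice integrable, not merely almost every one, as
    [cint_fubini] demands. *)
Lemma fubini_tensor (h : T1 * T2 -> R[i]) (a : T1 -> R) (b : T2 -> R) :
  cmeas h ->
  m1.-integrable setT (EFin \o a) -> m2.-integrable setT (EFin \o b) ->
  (forall x y, normc (h (x, y)) <= a x * b y) ->
  cint (m1 \x m2)%E h = cint m1 (fun x => cint m2 (fun y => h (x, y))) /\
  cint (m1 \x m2)%E h = cint m2 (fun y => cint m1 (fun x => h (x, y))).
Proof.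
move=> mh ia ib hab; apply: cint_fubini.
- exact: cintg_tensor ia ib hab.
- move=> x; apply: (@le_cintg _ _ _ _ _ (fun y => a x * b y)) => //.
    exact: cmeas_xsec.
  by rewrite /comp; under eq_fun do rewrite EFinM; exact: integrableZl.
- move=> y; apply: (@le_cintg _ _ _ _ _ (fun x => a x * b y)) => //.
    exact: cmeas_ysec.
  by rewrite /comp; under eq_fun do rewrite EFinM; exact: integrableZr.
Qed.

End complex_fubini.

(** * Measurability and integration on row vectors *)

Section rV_topology.
Context {R : realType}.

Lemma rV_ballP m (x y : 'rV[R]_m) (e : R) : 0 < e ->
  ball x e y <-> forall i, `|x ord0 i - y ord0 i| < e.
Proof.
move=> e0; split=> [[_ xy] i|xy]; first exact: xy.
by split => // i j; rewrite (ord1 i); exact: xy.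
Qed.

Lemma rV_box_measurable m (Y : 'I_m -> set R) : (forall i, measurable (Y i)) ->
  measurable [set x : 'rV[R]_m | forall i, Y i (x ord0 i)].
Proof.
move=> mY.
rewrite (_ : [set x | _] =
    \big[setI/setT]_(i < m) ((fun x : 'rV[R]_m => x ord0 i) @^-1` Y i)).
  apply: bigsetI_measurable => i _.
  by have := @measurable_coord R m i measurableT _ (mY i); rewrite setTI.
rewrite -bigcap_seq; apply/seteqP; split => x /=.
  by move=> xY i _; exact: xY.
by move=> xY i; apply: xY => /=; exact: mem_index_enum.
Qed.

(** The sigma-algebra is the product one, so U has to be exhausted by countably many boxes: those of
    rational centre and radius 1/(n+1) that it contains. *)
Lemma rV_open_measurable m (U : set 'rV[R]_m) : open U -> measurable U.
Proof.
move=> oU.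
pose box (p : 'rV[rat]_m * nat) : set 'rV[R]_m :=
  [set x | forall i, `|ratr (p.1 ord0 i) - x ord0 i| < p.2.+1%:R^-1].
have mbox p : measurable (box p).
  apply: (rV_box_measurable (Y := fun i => ball (ratr (p.1 ord0 i) : R) p.2.+1%:R^-1)) => i.
  exact: measurable_ball.
rewrite (_ : U = \bigcup_p (if `[< box p `<=` U >] then box p else set0)).
  apply: countable_bigcupT_measurable; first exact: countableP.
  by move=> p; case: ifP => // _; exact: measurable0.
apply/seteqP; split=> [x Ux|x [p _]]; last by case: asboolP => // /[apply].
have /nbhs_ballP[e /= e0 xe] : nbhs x U by exact: open_nbhs_nbhs.
(* A rational centre within 1/(n+1) of x gives a box that contains x and whose points are within
   2/(n+1) < e of x. *)
have [n ne] : exists n : nat, n.+1%:R^-1 < e / 2.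
  have [n _ /(_ n (leqnn n))] := near_infty_natSinv_lt (PosNum (divr_gt0 e0 (ltr0Sn R 1))).
  by exists n.
have /choice[q qP] (i : 'I_m) : exists q : rat, `|ratr q - x ord0 i| < n.+1%:R^-1 :> R.
  have n0 : x ord0 i - n.+1%:R^-1 < x ord0 i + n.+1%:R^-1.
    by rewrite ltrBlDr -addrA ltrDl addr_gt0.
  have [q] := rat_in_itvoo n0.
  by rewrite in_itv /= => qx; exists q; rewrite distrC ltr_distlC.
exists (\row_i q i, n) => //=.
have bx : box (\row_i q i, n) x by move=> i /=; rewrite mxE.
case: asboolP => // -[] y /= yb; apply: xe; apply/rV_ballP => // i.
have := yb i; rewrite !mxE => yi; have := qP i; rewrite distrC => xi.
rewrite (_ : x ord0 i - y ord0 i = (x ord0 i - ratr (q i)) + (ratr (q i) - y ord0 i)); last by ring.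
by apply: le_lt_trans (ler_normD _ _) _; rewrite (splitr e) ltrD// (lt_trans _ ne).
Qed.

Lemma rV_closed_measurable m (U : set 'rV[R]_m) : closed U -> measurable U.
Proof.
move=> cU; rewrite -(setCK U); apply: measurableC; apply: rV_open_measurable.
exact: closed_openC.
Qed.

Lemma rV_compact_closed m (K : set 'rV[R]_m) : compact K -> closed K.
Proof.
by apply: (@compact_closed 'rV[R]_m) => //; exact: (@norm_hausdorff R 'rV[R]_m).
Qed.

Lemma rV_compact_measurable m (K : set 'rV[R]_m) : compact K -> measurable K.
Proof. by move=> /rV_compact_closed/rV_closed_measurable. Qed.

Lemma rV_continuous_measurable m (f : 'rV[R]_m -> R) :
  continuous f -> measurable_fun setT f.
Proof.
move=> cf; apply: (measurability _ (RGenOpens.measurableE R)) => _ [_ [a [b ->] <-]].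
rewrite setTI; apply: rV_open_measurable.
by move/continuousP : cf; apply; exact: interval_open.
Qed.

Lemma ccontinuous_cmeas m (f : 'rV[R]_m -> R[i]) : ccontinuous f -> cmeas f.
Proof. by move=> [rf jf]; split; exact: rV_continuous_measurable. Qed.

End rV_topology.

Section rV_fubini.
Context {R : realType}.
Local Notation leb := (@lebesgue_measure R).

Lemma rV_cons_ord0 m (x : R) (v : 'rV[R]_m) : rV_cons (x, v) ord0 ord0 = x.
Proof.
have := @rV_consK R m (x, v); rewrite /rV_uncons => -[+ _].
by congr (_ = _); congr (rV_cons _ _ _); apply/val_inj.
Qed.

Lemma rV_cons_lift m (x : R) (v : 'rV[R]_m) (j : 'I_m) :
  rV_cons (x, v) ord0 (lift ord0 j) = v ord0 j.
Proof.
have := @rV_consK R m (x, v); rewrite /rV_uncons => -[_ /rowP /(_ j)].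
by rewrite mxE => <-; congr (rV_cons _ _ _); apply/val_inj.
Qed.

Variable m : nat.
Local Notation mu := (@lebesgue_rV R m).
Local Notation mu1 := (@lebesgue_rV R m.+1).

Lemma integrable_rVS (f : 'rV[R]_m.+1 -> R) : measurable_fun setT f ->
  (leb \x mu)%E.-integrable setT (fun z => (f (rV_cons z))%:E) ->
  mu1.-integrable setT (EFin \o f).
Proof.
move=> mf fi; apply: (@integrable_pushforward _ _ _ _ _ _ (@measurable_rV_cons R m)) => //.
exact/measurable_EFinP.
Qed.

Lemma Rintegral_rVS (f : 'rV[R]_m.+1 -> R) : measurable_fun setT f ->
  (leb \x mu)%E.-integrable setT (fun z => (f (rV_cons z))%:E) ->
  \int[mu1]_w f w = \int[(leb \x mu)%E]_z f (rV_cons z).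
Proof.
move=> mf fi; congr fine.
apply: (@integral_pushforward _ _ _ _ _ _ (@measurable_rV_cons R m)) => //.
exact/measurable_EFinP.
Qed.

Lemma cintg_rVS (f : 'rV[R]_m.+1 -> R[i]) : cmeas f ->
  cintg (leb \x mu)%E (fun z => f (rV_cons z)) -> cintg mu1 f.
Proof. by move=> [mr mi] [ir ii]; split; exact: integrable_rVS. Qed.

Lemma cint_rVS (f : 'rV[R]_m.+1 -> R[i]) : cmeas f ->
  cintg (leb \x mu)%E (fun z => f (rV_cons z)) ->
  cint mu1 f = cint (leb \x mu)%E (fun z => f (rV_cons z)).
Proof.
by move=> [mr mi] [ir ii]; apply: complex_ext; rewrite /cint /=; exact: Rintegral_rVS.
Qed.

End rV_fubini.

Section product_integral.
Context {R : realType}.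
Local Notation leb := (@lebesgue_measure R).

Lemma cmeas_coord m (k : R -> R[i]) (i : 'I_m) : cmeas (T := measurableTypeR R) k ->
  cmeas (fun x : 'rV[R]_m => k (x ord0 i)).
Proof. by move=> mk; apply: (cmeas_comp mk); exact: measurable_coord. Qed.

Lemma cint_prod m (k : 'I_m -> R -> R[i]) : (forall i, cintg leb (k i)) ->
  cintg (lebesgue_rV m) (fun x => \prod_(i < m) k i (x ord0 i)) /\
  cint (lebesgue_rV m) (fun x => \prod_(i < m) k i (x ord0 i)) =
    \prod_(i < m) cint leb (k i).
Proof.
elim: m k => [|m IH] k ik.
  under eq_fun do rewrite big_ord0.
  (* In dimension 0 the measure is a Dirac mass, so constants integrate to themselves and both empty
     products are 1. *)
  have E (c : R) : (\int[lebesgue_rV 0]_x c%:E)%E = c%:E.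
    rewrite /= integral_dirac// ?diracE ?mem_set// mul1e//.
  have I (c : R) : (lebesgue_rV 0).-integrable setT (cst c%:E).
    by apply/integrableP; split => //; rewrite /= E ltry.
  rewrite big_ord0; split; first by split; exact: I.
  by rewrite /cint /Rintegral !E.
have [iI eI] := IH (fun j => k (lift ord0 j)) (fun j => ik _).
have mk i := cintg_meas (ik i).
have mf : cmeas (fun x : 'rV[R]_m.+1 => \prod_(i < m.+1) k i (x ord0 i)).
  by apply: cmeas_prod => i; exact: cmeas_coord.
pose h (z : R * 'rV[R]_m) := k ord0 z.1 * \prod_(j < m) k (lift ord0 j) (z.2 ord0 j).
have hE z : \prod_(i < m.+1) k i (rV_cons z ord0 i) = h z.
  case: z => x v; rewrite big_ord_recl rV_cons_ord0 /h; congr (_ * _).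
  by apply: eq_bigr => j _; rewrite rV_cons_lift.
have mh : cmeas (h : measurableTypeR R * 'rV[R]_m -> R[i]).
  apply: cmeasM; first exact: (cmeas_comp (mk ord0) measurable_fst).
  exact: (cmeas_comp (cintg_meas iI) measurable_snd).
have hb x y : normc (h (x, y)) <= normc (k ord0 x) *
    normc (\prod_(j < m) k (lift ord0 j) (y ord0 j)) by rewrite normcM.
have ih : cintg (leb \x lebesgue_rV m)%E h.
  exact: (cintg_tensor mh (cintg_normc (ik ord0)) (cintg_normc iI)).
split.
  by apply: cintg_rVS => //; rewrite (funext hE).
rewrite cint_rVS//; last by rewrite (funext hE).
rewrite (funext hE) (fubini_tensor mh (cintg_normc (ik ord0)) (cintg_normc iI) hb).1.
rewrite big_ord_recl -eI.
under eq_cint => x do rewrite /h /= cintZ//.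
by under eq_cint => x do rewrite mulrC; rewrite cintZ// mulrC.
Qed.

End product_integral.

(** * Integrals over the real line *)

Section real_line_integrals.
Context {R : realType}.
Local Notation leb := (@lebesgue_measure R).

Lemma Rintegral_dominated d (T : measurableType d) (mu : {measure set T -> \bar R})
    (F : nat -> T -> R) (f h : T -> R) :
  (forall n, measurable_fun setT (F n)) -> measurable_fun setT f ->
  (forall x, F n x @[n --> \oo] --> f x) ->
  mu.-integrable setT (EFin \o h) ->
  (forall n x, `|F n x| <= h x) ->
  \int[mu]_x F n x @[n --> \oo] --> \int[mu]_x f x.
Proof.
move=> mF mf Ff ih Fh.
have [] := @cint_dominated R _ T mu (fun n x => (F n x)%:C) (fun x => (f x)%:C) h.
- by move=> n; exact: cmeas_real.
- exact: cmeas_real.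
- exact: Ff.
- by move=> x /=; exact: cvg_cst.
- exact: ih.
- by move=> n x; rewrite normc_real.
- by [].
Qed.

Lemma Rintegral_set_cvg d (T : measurableType d) (mu : {measure set T -> \bar R})
    (f : T -> R) (J : nat -> set T) (D : set T) :
  mu.-integrable setT (EFin \o f) ->
  (forall n, measurable (J n)) -> measurable D ->
  (forall x, \forall n \near \oo, J n x <-> D x) ->
  \int[mu]_(x in J n) f x @[n --> \oo] --> \int[mu]_(x in D) f x.
Proof.
move=> fi mJ mD JD.
have mf : measurable_fun setT f by apply/measurable_EFinP; exact: measurable_int fi.
have mr (A : set T) : measurable A -> measurable_fun setT (f \_ A).
  move=> mA; apply/(measurable_restrictT f mA).
  exact: measurable_funTS.
rewrite Rintegral_mkcond; under eq_cvg do rewrite Rintegral_mkcond.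
apply: (@Rintegral_dominated _ _ _ _ _ (fun x => `|f x|)).
- by move=> n; exact: mr.
- exact: mr.
- move=> x; apply: cvg_near_cst; near=> n.
  have xJD : J n x <-> D x by near: n; exact: JD.
  rewrite !patchE; case: ifPn; case: ifPn => //; rewrite ?notin_setE ?inE.
    by move=> nD /xJD.
  by move=> /xJD.
- exact: integrable_norm.
- by move=> n x; rewrite patchE; case: ifPn; rewrite ?normr0 ?normr_ge0.
Unshelve. all: by end_near.
Qed.

(** [F] is differentiable on the whole line with derivative [G], but [G] agrees with [f] only inside
    the interval. This suits integrands containing |x|: each half has a primitive that is smooth
    across the corner at 0. *)
Lemma Rintegral_FTC2 (f F G : R -> R) (a b : R) : a < b -> continuous f ->
  (forall x : R, is_derive x 1 F (G x)) -> (forall x, a < x < b -> G x = f x) ->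
  \int[leb]_(x in `[a, b]) f x = F b - F a.
Proof.
move=> ab cf dFG Ff.
have dF x : derivable F x 1 by exact: ex_derive.
have cF : continuous F.
  by move=> x; apply: differentiable_continuous; exact/derivable1_diffP/dF.
rewrite /Rintegral (@continuous_FTC2 R f F)//.
- exact: continuous_subspaceT.
- split.
  + by move=> x _; exact: dF.
  + exact: cvg_at_right_filter (cF _).
  + exact: cvg_at_left_filter (cF _).
- by move=> x; rewrite in_itv derive1E derive_val; exact: Ff.
Qed.

Lemma integral_halfy (f F G : R -> R) (L : R) :
  leb.-integrable setT (EFin \o f) -> continuous f ->
  (forall x : R, is_derive x 1 F (G x)) -> (forall x, 0 < x -> G x = f x) ->
  F n%:R @[n --> \oo] --> L ->
  \int[leb]_(x in `[0, +oo[) f x = L - F 0.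
Proof.
move=> fi cf dF Ff FL.
have c1 : \int[leb]_(x in `[0, n.+1%:R]) f x @[n --> \oo] --> L - F 0.
  rewrite (_ : (fun n => _) = (fun n : nat => F n.+1%:R - F 0)).
    by apply: cvgB; [move: FL; rewrite -(cvg_shiftS (fun n => F n%:R)) | exact: cvg_cst].
  apply/funext => n; apply: (Rintegral_FTC2 _ _ dF) => // x /andP[x0 _]; exact: Ff.
have c2 : \int[leb]_(x in `[0, n.+1%:R]) f x @[n --> \oo] -->
    \int[leb]_(x in `[0, +oo[) f x.
  apply: Rintegral_set_cvg => // x; near=> n => /=; rewrite !in_itv/= andbT.
  rewrite (_ : x <= n.+1%:R) ?andbT//.
  near: n; have /cvgryPge/(_ x) := @cvgr_idn R.
  by apply: filterS => n /le_trans; apply; rewrite ler_nat.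
exact: (cvg_unique _ c2 c1).
Unshelve. all: by end_near.
Qed.

Lemma integral_halfNy (f F G : R -> R) (L : R) :
  leb.-integrable setT (EFin \o f) -> continuous f ->
  (forall x : R, is_derive x 1 F (G x)) -> (forall x, x < 0 -> G x = f x) ->
  F (- n%:R) @[n --> \oo] --> L ->
  \int[leb]_(x in `]-oo, 0[) f x = F 0 - L.
Proof.
move=> fi cf dF Ff FL.
have fiD (D : set R) : measurable D -> leb.-integrable D (EFin \o f).
  by move=> mD; exact: integrableS fi.
have c1 : \int[leb]_(x in `[- n.+1%:R, 0[) f x @[n --> \oo] --> F 0 - L.
  rewrite (_ : (fun n => _) = (fun n : nat => F 0 - F (- n.+1%:R))).
    by apply: cvgB; [exact: cvg_cst | move: FL; rewrite -(cvg_shiftS (fun n => F (- n%:R)))].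
  apply/funext => n; rewrite Rintegral_itv_bndo_bndc; last exact: fiD.
  by apply: (Rintegral_FTC2 _ _ dF); rewrite ?oppr_lt0// => x /andP[_]; exact: Ff.
have c2 : \int[leb]_(x in `[- n.+1%:R, 0[) f x @[n --> \oo] -->
    \int[leb]_(x in `]-oo, 0[) f x.
  apply: Rintegral_set_cvg => // x; near=> n => /=; rewrite !in_itv/=.
  rewrite (_ : - n.+1%:R <= x)//.
  near: n; have /cvgryPge/(_ (- x)) := @cvgr_idn R.
  by apply: filterS => n nx; rewrite lerNl (le_trans nx)// ler_nat.
exact: (cvg_unique _ c2 c1).
Unshelve. all: by end_near.
Qed.

Lemma Rintegral_split (f : R -> R) : leb.-integrable setT (EFin \o f) ->
  \int[leb]_x f x = \int[leb]_(x in `]-oo, 0[) f x + \int[leb]_(x in `[0, +oo[) f x.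
Proof.
move=> fi.
have U : `]-oo, 0[%classic `|` `[0, +oo[%classic = setT :> set R.
  by rewrite -setCitvl setUv.
rewrite -U Rintegral_setU//; first by rewrite U.
by rewrite -setCitvl; apply/disj_set2P; rewrite setICr.
Qed.

Lemma integral_split_FTC (f Fp Gp Fm Gm : R -> R) (Lp Lm : R) :
  leb.-integrable setT (EFin \o f) -> continuous f ->
  (forall x : R, is_derive x 1 Fp (Gp x)) -> (forall x, 0 < x -> Gp x = f x) ->
  (forall x : R, is_derive x 1 Fm (Gm x)) -> (forall x, x < 0 -> Gm x = f x) ->
  Fp n%:R @[n --> \oo] --> Lp -> Fm (- n%:R) @[n --> \oo] --> Lm ->
  \int[leb]_x f x = (Lp - Fp 0) + (Fm 0 - Lm).
Proof.
move=> fi cf dFp Fpf dFm Fmf FLp FLm.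
rewrite Rintegral_split// addrC; congr (_ + _).
- exact: integral_halfy dFp _ _.
- exact: integral_halfNy dFm _ _.
Qed.

(** The Cauchy density up to a factor. It is the basic integrable majorant on the line, and its
    products over the coordinates ([decay]) play that role in dimension m. *)
Definition cauchyd (x : R) : R := (1 + x ^+ 2)^-1.

Lemma cauchyd_gt0 x : 0 < cauchyd x.
Proof. by rewrite invr_gt0 ltr_pwDl// sqr_ge0. Qed.

Lemma continuous_cauchyd : continuous cauchyd.
Proof.
move=> x; apply: cvgV; first by rewrite gt_eqF// ltr_pwDl// sqr_ge0.
by apply: cvgD; [exact: cvg_cst | exact: exprn_continuous].
Qed.

Lemma integrable_cauchyd : leb.-integrable setT (EFin \o cauchyd).
Proof.
apply/integrableP; split.
  apply/measurable_EFinP; apply: continuous_measurable_fun.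
  exact: continuous_cauchyd.
under eq_integral do rewrite /= ger0_norm ?ltW ?cauchyd_gt0//.
rewrite ge0_symfun_integralT; last 3 first.
- by move=> x; exact/ltW/cauchyd_gt0.
- exact: continuous_cauchyd.
- by move=> x /=; rewrite /cauchyd sqrrN.
rewrite -set_itvcy (@ge0_continuous_FTC2y R cauchyd atan 0 (pi / 2)).
- by rewrite -EFinB -EFinM ltry.
- by move=> x _; exact/ltW/cauchyd_gt0.
- by apply: continuous_subspaceT; exact: continuous_cauchyd.
- exact: cvgy_atan.
- by move=> x _; exact: ex_derive.
- by apply: cvg_at_right_filter; exact: continuous_atan.
- by move=> x _; rewrite derive1_atan.
Qed.

End real_line_integrals.

(** * Rules for directional derivatives *)

Section directional.
Context {R : realType} {V : normedModType R}.
Implicit Types (f g : V -> R) (x v : V).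

Lemma is_derive_line f x v (a : R) :
  is_derive x v f a <-> is_derive (0 : R) 1 (fun t : R => f (t *: v + x)) a.
Proof.
have E : (fun h : R => h^-1 *: (f (h *: v + x) - f x)) =
    (fun h : R => h^-1 *: ((fun t : R => f (t *: v + x)) (h *: 1 + 0) -
      (fun t : R => f (t *: v + x)) 0)).
  by apply/funext => h; rewrite addr0 scale0r add0r [h *: 1]mulr1.
split => -[d e]; split.
- by rewrite /derivable -E.
- by rewrite /derive -E.
- by rewrite /derivable E.
- by rewrite /derive E.
Qed.

Lemma is_derive_mul f g x v (a b : R) : is_derive x v f a -> is_derive x v g b ->
  is_derive x v (fun y => f y * g y) (a * g x + f x * b).
Proof. by move=> fa gb; apply: is_derive_eq; rewrite addrC [X in X + _]mulrC mulrC. Qed.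

Lemma is_derive_add f g x v (a b : R) : is_derive x v f a -> is_derive x v g b ->
  is_derive x v (fun y => f y + g y) (a + b).
Proof. by move=> fa gb; exact: is_deriveD. Qed.

Lemma is_derive_sub f g x v (a b : R) : is_derive x v f a -> is_derive x v g b ->
  is_derive x v (fun y => f y - g y) (a - b).
Proof. by move=> fa gb; exact: is_deriveB. Qed.

Lemma is_derive_opp f x v (a : R) : is_derive x v f a ->
  is_derive x v (fun y => - f y) (- a).
Proof. by move=> fa; exact: is_deriveN. Qed.

Lemma is_derive_const (c : R) x v : is_derive x v (fun=> c : R) (0 : R).
Proof. exact: is_derive_cst. Qed.

Lemma is_derive_scal (c : R) f x v (a : R) : is_derive x v f a ->
  is_derive x v (fun y => c * f y) (c * a).
Proof.
move=> fa; have := is_derive_mul (is_derive_const c x v) fa.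
by rewrite mul0r add0r.
Qed.

Lemma is_derive_chain (h : R -> R) f x v (a b : R) :
  is_derive (f x) 1 h b -> is_derive x v f a ->
  is_derive x v (fun y => h (f y)) (b * a).
Proof.
move=> hb /is_derive_line fa; apply/is_derive_line.
apply: (@is_derive1_comp R h (fun t : R => f (t *: v + x)) 0 b a) => //.
by rewrite scale0r add0r.
Qed.

Lemma is_derive_near f g x v (a : R) : (\forall y \near x, f y = g y) ->
  is_derive x v f a -> is_derive x v g a.
Proof.
move=> fg [df ef].
have E : (fun h : R => h^-1 *: (f (h *: v + x) - f x)) @ 0^' --> a.
  by rewrite -ef; exact: df.
have fgx : f x = g x by exact: nbhs_singleton fg.
have L : (fun h : R => h^-1 *: (g (h *: v + x) - g x)) @ 0^' --> a.
  apply: cvg_trans E; apply: near_eq_cvg; near=> h; congr (_ *: (_ - _)) => //.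
  suff : f (h *: v + x) = g (h *: v + x) by [].
  near: h; apply: nbhs_dnbhs.
  have c : (fun h : R => h *: v + x) @ (0 : R) --> x.
    rewrite -[X in _ --> X]add0r -(scale0r v); apply: cvgD; last exact: cvg_cst.
    exact: scalel_continuous.
  exact: (c _ fg).
split; first by apply/cvg_ex; exists a.
exact: (cvg_lim _ L).
Unshelve. all: by end_near.
Qed.

(** A remainder C t^2 valid for all t replaces limit arguments at the points of use: linear phases
    (C = 0), the Fourier integral, and the flat function [step] at 0. *)
Lemma is_derive_quadratic f x v (a C : R) :
  (forall t : R, `|f (t *: v + x) - f x - t * a| <= C * t ^+ 2) ->
  is_derive x v f a.
Proof.
move=> fC.
have C0 : 0 <= C by have := fC 1; rewrite expr1n mulr1; exact: le_trans (normr_ge0 _).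
have L : (fun h : R => h^-1 *: (f (h *: v + x) - f x)) @ 0^' --> a.
  apply/cvgrPdist_le => e e0; near=> h.
  have h0 : h != 0 by near: h; exact: nbhs_dnbhs_neq.
  rewrite distrC.
  rewrite (_ : _ - a = h^-1 * (f (h *: v + x) - f x - h * a)); last first.
    by rewrite mulrBr mulrA mulVf// mul1r.
  rewrite normrM normfV ler_pdivrMl ?normr_gt0//.
  apply: le_trans (fC h) _.
  rewrite -real_normK ?num_real// expr2 mulrA [leRHS]mulrC ler_wpM2r//.
  have he : `|h| < e / (C + 1).
    near: h; apply: dnbhs0_lt.
    by rewrite divr_gt0// ltr_wpDl.
  have C1 : 0 < C + 1 by rewrite ltr_wpDl.
  apply: (@le_trans _ _ ((C + 1) * `|h|)); first by rewrite ler_wpM2r// lerDl.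
  by rewrite mulrC -ler_pdivlMr// ltW.
split; first by apply/cvg_ex; exists a.
exact: (cvg_lim _ L).
Unshelve. all: by end_near.
Qed.

End directional.

(** * The Abel factor and the Poisson kernel on the line *)

Section poisson_kernel.
Context {R : realType}.
Local Notation leb := (@lebesgue_measure R).

Lemma normc_expi (t : R) : normc (expi t) = 1.
Proof. by rewrite /expi /= cos2Dsin2 sqrtr1. Qed.

Lemma expiD (s t : R) : expi (s + t) = expi s * expi t.
Proof. by rewrite /expi cosD sinD; apply: complex_ext => /=; ring. Qed.

Lemma expi0 : expi (0 : R) = 1.
Proof. by rewrite /expi cos0 sin0. Qed.

Lemma expiN (t : R) : expi (- t) = (expi t)^*.
Proof. by rewrite /expi cosN sinN. Qed.

Lemma expi_sum (I : Type) (r : seq I) (F : I -> R) :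
  expi (\sum_(i <- r) F i) = \prod_(i <- r) expi (F i).
Proof. exact: (big_morph _ expiD expi0). Qed.

Definition pois (e x : R) : R := expR (- (e * `|x|)).

(** The Fourier transform of [pois e] ([cint_pois]), that is 2 pi times the Poisson kernel of the
    half-plane; hence its mass 2 pi for every e. *)
Definition pker (e z : R) : R := 2 * e / (e ^+ 2 + z ^+ 2).

Lemma pois_gt0 e x : 0 < pois e x.
Proof. exact: expR_gt0. Qed.

Lemma pois_le1 e x : 0 <= e -> pois e x <= 1.
Proof. by move=> e0; rewrite /pois -expR0 ler_expR oppr_le0 mulr_ge0. Qed.

Lemma continuous_pois e : continuous (pois e).
Proof.
move=> x; apply: (@continuous_comp _ _ _ (fun x => - (e * `|x|)) expR); last exact: continuous_expR.
by apply: cvgN; apply: cvgM; [exact: cvg_cst | exact: norm_continuous].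
Qed.

Lemma pois_le_cauchyd (e x : R) : 0 < e -> pois e x <= (1 + 4 / e ^+ 2) * cauchyd x.
Proof.
move=> e0; rewrite /cauchyd ler_pdivlMr ?ltr_pwDl ?sqr_ge0// mulrC.
rewrite /pois expRN ler_pdivrMr ?expR_gt0//.
(* With u = e |x|: 1 + u^2/4 <= (1 + u/2)^2 <= exp(u/2)^2. Multiplying by 1 + 4/e^2 restores the
   coefficient 1 of x^2. *)
have h : 1 + (e * `|x|) ^+ 2 / 4 <= expR (e * `|x|).
  rewrite {2}(splitr (e * `|x|)) expRD -expr2.
  have u0 : 0 <= e * `|x| / 2 by rewrite divr_ge0// mulr_ge0// ltW.
  apply: (@le_trans _ _ ((1 + e * `|x| / 2) ^+ 2)); first by nra.
  rewrite ler_pXn2r ?nnegrE ?expR_ge0 ?addr_ge0//.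
  exact: expR_ge1Dx.
have e2 : 0 < e ^+ 2 by rewrite exprn_gt0.
have K0 : 0 <= 1 + 4 / e ^+ 2 by rewrite addr_ge0// divr_ge0// ltW.
apply: le_trans (ler_wpM2l K0 h).
rewrite exprMn (real_normK (num_real x)).
have -> : (1 + 4 / e ^+ 2) * (1 + e ^+ 2 * x ^+ 2 / 4) =
  (1 + x ^+ 2) + (4 / e ^+ 2 + e ^+ 2 * x ^+ 2 / 4) by field; rewrite gt_eqF.
rewrite lerDl; apply: addr_ge0; first by rewrite divr_ge0// ltW.
by rewrite divr_ge0// mulr_ge0// ?sqr_ge0.
Qed.

Lemma integrable_dom (f : R -> R) (C : R) : continuous f ->
  (forall x, `|f x| <= C * cauchyd x) -> leb.-integrable setT (EFin \o f).
Proof.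
move=> cf fC.
have ic : leb.-integrable setT (EFin \o (fun x => C * cauchyd x)).
  by rewrite /comp; under eq_fun do rewrite EFinM; apply: integrableZl => //; exact: integrable_cauchyd.
apply: le_integrable ic => //; first by apply/measurable_EFinP; exact: continuous_measurable_fun.
by move=> x _ /=; rewrite lee_fin (le_trans (fC x))// ler_norm.
Qed.

Lemma integrable_pois e : 0 < e -> leb.-integrable setT (EFin \o pois e).
Proof.
move=> e0; apply: integrable_dom (@continuous_pois e) _ => x.
by rewrite ger0_norm; [exact: pois_le_cauchyd | exact/ltW/pois_gt0].
Qed.

Lemma Rintegral_pois_trig (e z a b : R) : 0 < e ->
  \int[leb]_x ((a * cos (z * x) + b * sin (z * x)) * pois e x) = a * pker e z.
Proof.
move=> e0.
have D0 : e ^+ 2 + z ^+ 2 != 0 by rewrite gt_eqF// ltr_pwDl ?sqr_ge0// exprn_gt0.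
pose q (s x : R) : R := expR (s * x).
have dq (s x : R) : is_derive x 1 (q s) (q s x * s).
  have := @is_derive_chain R R expR (fun x => s * x) x 1 s (expR (s * x)).
  apply.
  by rewrite -[X in is_derive _ _ _ X]mulr1; apply: is_derive_scal; exact: is_derive_id.
have dl (x : R) : is_derive x 1 (fun x => z * x) z.
  by rewrite -[X in is_derive _ _ _ X]mulr1; apply: is_derive_scal; exact: is_derive_id.
have ds (x : R) : is_derive x 1 (fun x => sin (z * x)) (cos (z * x) * z).
  by apply: is_derive_chain; exact: dl.
have dc (x : R) : is_derive x 1 (fun x => cos (z * x)) (- sin (z * x) * z).
  by apply: is_derive_chain; exact: dl.
(* The elementary primitive of exp(s x) (a cos(z x) + b sin(z x)). The right half-line uses s = -e
   and the left one s = e; both satisfy s^2 = e^2, so they share the denominator. *)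
pose F s x := q s x * ((a * z + b * s) * sin (z * x) + (a * s - b * z) * cos (z * x)) /
  (e ^+ 2 + z ^+ 2).
have dF (s x : R) : s ^+ 2 = e ^+ 2 -> is_derive x 1 (F s)
    ((a * cos (z * x) + b * sin (z * x)) * q s x).
  move=> se; rewrite /F.
  have := is_derive_mul (is_derive_mul (dq s x)
    (is_derive_add (is_derive_scal (a * z + b * s) (ds x))
      (is_derive_scal (a * s - b * z) (dc x))))
    (is_derive_const (e ^+ 2 + z ^+ 2)^-1 x 1).
  move=> H; apply: (is_derive_eq H); rewrite mulr0 addr0 -se; field.
  by rewrite se.
have bF s x : `|F s x| <= q s x * ((`|a * z + b * s| + `|a * s - b * z|) / (e ^+ 2 + z ^+ 2)).
  rewrite /F -mulrA normrM ger0_norm ?expR_ge0// ler_wpM2l ?expR_ge0//.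
  rewrite normrM normfV [`|e ^+ 2 + _|]ger0_norm ?addr_ge0 ?sqr_ge0//.
  rewrite ler_wpM2r ?invr_ge0 ?addr_ge0 ?sqr_ge0//.
  apply: le_trans (ler_normD _ _) _; rewrite !normrM.
  by apply: lerD; rewrite ler_piMr// ?sin_max ?cos_max.
have q0 : q (- e) n%:R @[n --> \oo] --> 0.
  have -> : (fun n : nat => q (- e) n%:R) = (fun n => expR (- e) ^+ n).
    by apply/funext => n; rewrite /q -expRM_natr.
  by apply: cvg_expr; rewrite ger0_norm ?expR_ge0// expR_lt1 oppr_lt0.
(* One statement for both ends: [u n] is n when s = -e and -n when s = e. *)
have F0 s (u : nat -> R) : (forall n, q s (u n) = q (- e) n%:R) ->
    F s (u n) @[n --> \oo] --> 0.
  move=> su; apply: norm_cvg0.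
  apply: (@squeeze_cvgr _ _ _ _ (fun=> 0) (fun n : nat => q (- e) n%:R * ((`|a * z + b * s| + `|a * s - b * z|) / (e ^+ 2 + z ^+ 2)))).
  - by apply: nearW => n; rewrite normr_ge0 -su bF.
  - exact: cvg_cst.
  - by rewrite -[X in _ --> X](mul0r ((`|a * z + b * s| + `|a * s - b * z|) / (e ^+ 2 + z ^+ 2))); apply: cvgM => //; exact: cvg_cst.
have cpc : continuous (fun x => (a * cos (z * x) + b * sin (z * x)) * pois e x).
  have cab : continuous (fun x => a * cos (z * x) + b * sin (z * x)).
    move=> x; apply: differentiable_continuous; apply/derivable1_diffP.
    by have [] := is_derive_add (is_derive_scal a (dc x)) (is_derive_scal b (ds x)).
  by move=> x; apply: cvgM; [exact: cab | exact: continuous_pois].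
rewrite (@integral_split_FTC R _ (F (- e)) _ (F e) _ 0 0 _ _
  (fun x => dF (- e) x (sqrrN e)) _ (fun x => dF e x erefl) _
  (F0 (- e) _ (fun n => erefl)) (F0 e (fun n => - n%:R) _)).
- rewrite /F /q !mulr0 expR0 sin0 cos0 /pker; field.
  exact: D0.
- apply: (@integrable_dom _ ((`|a| + `|b|) * (1 + 4 / e ^+ 2))) => // x.
  rewrite normrM [X in _ * X]ger0_norm ?(ltW (pois_gt0 _ _))// -mulrA.
  apply: ler_pM (pois_le_cauchyd x e0) => //; first exact/ltW/pois_gt0.
  apply: le_trans (ler_normD _ _) _; rewrite !normrM.
  by apply: lerD; rewrite ler_piMr// ?sin_max ?cos_max.
- exact: cpc.
- by move=> x x0; rewrite /q /pois gtr0_norm// mulNr.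
- by move=> x x0; rewrite /q /pois ltr0_norm// mulrN opprK.
- by move=> n; rewrite /q mulrN mulNr.
Qed.

Lemma pker_ge0 (e z : R) : 0 < e -> 0 <= pker e z.
Proof. by move=> e0; rewrite /pker divr_ge0 ?addr_ge0 ?sqr_ge0// mulr_ge0// ltW. Qed.

Lemma cmeas_cts (f : R -> R[i]) : continuous (fun x => complex.Re (f x)) ->
  continuous (fun x => complex.Im (f x)) -> cmeas (T := measurableTypeR R) f.
Proof. by move=> cr ci; split; exact: continuous_measurable_fun. Qed.

Lemma cmeas_expi : cmeas (T := measurableTypeR R) (@expi R).
Proof. by apply: cmeas_cts => /=; [exact: continuous_cos | exact: continuous_sin]. Qed.

Lemma cmeas_expiZ (z : R) : cmeas (T := measurableTypeR R) (fun x => expi (z * x)).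
Proof. by apply: (cmeas_comp cmeas_expi); exact: mulrl_measurable. Qed.

Lemma cintg_pois (e z : R) : 0 < e ->
  cintg leb (fun x => expi (z * x) * (pois e x)%:C).
Proof.
move=> e0; apply: (@le_cintg R _ (measurableTypeR R) leb _ (pois e)).
- apply: cmeasM; first exact: cmeas_expiZ.
  by apply: cmeas_real; apply: continuous_measurable_fun; exact: continuous_pois.
- exact: integrable_pois.
- by move=> x; rewrite normcM normc_expi mul1r normc_real ger0_norm// ltW ?pois_gt0.
Qed.

Lemma cint_pois (e z : R) : 0 < e ->
  cint leb (fun x => expi (z * x) * (pois e x)%:C) = (pker e z)%:C.
Proof.
move=> e0; apply: complex_ext; rewrite /cint /real_complex_def /=.
- rewrite -[RHS]mul1r -(Rintegral_pois_trig z 1 0 e0); apply: eq_Rintegral => x _.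
  by rewrite /=; ring.
- rewrite -[RHS](mul0r (pker e z)) -(Rintegral_pois_trig z 0 1 e0).
  by apply: eq_Rintegral => x _; rewrite /=; ring.
Qed.

(** From 1 + x^2 <= 1 + 2 y^2 + 2 (x - y)^2. The constant may depend on e and y, since it serves
    only the integrability of one kernel at a time. *)
Lemma pker_le_cauchyd (e y x : R) : 0 < e ->
  pker e (x - y) <= 2 * e * ((1 + 2 * y ^+ 2) / e ^+ 2 + 2) * cauchyd x.
Proof.
move=> e0; have e2 : 0 < e ^+ 2 by rewrite exprn_gt0.
have D0 : 0 < e ^+ 2 + (x - y) ^+ 2 by rewrite ltr_pwDl// sqr_ge0.
rewrite /cauchyd ler_pdivlMr ?ltr_pwDl ?sqr_ge0// /pker mulrAC ler_pdivrMr// -[leRHS]mulrA.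
rewrite ler_pM2l ?mulr_gt0//.
have -> : ((1 + 2 * y ^+ 2) / e ^+ 2 + 2) * (e ^+ 2 + (x - y) ^+ 2) =
  (1 + 2 * y ^+ 2) + 2 * e ^+ 2 + 2 * (x - y) ^+ 2 +
   (1 + 2 * y ^+ 2) / e ^+ 2 * (x - y) ^+ 2 by field; rewrite gt_eqF.
have h : 0 <= (1 + 2 * y ^+ 2) / e ^+ 2 * (x - y) ^+ 2.
  by rewrite mulr_ge0 ?sqr_ge0// divr_ge0 ?(ltW e2)// addr_ge0// mulr_ge0// sqr_ge0.
apply: le_trans (_ : _ <= (1 + 2 * y ^+ 2) + 2 * e ^+ 2 + 2 * (x - y) ^+ 2) _; last by rewrite lerDl.
rewrite -subr_ge0.
have -> : 1 + 2 * y ^+ 2 + 2 * e ^+ 2 + 2 * (x - y) ^+ 2 - (1 + x ^+ 2) =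
  2 * e ^+ 2 + (x - 2 * y) ^+ 2 by ring.
by rewrite addr_ge0 ?sqr_ge0// mulr_ge0// ltW.
Qed.

Lemma is_derive_atan_affine (e y x : R) : e != 0 ->
  is_derive x 1 (fun x => 2 * atan ((x - y) / e)) (pker e (x - y)).
Proof.
move=> e0.
have dl : is_derive x 1 (fun x => (x - y) / e) e^-1.
  have := is_derive_mul (is_derive_sub (is_derive_id x (1 : R)) (is_derive_const y x 1))
    (is_derive_const e^-1 x 1).
  by move=> H; apply: (is_derive_eq H); rewrite mulr0 addr0 subr0 mul1r.
have := is_derive_scal 2 (@is_derive_chain R R atan _ x 1 _ _ (is_derive1_atan _) dl).
move=> H; apply: (is_derive_eq H); rewrite /pker; field.
have D0 : e ^+ 2 + (x - y) ^+ 2 != 0.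
  by rewrite gt_eqF// ltr_pwDl ?sqr_ge0// exprn_even_gt0.
by rewrite D0 e0.
Qed.

Lemma continuous_pker (e y : R) : 0 < e -> continuous (fun x => pker e (x - y)).
Proof.
move=> e0 x; apply: cvgM; first exact: cvg_cst.
apply: cvgV; first by rewrite gt_eqF// ltr_pwDl ?sqr_ge0// exprn_gt0.
apply: cvgD; first exact: cvg_cst.
apply: (@continuous_comp _ _ _ (fun x => x - y) (fun z => z ^+ 2)); last exact: exprn_continuous.
by apply: cvgB; [exact: cvg_id | exact: cvg_cst].
Qed.

Lemma integrable_pker (e y : R) : 0 < e ->
  leb.-integrable setT (EFin \o (fun x => pker e (x - y))).
Proof.
move=> e0; apply: integrable_dom (continuous_pker e0) _ => x.
by rewrite ger0_norm ?pker_ge0//; exact: pker_le_cauchyd.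
Qed.

Lemma Rintegral_pker (e y : R) : 0 < e -> \int[leb]_x pker e (x - y) = 2 * pi.
Proof.
move=> e0; have e0' : e != 0 by rewrite gt_eqF.
have L (c : R) : 2 * atan ((n%:R - c) / e) @[n --> \oo] --> pi.
  rewrite (_ : pi = 2 * (pi / 2)); last by field.
  apply: cvgM; first exact: cvg_cst.
  apply: (@cvg_comp _ _ _ (fun n : nat => (n%:R - c) / e) atan _ +oo); last exact: cvgy_atan.
  apply/cvgryPge => A; near=> n; rewrite ler_pdivlMr// lerBrDr.
  by near: n; have /cvgryPge/(_ (A * e + c)) := @cvgr_idn R.
rewrite (@integral_split_FTC R _ (fun x => 2 * atan ((x - y) / e)) _
  (fun x => 2 * atan ((x - y) / e)) _ pi (- pi) (integrable_pker y e0) (continuous_pker e0)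
  (fun x => is_derive_atan_affine y x e0') _ (fun x => is_derive_atan_affine y x e0') _ (L y) _)//.
- ring.
- rewrite (_ : (fun n => _) = (fun n : nat => - (2 * atan ((n%:R - (- y)) / e)))).
    exact: cvgN.
  by apply/funext => n; rewrite opprK -mulrN -atanN -mulNr opprD.
Unshelve. all: by end_near.
Qed.

End poisson_kernel.

(** * The Fourier integral *)

Section expi_bounds.
Context {R : realType}.

Lemma is_derive_continuous (f df : R -> R) :
  (forall x : R, is_derive x 1 f (df x)) -> continuous f.
Proof.
move=> fdf x; apply: differentiable_continuous; apply/derivable1_diffP.
by have [] := fdf x.
Qed.

Lemma MVT_le (f df : R -> R) (C : R) (a b : R) :
  (forall x : R, is_derive x 1 f (df x)) -> (forall x, `|df x| <= C) ->
  `|f b - f a| <= C * `|b - a|.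
Proof.
move=> fdf dfC.
have cf := is_derive_continuous fdf.
wlog ab : a b / a <= b.
  move=> H; have [/H//|/ltW/H] := leP a b.
  by rewrite distrC (distrC a).
have [c _ ->] := MVT_segment ab (fun x _ => fdf x) (continuous_subspaceT cf).
by rewrite normrM ler_wpM2r.
Qed.

Lemma sin_lip (a b : R) : `|sin b - sin a| <= `|b - a|.
Proof.
rewrite -[leRHS]mul1r.
exact: (MVT_le a b (fun x => is_derive_sin x) (fun x => cos_max x)).
Qed.

Lemma cos_lip (a b : R) : `|cos b - cos a| <= `|b - a|.
Proof.
have h (x : R) : `|- sin x| <= 1 by rewrite normrN sin_max.
rewrite -[leRHS]mul1r.
exact: (MVT_le a b (fun x => is_derive_cos x) h).
Qed.

Lemma expi_lip (a b : R) : normc (expi b - expi a) <= 2 * `|b - a|.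
Proof.
rewrite mulr_natl mulr2n; apply: le_trans (normc_le _) _.
by apply: lerD => /=; [exact: cos_lip | exact: sin_lip].
Qed.

Lemma cos_taylor (t : R) : `|cos t - 1| <= t ^+ 2.
Proof.
have dl (x : R) : is_derive x 1 (fun x => cos (t * x)) (- sin (t * x) * t).
  apply: is_derive_chain.
  by rewrite -[X in is_derive _ _ _ X]mulr1; apply: is_derive_scal; exact: is_derive_id.
have [x /andP[x0 x1]] := @MVT_segment R (fun x => cos (t * x)) _ 0 1 ler01 (fun x _ => dl x)
  (continuous_subspaceT (is_derive_continuous dl)).
rewrite mulr1 mulr0 cos0 => ->; rewrite subr0 mulr1 normrM normrN.
rewrite -(real_normK (num_real t)) expr2 ler_wpM2r//.
have := sin_lip 0 (t * x); rewrite sin0 !subr0 => /le_trans; apply.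
by rewrite normrM ler_piMr// ger0_norm.
Qed.

Lemma sin_taylor (t : R) : `|sin t - t| <= t ^+ 2.
Proof.
have dl (x : R) : is_derive x 1 (fun x => sin (t * x) - t * x) (cos (t * x) * t - t).
  have d1 : is_derive x 1 (fun x => t * x) t.
    by rewrite -[X in is_derive _ _ _ X]mulr1; apply: is_derive_scal; exact: is_derive_id.
  by apply: is_derive_sub => //; apply: is_derive_chain.
have [x /andP[x0 x1]] := @MVT_segment R (fun x => sin (t * x) - t * x) _ 0 1 ler01 (fun x _ => dl x)
  (continuous_subspaceT (is_derive_continuous dl)).
rewrite mulr1 mulr0 sin0 !subr0 mulr1 => ->.
rewrite (_ : _ - t = (cos (t * x) - 1) * t); last by ring.
rewrite normrM.
rewrite -(real_normK (num_real t)) expr2 ler_wpM2r//.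
have := cos_lip 0 (t * x); rewrite cos0 !subr0 => /le_trans; apply.
by rewrite normrM ler_piMr// ger0_norm.
Qed.

Lemma expi_taylor (t : R) : normc (expi t - 1 - 'i * t%:C) <= 2 * t ^+ 2.
Proof.
rewrite mulr_natl mulr2n; apply: le_trans (normc_le _) _.
rewrite !(Re_add, Im_add, Re_opp, Im_opp, Re_mul, Im_mul) /= !(mul0r, mul1r, mulr0, subr0, add0r, addr0, oppr0).
apply: lerD; first exact: cos_taylor.
exact: sin_taylor.
Qed.

End expi_bounds.

Lemma rV_coord_le {R : realType} m (x : 'rV[R]_m) i : `|x ord0 i| <= `|x|.
Proof.
by rewrite [leRHS]/Num.Def.normr /= mx_normrE; apply/bigmax_geP; right => /=; exists (ord0, i).
Qed.

Section fourier_integral.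
Context {R : realType} {m : nat}.
Local Notation V := 'rV[R]_m.
Local Notation mu := (@lebesgue_rV R m).
Implicit Types (f g : V -> R[i]) (x y xi : V).

(** The Fourier integral without (2 pi)^(-m/2); the factor is restored by [fourierE] where the
    normalization matters. *)
Definition ft f : V -> R[i] := fun xi => cint mu (fun x => expi (- dotp xi x) * f x).

Lemma fourierE f : fourier f = fun xi => ((2 * pi) `^ (- (m%:R / 2)))%:C * ft f xi.
Proof. by []. Qed.

Lemma dotpC x y : dotp x y = dotp y x.
Proof. by apply: eq_bigr => i _; rewrite mulrC. Qed.

Lemma dotpDl x y z : dotp (x + y) z = dotp x z + dotp y z.
Proof. by rewrite -big_split; apply: eq_bigr => i _; rewrite mxE mulrDl. Qed.

Lemma dotpNl x y : dotp (- x) y = - dotp x y.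
Proof. by rewrite -sumrN; apply: eq_bigr => i _; rewrite mxE mulNr. Qed.

Lemma dotpZl (a : R) x y : dotp (a *: x) y = a * dotp x y.
Proof. by rewrite /dotp mulr_sumr; apply: eq_bigr => i _; rewrite mxE mulrA. Qed.

Lemma dotp_delta (i : 'I_m) y : dotp (delta_mx ord0 i) y = y ord0 i.
Proof.
rewrite /dotp (bigD1 i)//= !mxE !eqxx mul1r big1 ?addr0// => j ji.
by rewrite !mxE (negbTE ji) andbF mul0r.
Qed.

Lemma measurable_dotp2 :
  measurable_fun setT (fun z : V * V => dotp z.1 z.2).
Proof.
apply: measurable_sum => i; apply: measurable_funM.
- exact: (measurableT_comp (measurable_coord i) measurable_fst).
- exact: (measurableT_comp (measurable_coord i) measurable_snd).
Qed.

Lemma cmeas_expi_comp d (T : measurableType d) (h : T -> R) :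
  measurable_fun setT h -> cmeas (fun t => expi (h t)).
Proof. by move=> mh; exact: (cmeas_comp (@cmeas_expi R) mh). Qed.

Lemma measurable_dotp xi : measurable_fun setT (fun x : V => dotp xi x).
Proof.
by apply: measurable_sum => i; apply: measurable_funM => //; exact: measurable_coord.
Qed.

Lemma cintg_expi (h : V -> R) f : measurable_fun setT h -> cintg mu f ->
  cintg mu (fun x => expi (h x) * f x).
Proof.
move=> mh fi; apply: le_cintg (cintg_normc fi) _.
  by apply: cmeasM; [exact: cmeas_expi_comp | exact: cintg_meas fi].
by move=> x; rewrite normcM normc_expi mul1r.
Qed.

Lemma cintg_kernel xi f : cintg mu f -> cintg mu (fun x => expi (- dotp xi x) * f x).
Proof. by apply: cintg_expi; apply: measurable_funN; exact: measurable_dotp. Qed.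

Lemma normc_ft f xi : cintg mu f ->
  normc (ft f xi) <= 2 * \int[mu]_x normc (f x).
Proof.
move=> fi; apply: normc_cint.
- exact: cintg_meas (cintg_kernel _ fi).
- exact: cintg_normc.
- by move=> x; rewrite normcM normc_expi mul1r.
Qed.

Lemma ft_lin (a : R[i]) f g : cintg mu f -> cintg mu g ->
  ft (fun x => a * f x + g x) = fun xi => a * ft f xi + ft g xi.
Proof.
move=> fi gi; apply/funext => xi; rewrite /ft.
under eq_cint => x do rewrite mulrDr mulrCA.
rewrite cintD ?cintZ//; first exact: cintg_kernel.
- by apply: cintgZ; exact: cintg_kernel.
- exact: cintg_kernel.
Qed.

(** The kernel is symmetric in its two variables, so Fubini moves the transform from one factor to
    the other. Inversion, the L^2 bound and the densities of regular distributions all rest on this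
    formula. *)
Lemma ft_mult f g : cintg mu f -> cintg mu g ->
  cint mu (fun x => f x * ft g x) = cint mu (fun x => ft f x * g x).
Proof.
move=> fi gi.
pose h (z : V * V) := f z.1 * (expi (- dotp z.1 z.2) * g z.2).
have mh : cmeas h.
  apply: cmeasM; first exact: (cmeas_comp (cintg_meas fi) measurable_fst).
  apply: cmeasM; last exact: (cmeas_comp (cintg_meas gi) measurable_snd).
  by apply: cmeas_expi_comp; apply: measurable_funN; exact: measurable_dotp2.
have hb x y : normc (h (x, y)) <= normc (f x) * normc (g y).
  by rewrite /h /= !normcM normc_expi mul1r.
have [e1 e2] := fubini_tensor mh (cintg_normc fi) (cintg_normc gi) hb.
transitivity (cint (mu \x mu)%E h).
  rewrite e1; apply: eq_cint => x; rewrite /h /= cintZ//.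
  exact: cintg_kernel.
rewrite e2; apply: eq_cint => y; rewrite /h /= /ft mulrC -cintZ.
  by apply: eq_cint => x; rewrite dotpC; ring.
exact: cintg_kernel.
Qed.

(** First moments make [ft f] Lipschitz, hence continuous and measurable. Schwartz functions and
    bounded measurable functions of compact support both qualify. *)
Definition moment1 f := cintg mu f /\ forall i, cintg mu (fun x => (x ord0 i)%:C * f x).

Lemma ft_lip f : moment1 f -> exists2 C : R, 0 <= C &
  forall xi eta, normc (ft f xi - ft f eta) <= C * `|xi - eta|.
Proof.
move=> [fi xfi].
pose S x := \sum_i normc ((x ord0 i)%:C * f x).
have iS : mu.-integrable setT (EFin \o S).
  rewrite /comp /S; under eq_fun do rewrite -sumEFin.
  apply: integrable_sum => // i _.
  exact: (cintg_normc (xfi i)).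
have S0 x : 0 <= S x by apply: sumr_ge0 => i _; exact: normc_ge0.
exists (2 * (2 * \int[mu]_x S x)).
  by rewrite mulr_ge0// mulr_ge0//; apply: Rintegral_ge0 => x _.
move=> xi eta; rewrite /ft -cintB; [|exact: cintg_kernel|exact: cintg_kernel].
rewrite -!mulrA -[(_ * `|xi - eta|)]mulrC -RintegralZl// -RintegralZl//; last first.
  by rewrite /comp; under eq_fun do rewrite EFinM; exact: integrableZl.
apply: normc_cint.
- exact: cintg_meas (cintgB (cintg_kernel xi fi) (cintg_kernel eta fi)).
- do 2 (rewrite /comp; under eq_fun do rewrite EFinM; apply: integrableZl => //).
- move=> x; rewrite -mulrBl normcM.
  apply: (@le_trans _ _ (2 * `|dotp (xi - eta) x| * normc (f x))).
    rewrite ler_wpM2r ?normc_ge0//; apply: le_trans (expi_lip _ _) _.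
    by rewrite -opprB normrN opprK -dotpNl -dotpDl addrC -opprB dotpNl normrN addrC.
  rewrite -mulrA ler_wpM2l// /S mulr_sumr.
  apply: le_trans (ler_wpM2r (normc_ge0 _) (ler_norm_sum _ _ _)) _.
  rewrite mulr_suml; apply: ler_sum => i _.
  rewrite normcM normrM normc_real mulrA ler_wpM2r ?normc_ge0// ler_wpM2r//.
  by have := rV_coord_le (xi - eta) i.
Qed.

End fourier_integral.

(** * The Poisson kernel and Fourier inversion *)

Section poisson_rV.
Context {R : realType} {m : nat}.
Local Notation V := 'rV[R]_m.
Local Notation C := R[i].
Local Notation leb := (@lebesgue_measure R).
Local Notation mu := (@lebesgue_rV R m).
Implicit Types (f g : V -> C) (x y z xi : V).

Lemma Rintegral_prod (k : 'I_m -> R -> R) :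
  (forall i, leb.-integrable setT (EFin \o k i)) ->
  mu.-integrable setT (EFin \o (fun x => \prod_i k i (x ord0 i))) /\
  \int[mu]_x \prod_i k i (x ord0 i) = \prod_i \int[leb]_t k i t.
Proof.
move=> ik; have [[I _] E] := cint_prod (fun i => cintg_real (ik i)).
have e x : \prod_i (k i (x ord0 i))%:C = (\prod_i k i (x ord0 i))%:C.
  by rewrite rmorph_prod.
split.
  by move: I; apply: eq_integrable => // x _; rewrite e.
move: E; rewrite (eq_cint _ e) cint_real.
rewrite (_ : \prod_i cint _ _ = (\prod_i \int[leb]_t k i t)%:C); first by case.
by rewrite rmorph_prod; apply: eq_bigr => i _; rewrite cint_real.
Qed.

Definition decay x : R := \prod_i cauchyd (x ord0 i).

Lemma decay_gt0 x : 0 < decay x.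
Proof. by apply: prodr_gt0 => i _; exact: cauchyd_gt0. Qed.

Lemma integrable_decay : mu.-integrable setT (EFin \o decay).
Proof. by have [] := Rintegral_prod (fun=> @integrable_cauchyd R). Qed.

Lemma integrable_decayZ (c : R) : mu.-integrable setT (EFin \o (fun x => c * decay x)).
Proof.
rewrite /comp; under eq_fun do rewrite EFinM.
by apply: integrableZl => //; exact: integrable_decay.
Qed.

Lemma cintg_decay f (c : R) : cmeas f -> (forall x, normc (f x) <= c * decay x) ->
  cintg mu f.
Proof. by move=> mf fc; apply: le_cintg (integrable_decayZ c) fc. Qed.

(** The decay is in the l^1 norm of xi (see [poisVE]), not the Euclidean one, so that the transform
    factors into one-dimensional kernels. *)
Definition poisV (e : R) xi : R := \prod_i pois e (xi ord0 i).

Definition pkerV (e : R) x y : R := \prod_i pker e (x ord0 i - y ord0 i).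

Lemma poisV_gt0 e xi : 0 < poisV e xi.
Proof. by apply: prodr_gt0 => i _; exact: pois_gt0. Qed.

Lemma poisV_le1 e xi : 0 <= e -> poisV e xi <= 1.
Proof.
by move=> e0; apply: prodr_ile1 => i _; rewrite pois_le1// andbT ltW// pois_gt0.
Qed.

Lemma pkerV_ge0 e x y : 0 < e -> 0 <= pkerV e x y.
Proof. by move=> e0; apply: prodr_ge0 => i _; exact: pker_ge0. Qed.

Lemma pkerC e (s t : R) : pker e (s - t) = pker e (t - s).
Proof. by rewrite /pker -opprB sqrrN. Qed.

Lemma pkerVC e x y : pkerV e x y = pkerV e y x.
Proof. by apply: eq_bigr => i _; rewrite pkerC. Qed.

Lemma integrable_poisV e : 0 < e -> mu.-integrable setT (EFin \o poisV e).
Proof. by move=> e0; have [] := Rintegral_prod (fun=> integrable_pois e0). Qed.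

Lemma pkerV_integral e y : 0 < e ->
  mu.-integrable setT (EFin \o (fun x => pkerV e x y)) /\
  \int[mu]_x pkerV e x y = (2 * pi) ^+ m.
Proof.
move=> e0; have [I ->] := Rintegral_prod (fun i => integrable_pker (y ord0 i) e0).
split => //; under eq_bigr do rewrite Rintegral_pker//.
by rewrite prodr_const card_ord.
Qed.

Lemma ft_poisV e y x : 0 < e ->
  cintg mu (fun xi => expi (dotp y xi) * (poisV e xi)%:C) /\
  ft (fun xi => expi (dotp y xi) * (poisV e xi)%:C) x = (pkerV e x y)%:C.
Proof.
move=> e0.
have := cint_prod (fun i => cintg_pois (y ord0 i - x ord0 i) e0).
have E (z xi : V) : \prod_i (expi (z ord0 i * xi ord0 i) * (pois e (xi ord0 i))%:C) =
    expi (dotp z xi) * (poisV e xi)%:C.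
  by rewrite big_split/= -expi_sum rmorph_prod.
have := cint_prod (fun i => cintg_pois (y ord0 i) e0).
under eq_fun do rewrite E; move=> [I1 _] [_ I2]; split => //.
rewrite /ft; transitivity (cint mu (fun xi => \prod_i (expi ((y ord0 i - x ord0 i) * xi ord0 i) *
    (pois e (xi ord0 i))%:C))).
  apply: eq_cint => xi; rewrite mulrA -expiD addrC -dotpNl -dotpDl -E.
  by apply: eq_bigr => i _; rewrite !mxE.
rewrite I2; under eq_bigr do rewrite cint_pois//.
by rewrite -rmorph_prod; congr (_%:C); apply: eq_bigr => i _; rewrite pkerC.
Qed.

(** This is [ft_mult] against a modulated Abel factor: the damped inversion integral is an average
    of f against the Poisson kernel at y. *)
Lemma poisson_identity f e y : 0 < e -> cintg mu f ->
  cint mu (fun xi => ft f xi * (expi (dotp y xi) * (poisV e xi)%:C)) =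
  cint mu (fun x => f x * (pkerV e x y)%:C).
Proof.
move=> e0 fi; have [I _] := ft_poisV y 0 e0.
rewrite -ft_mult//; apply: eq_cint => x.
by have [_ ->] := ft_poisV y x e0.
Qed.

(* Off the diagonal the kernel is O(e) times the fixed kernel [pker 1]; this
   replaces the rescaling of the usual approximate-identity argument. *)
Lemma pker_off e (d t : R) : 0 < e -> 0 < d -> d <= `|t| ->
  pker e t <= e * (1 + d ^- 2) * pker 1 t.
Proof.
move=> e0 d0 dt; rewrite /pker.
have t2 : d ^+ 2 <= t ^+ 2.
  by rewrite -[leRHS](real_normK (num_real t)) ler_pXn2r// nnegrE ltW.
have d2 : 0 < d ^+ 2 by rewrite exprn_gt0.
have t20 : 0 < t ^+ 2 by exact: lt_le_trans t2.
rewrite expr1n mulr1 ler_pdivrMr; last by rewrite ltr_wpDl// sqr_ge0.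
have D1 : 0 < 1 + t ^+ 2 by rewrite ltr_pwDl ?sqr_ge0.
rewrite (_ : _ * (e ^+ 2 + t ^+ 2) = 2 * e * ((1 + d ^- 2) * (e ^+ 2 + t ^+ 2) / (1 + t ^+ 2))); last first.
  by field; rewrite !gt_eqF.
rewrite -{1}[2 * e]mulr1 ler_pM2l ?mulr_gt0// ler_pdivlMr// mul1r.
have h : 1 <= d ^- 2 * t ^+ 2 by rewrite mulrC ler_pdivlMr// mul1r.
have e2 : 0 <= e ^+ 2 by rewrite sqr_ge0.
have dd : 0 <= d ^- 2 * e ^+ 2 by rewrite mulr_ge0// invr_ge0 ltW.
rewrite (_ : _ * _ = t ^+ 2 + e ^+ 2 + d ^- 2 * e ^+ 2 + d ^- 2 * t ^+ 2); last by ring.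
by rewrite addrC lerD// -addrA lerDl addr_ge0.
Qed.

End poisson_rV.

Section fourier_inversion.
Context {R : realType} {m : nat}.
Local Notation V := 'rV[R]_m.
Local Notation C := R[i].
Local Notation mu := (@lebesgue_rV R m).
Implicit Types (f g : V -> C) (x y z xi : V).

(** The majorant of [pkerV_off] has parameter 1 in the coordinate i and e in the others. Its mass
    stays (2 pi)^m because that of [pker] does not depend on the parameter. *)
Lemma pkerV_mixed e y (i : 'I_m) : 0 < e ->
  mu.-integrable setT (EFin \o
    (fun x => \prod_j pker (if j == i then 1 else e) (x ord0 j - y ord0 j))) /\
  \int[mu]_x \prod_j pker (if j == i then 1 else e) (x ord0 j - y ord0 j) = (2 * pi) ^+ m.
Proof.
move=> e0.
have h (j : 'I_m) : 0 < (if j == i then 1 else e) by case: ifP.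
have [I ->] := Rintegral_prod (fun j => integrable_pker (y ord0 j) (h j)).
split => //; rewrite (eq_bigr (fun=> 2 * pi)) => [|j _]; last exact: Rintegral_pker.
by rewrite prodr_const card_ord.
Qed.

Lemma pkerV_off e (d : R) x y (i : 'I_m) : 0 < e -> 0 < d ->
  d <= `|x ord0 i - y ord0 i| ->
  pkerV e x y <= e * (1 + d ^- 2) *
    \prod_j pker (if j == i then 1 else e) (x ord0 j - y ord0 j).
Proof.
move=> e0 d0 dxy; rewrite /pkerV (bigD1 i)//= [X in _ <= _ * X](bigD1 i)//= eqxx mulrA.
rewrite [X in _ <= _ * X](eq_bigr (fun j => pker e (x ord0 j - y ord0 j))); last first.
  by move=> j /negbTE ->.
by apply: ler_wpM2r; [apply: prodr_ge0 => j _; exact: pker_ge0 | exact: pker_off].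
Qed.

Lemma cmeas_mulr_real f (h : V -> R) : cmeas f -> measurable_fun setT h ->
  cmeas (fun x => f x * (h x)%:C).
Proof. by move=> mf mh; apply: cmeasM => //; exact: cmeas_real. Qed.

Lemma measurable_integrable (h : V -> R) : mu.-integrable setT (EFin \o h) ->
  measurable_fun setT h.
Proof. by move=> ih; apply/measurable_EFinP; exact: measurable_int ih. Qed.

(** The mass (2 pi)^m of the kernel lets f y be moved under the integral. In the bound, the leading
    2 comes from [normc_cint], 2 M bounds |f x - f y|, and m counts the coordinates in which a far
    point can be at distance d or more. *)
Lemma pkerV_approx f y e (d eta M : R) : 0 < e -> 0 < d -> 0 <= eta ->
  cmeas f -> (forall x, normc (f x) <= M) ->
  (forall x, (forall i, `|x ord0 i - y ord0 i| < d) -> normc (f x - f y) <= eta) ->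
  normc (cint mu (fun x => f x * (pkerV e x y)%:C) - ((2 * pi) ^+ m)%:C * f y) <=
  2 * ((2 * pi) ^+ m * (eta + 2 * M * m%:R * (e * (1 + d ^- 2)))).
Proof.
move=> e0 d0 eta0 mf fM fd.
have [Ip Ep] := pkerV_integral y e0.
pose Q (i : 'I_m) x := \prod_j pker (if j == i then 1 else e) (x ord0 j - y ord0 j).
have Q0 i x : 0 <= Q i x.
  by apply: prodr_ge0 => j _; apply: pker_ge0; case: ifP.
have M0 : 0 <= M by exact: le_trans (normc_ge0 _) (fM y).
have c0 : 0 <= e * (1 + d ^- 2).
  by rewrite mulr_ge0 ?(ltW e0)// addr_ge0// invr_ge0 exprn_ge0// ltW.
have iZ (c : R) h : mu.-integrable setT (EFin \o h) ->
    mu.-integrable setT (EFin \o (fun x : V => c * h x)).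
  by move=> ih; rewrite /comp; under eq_fun do rewrite EFinM; exact: integrableZl.
have mp := measurable_integrable Ip.
have -> : ((2 * pi) ^+ m)%:C * f y = cint mu (fun x => f y * (pkerV e x y)%:C).
  by rewrite cintZ ?cint_real ?Ep 1?mulrC//; exact: cintg_real.
have ifp : cintg mu (fun x => f x * (pkerV e x y)%:C).
  apply: le_cintg (iZ M _ Ip) _; first exact: cmeas_mulr_real.
  move=> x; rewrite normcM normc_real ger0_norm ?pkerV_ge0//.
  by rewrite ler_wpM2r ?pkerV_ge0.
rewrite -cintB//; last by apply: cintgZ; exact: cintg_real.
(* Close to y the first term suffices; elsewhere some coordinate i is at distance at least d and
   [pkerV_off] yields the summand [Q i]. Summing over all i avoids selecting i as a function of
   x. *)
pose h x := eta * pkerV e x y + 2 * M * (e * (1 + d ^- 2)) * \sum_i Q i x.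
have iS : mu.-integrable setT (EFin \o (fun x => \sum_i Q i x)).
  rewrite /comp; under eq_fun do rewrite -sumEFin.
  by apply: integrable_sum => // i _; have [] := pkerV_mixed y i e0.
have ih : mu.-integrable setT (EFin \o h).
  rewrite /comp; under eq_fun do rewrite EFinD.
  by apply: integrableD => //; exact: iZ.
have Eh : \int[mu]_x h x = (2 * pi) ^+ m * (eta + 2 * M * m%:R * (e * (1 + d ^- 2))).
  rewrite RintegralD// ?RintegralZl//; [|exact: iZ|exact: iZ].
  have -> : \int[mu]_x \sum_i Q i x = m%:R * (2 * pi) ^+ m.
    rewrite /Rintegral; under eq_integral do rewrite -sumEFin.
    rewrite integral_sum//; last by move=> i; have [] := pkerV_mixed y i e0.
    rewrite (eq_bigr (fun=> ((2 * pi) ^+ m)%:E)); last first.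
      move=> i _; have [I E] := pkerV_mixed y i e0.
      by rewrite -E /Rintegral fineK//; exact: integrable_fin_num.
    by rewrite sumEFin /= sumr_const card_ord [RHS]mulr_natl.
  by rewrite Ep; ring.
rewrite -Eh; apply: normc_cint => //.
  by apply: cmeasB; apply: cmeas_mulr_real => //; exact: cmeas_cst.
move=> x; rewrite -mulrBl normcM normc_real ger0_norm ?pkerV_ge0// /h.
have [xd|] := pselect (forall i, `|x ord0 i - y ord0 i| < d).
  apply: ler_wpDr; last by rewrite ler_wpM2r ?pkerV_ge0// fd.
  by apply: mulr_ge0; [rewrite mulr_ge0// mulr_ge0 | apply: sumr_ge0 => i _].
move=> /existsNP[i /negP]; rewrite -leNgt => xi.
apply: ler_wpDl; first by rewrite mulr_ge0// pkerV_ge0.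
rewrite -mulrA; apply: ler_pM; rewrite ?normc_ge0 ?pkerV_ge0//.
  by apply: le_trans (normcB _ _) _; rewrite mulr_natl mulr2n lerD.
apply: le_trans (pkerV_off e0 d0 xi) _.
rewrite ler_wpM2l// [leRHS](bigD1 i)//= lerDl; apply: sumr_ge0 => j _; exact: Q0.
Qed.

Lemma poisVE e xi : poisV e xi = expR (- (e * \sum_i `|xi ord0 i|)).
Proof.
rewrite /poisV /pois mulr_sumr -sumrN.
by rewrite (big_morph _ (@expRD R) (@expR0 R)).
Qed.

Lemma harm_cvg0 : (n.+1%:R^-1 : R) @[n --> \oo] --> (0 : R).
Proof. exact: cvg_harmonic. Qed.

Lemma poisV_cvg xi : poisV (n.+1%:R^-1) xi @[n --> \oo] --> (1 : R).
Proof.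
rewrite (_ : (fun n => _) = (fun n : nat => expR (- (n.+1%:R^-1 * \sum_i `|xi ord0 i|)))); last first.
  by apply/funext => n; rewrite poisVE.
rewrite -[X in _ --> X](@expR0 R).
have h : - (n.+1%:R^-1 * \sum_i `|xi ord0 i|) @[n --> \oo] --> (0 : R).
  rewrite -[X in _ --> X]oppr0; apply: cvgN.
  rewrite -[X in _ --> X](mul0r (\sum_i `|xi ord0 i|)).
  by apply: cvgM; [exact: harm_cvg0 | exact: cvg_cst].
apply: (@cvg_comp _ _ _ (fun n : nat => - (n.+1%:R^-1 * \sum_i `|xi ord0 i|)) (@expR R) _ _ _ h).
exact: continuous_expR.
Qed.

(** The damped integrals [cint mu (F n)] have two limits: the inversion integral, by dominated
    convergence as the Abel factor tends to 1, and (2 pi)^m f y, by [pkerV_approx]. *)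
Lemma fourier_inversion_pt f y (M : R) : cintg mu f -> cintg mu (ft f) ->
  (forall x, normc (f x) <= M) ->
  {for y, continuous (fun x => complex.Re (f x))} ->
  {for y, continuous (fun x => complex.Im (f x))} ->
  cint mu (fun xi => ft f xi * expi (dotp y xi)) = ((2 * pi) ^+ m)%:C * f y.
Proof.
move=> fi ffi fM cr ci.
pose e (n : nat) : R := n.+1%:R^-1.
have e0 n : 0 < e n by rewrite invr_gt0.
pose F n xi := ft f xi * (expi (dotp y xi) * (poisV (e n) xi)%:C).
have mE : cmeas (fun xi => expi (dotp y xi)).
  by apply: cmeas_expi_comp; exact: measurable_dotp.
have [Lr Li] : complex.Re (cint mu (F n)) @[n --> \oo] -->
      complex.Re (cint mu (fun xi => ft f xi * expi (dotp y xi))) /\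
    complex.Im (cint mu (F n)) @[n --> \oo] -->
      complex.Im (cint mu (fun xi => ft f xi * expi (dotp y xi))).
  apply: (@cint_dominated _ _ _ _ _ _ (fun xi => normc (ft f xi))).
  - move=> n; apply: cmeasM; first exact: cintg_meas ffi.
    apply: cmeas_mulr_real => //; by apply: measurable_integrable; exact: integrable_poisV.
  - by apply: cmeasM => //; exact: cintg_meas ffi.
  - move=> xi.
    have E n : complex.Re (F n xi) = complex.Re (ft f xi * expi (dotp y xi)) * poisV (e n) xi.
      by rewrite /F mulrA Re_mul /= mulr0 subr0.
    rewrite (funext E) -[X in _ --> X]mulr1; apply: cvgM; [exact: cvg_cst | exact: poisV_cvg].
  - move=> xi.
    have E n : complex.Im (F n xi) = complex.Im (ft f xi * expi (dotp y xi)) * poisV (e n) xi.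
      by rewrite /F mulrA Im_mul /= mulr0 add0r.
    rewrite (funext E) -[X in _ --> X]mulr1; apply: cvgM; [exact: cvg_cst | exact: poisV_cvg].
  - exact: cintg_normc.
  - move=> n xi; rewrite /F !normcM normc_expi mul1r normc_real.
    by rewrite ger0_norm ?(ltW (poisV_gt0 _ _))// ler_piMr ?normc_ge0// poisV_le1// ltW.
have FE n : cint mu (F n) = cint mu (fun x => f x * (pkerV (e n) x y)%:C).
  exact: poisson_identity.
have M0 : 0 <= M by exact: le_trans (normc_ge0 _) (fM y).
have T0 : 0 < (2 * pi) ^+ m :> R by rewrite exprn_gt0// mulr_gt0// pi_gt0.
have key (eta : R) : 0 < eta -> \forall n \near \oo,
    normc (cint mu (F n) - ((2 * pi) ^+ m)%:C * f y) <= eta.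
  (* Both terms of [pkerV_approx] will be at most 2 eta', so its bound becomes 8 (2 pi)^m eta' =
     eta. *)
  move=> eta0; pose eta' := eta / (8 * (2 * pi) ^+ m).
  have eta'0 : 0 < eta' by rewrite divr_gt0// mulr_gt0.
  have /nbhs_ballP[d1 /= d10 D1] : \forall x \near y, `|complex.Re (f y) - complex.Re (f x)| < eta'.
    by move/cvgrPdist_lt : cr; apply.
  have /nbhs_ballP[d2 /= d20 D2] : \forall x \near y, `|complex.Im (f y) - complex.Im (f x)| < eta'.
    by move/cvgrPdist_lt : ci; apply.
  pose d := Num.min d1 d2.
  have d0 : 0 < d by rewrite lt_min d10.
  have fd x : (forall i, `|x ord0 i - y ord0 i| < d) -> normc (f x - f y) <= 2 * eta'.
    move=> xd; rewrite mulr_natl mulr2n; apply: le_trans (normc_le _) _.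
    rewrite Re_add Re_opp Im_add Im_opp; apply: lerD; rewrite distrC ltW//.
      by apply: D1; apply/rV_ballP => // i; rewrite distrC; have := xd i; rewrite lt_min => /andP[].
    by apply: D2; apply/rV_ballP => // i; rewrite distrC; have := xd i; rewrite lt_min => /andP[].
  pose K := 2 * M * m%:R * (1 + d ^- 2).
  have K0 : 0 <= K by rewrite !mulr_ge0// addr_ge0// invr_ge0 exprn_ge0// ltW.
  (* [K] may be 0, hence the division by K + 1 below. *)
  have K1 : 0 < K + 1 by exact: ltr_wpDl.
  near=> n; rewrite FE.
  apply: le_trans (pkerV_approx (e0 n) d0 _ (cintg_meas fi) fM fd) _.
    by rewrite mulr_ge0// ltW.
  have eK : 2 * M * m%:R * (e n * (1 + d ^- 2)) <= 2 * eta'.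
    rewrite (_ : _ * _ = e n * K); last by rewrite /K; ring.
    have : `|0 - e n| < 2 * eta' / (K + 1).
      near: n; move/cvgrPdist_lt : harm_cvg0; apply.
      by apply: divr_gt0; [rewrite mulr_gt0 | exact: K1].
    rewrite sub0r normrN gtr0_norm// ltr_pdivlMr// => /ltW; apply: le_trans.
    by rewrite ler_wpM2l ?(ltW (e0 n))// lerDl.
  apply: (@le_trans _ _ (2 * ((2 * pi) ^+ m * (2 * eta' + 2 * eta')))).
    by rewrite ler_wpM2l// ler_wpM2l ?(ltW T0)// lerD2l.
  rewrite /eta' le_eqVlt; apply/orP; left; apply/eqP; field.
  by rewrite gt_eqF// pi_gt0.
apply: complex_ext.
- have H : complex.Re (cint mu (F n)) @[n --> \oo] --> complex.Re (((2 * pi) ^+ m)%:C * f y).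
    apply/cvgrPdist_le => eta /key; apply: filterS => n.
    by apply: le_trans; rewrite distrC -Re_opp -Re_add; exact: ler_Re.
  exact: (cvg_unique _ Lr H).
- have H : complex.Im (cint mu (F n)) @[n --> \oo] --> complex.Im (((2 * pi) ^+ m)%:C * f y).
    apply/cvgrPdist_le => eta /key; apply: filterS => n.
    by apply: le_trans; rewrite distrC -Im_opp -Im_add; exact: ler_Im.
  exact: (cvg_unique _ Li H).
Unshelve. all: by end_near.
Qed.

End fourier_inversion.

(** * Bessel's inequality *)

Section fubini_slices.
Context {R : realType} d1 d2 (T1 : measurableType d1) (T2 : measurableType d2).
Variables (m1 : {sigma_finite_measure set T1 -> \bar R}).
Variables (m2 : {sigma_finite_measure set T2 -> \bar R}).

Lemma cintg_fubini (h : T1 * T2 -> R[i]) (a : T1 -> R) (b : T2 -> R) :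
  cmeas h ->
  m1.-integrable setT (EFin \o a) -> m2.-integrable setT (EFin \o b) ->
  (forall x y, normc (h (x, y)) <= a x * b y) ->
  cintg m1 (fun x => cint m2 (fun y => h (x, y))).
Proof.
move=> mh ia ib hab; have [Ir Ii] := cintg_tensor mh ia ib hab.
have sl x : cintg m2 (fun y => h (x, y)).
  apply: (@le_cintg _ _ _ _ _ (fun y => a x * b y)) => //; first exact: cmeas_xsec.
  by rewrite /comp; under eq_fun do rewrite EFinM; exact: integrableZl.
split.
- apply: eq_integrable (integrable_fubini_F Ir) => // x _.
  by rewrite /fubini_F /cint /Rintegral /= fineK//; apply: integrable_fin_num => //; case: (sl x).
- apply: eq_integrable (integrable_fubini_F Ii) => // x _.
  by rewrite /fubini_F /cint /Rintegral /= fineK//; apply: integrable_fin_num => //; case: (sl x).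
Qed.

End fubini_slices.

Lemma conjcM {R : realType} (z w : R[i]) : (z * w)^* = z^* * w^*.
Proof. by case: z w => a b [c d]; apply: complex_ext => /=; ring. Qed.

Section bessel.
Context {R : realType} {m : nat}.
Local Notation V := 'rV[R]_m.
Local Notation C := R[i].
Local Notation mu := (@lebesgue_rV R m).
Implicit Types (f g : V -> C) (x y z xi : V).

Lemma normc_cint_ereal f : cintg mu f ->
  ((normc (cint mu f))%:E <= 2%:E * \int[mu]_x (normc (f x))%:E)%E.
Proof.
move=> fi; have nfi := cintg_normc fi.
have := normc_cint (cintg_meas fi) nfi (fun x => lexx _).
rewrite -lee_fin EFinM /Rintegral fineK//; exact: integrable_fin_num.
Qed.

Lemma ft_ccontinuous f : moment1 f -> ccontinuous (ft f).
Proof.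
move=> /ft_lip[K K0 fK].
have key (p : C -> R) : (forall z w : C, p (z - w) = p z - p w) ->
    (forall z : C, `|p z| <= normc z) -> continuous (fun xi => p (ft f xi)).
  have K1 : 0 < K + 1 by rewrite ltr_wpDl.
  move=> pB pn xi; apply/(@cvgrPdist_le _ _ _ (nbhs xi) (nbhs_filter xi)) => e e0.
  apply/nbhs_ballP; exists (e / (K + 1)) => /=; first exact: divr_gt0.
  move=> eta; rewrite mx_norm_ball /ball_ /= => xe.
  rewrite -pB; apply: le_trans (pn _) _; apply: le_trans (fK _ _) _.
  move: xe; rewrite ltr_pdivlMr// => /ltW; apply: le_trans.
  by rewrite mulrC ler_wpM2l// lerDl.
split; apply: key.
- by move=> z w; rewrite Re_add Re_opp.
- exact: ler_Re.
- by move=> z w; rewrite Im_add Im_opp.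
- exact: ler_Im.
Qed.

Lemma ft_cmeas f : moment1 f -> cmeas (ft f).
Proof. by move=> f1; exact/ccontinuous_cmeas/ft_ccontinuous. Qed.

Lemma measurable_pkerV (e : R) : 0 < e ->
  measurable_fun setT (fun z : V * V => pkerV e z.2 z.1).
Proof.
move=> e0; apply: measurable_prod => i _.
apply: (@measurableT_comp _ _ _ _ _ _ (fun t : measurableTypeR R => pker e t)
  setT (fun z : V * V => z.2 ord0 i - z.1 ord0 i)).
- apply: continuous_measurable_fun.
  by have := @continuous_pker R e 0 e0; under eq_fun do rewrite subr0.
- apply: measurable_funB.
  + exact: (measurableT_comp (measurable_coord i) measurable_snd).
  + exact: (measurableT_comp (measurable_coord i) measurable_fst).
Qed.

Lemma integral_pkerV e y : 0 < e ->
  (\int[mu]_x (pkerV e x y)%:E = ((2 * pi) ^+ m)%:E)%E.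
Proof.
move=> e0; have [I <-] := pkerV_integral y e0.
by rewrite /Rintegral fineK//; exact: integrable_fin_num.
Qed.

Lemma pkerV_le e x y : 0 < e -> pkerV e x y <= (2 / e) ^+ m.
Proof.
move=> e0; rewrite -[X in _ ^+ X](card_ord m) -prodr_const.
apply: ler_prod => i _; rewrite pker_ge0//= /pker.
have D0 : 0 < e ^+ 2 + (x ord0 i - y ord0 i) ^+ 2 by rewrite ltr_pwDl ?sqr_ge0// exprn_gt0.
rewrite ler_pdivrMr// mulrAC ler_pdivlMr// -mulrA ler_pM2l// -expr2.
by rewrite lerDl sqr_ge0.
Qed.

(** With [w] the conjugate of [ft f] times the Abel factor, [ft f * w] is the damped square, while
    [ft w] is the conjugate of the Poisson average [G] of f. So [ft_mult] turns the left side into a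
    pairing of f with that conjugate, and Schur's test applies to the symmetric kernel [pkerV],
    whose mass (2 pi)^m is independent of e. *)
Lemma bessel_pois f (e : R) : 0 < e -> moment1 f ->
  (\int[mu]_xi (normc (ft f xi) ^+ 2 * poisV e xi)%:E <=
    (4 * (2 * pi) ^+ m)%:E * \int[mu]_x (normc (f x) ^+ 2)%:E)%E.
Proof.
move=> e0 f1; have [fi _] := f1.
have mf := cintg_meas fi; have mff := ft_cmeas f1.
have mp : measurable_fun setT (@poisV R m e).
  by apply: measurable_integrable; exact: integrable_poisV.
pose w xi := (ft f xi)^* * (poisV e xi)%:C.
have mw : cmeas w by apply: cmeas_mulr_real => //; exact: cmeasJ.
pose B := 2 * \int[mu]_x normc (f x).
have B0 : 0 <= B by rewrite mulr_ge0//; apply: Rintegral_ge0 => x _; exact: normc_ge0.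
have iw : cintg mu w.
  apply: (@le_cintg _ _ _ _ _ (fun xi => B * poisV e xi)) => //.
    rewrite /comp; under eq_fun do rewrite EFinM.
    by apply: integrableZl => //; exact: integrable_poisV.
  move=> xi; rewrite /w normcM normc_conj normc_real ger0_norm ?(ltW (poisV_gt0 _ _))//.
  by rewrite ler_wpM2r ?(ltW (poisV_gt0 _ _))//; exact: normc_ft.
pose G x := cint mu (fun t => f t * (pkerV e t x)%:C).
have ftw x : ft w x = (G x)^*.
  rewrite /G -poisson_identity// -cintJ.
    apply: eq_cint => xi; rewrite /w conjcM.
    rewrite [X in _ = _ * X](_ : _ = expi (- dotp x xi) * (poisV e xi)%:C); first by ring.
    by rewrite expiN; case: (expi _) => a b; apply: complex_ext => /=; ring.
  have [I _] := ft_poisV x 0 e0.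
  apply: (@le_cintg _ _ _ _ _ (fun xi => B * poisV e xi)) => //.
  - by apply: cmeasM => //; exact: cintg_meas I.
  - rewrite /comp; under eq_fun do rewrite EFinM.
    by apply: integrableZl => //; exact: integrable_poisV.
  - move=> xi; rewrite !normcM normc_expi mul1r normc_real ger0_norm ?(ltW (poisV_gt0 _ _))//.
    by rewrite ler_wpM2r ?(ltW (poisV_gt0 _ _))//; exact: normc_ft.
pose h xi := normc (ft f xi) ^+ 2 * poisV e xi.
have h0 xi : 0 <= h xi by rewrite mulr_ge0 ?sqr_ge0// ltW// poisV_gt0.
have hE xi : ft f xi * w xi = (h xi)%:C by rewrite /w /h mulrA -sqr_normc_conj -rmorphM.
have ih : mu.-integrable setT (EFin \o h).
  have : cintg mu (fun xi => ft f xi * w xi).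
    apply: (@le_cintg _ _ _ _ _ (fun xi => B * normc (w xi))).
    - exact: cmeasM.
    - rewrite /comp; under eq_fun do rewrite EFinM.
      by apply: integrableZl => //; exact: cintg_normc.
    - by move=> xi; rewrite normcM ler_wpM2r ?normc_ge0//; exact: normc_ft.
  by under eq_fun do rewrite hE; case.
(* No first moments of [w] are at hand, so [ft_cmeas] does not give measurability of [ft w]; the
   product is instead a partial integral of an integrable function of two variables. *)
have ifw : cintg mu (fun x => f x * ft w x).
  pose h2 (z : V * V) := f z.1 * (expi (- dotp z.1 z.2) * w z.2).
  have mh2 : cmeas h2.
    apply: cmeasM; first exact: (cmeas_comp mf measurable_fst).
    apply: cmeasM; last exact: (cmeas_comp mw measurable_snd).
    by apply: cmeas_expi_comp; apply: measurable_funN; exact: measurable_dotp2.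
  have := cintg_fubini mh2 (cintg_normc fi) (cintg_normc iw) _.
  rewrite (_ : (fun x => cint mu (fun y => h2 (x, y))) = fun x => f x * ft w x).
    by apply=> x y; rewrite /h2 !normcM normc_expi mul1r.
  by apply/funext => x; rewrite /h2 /= cintZ//; exact: cintg_kernel.
have E1 : (\int[mu]_xi (h xi)%:E = (normc (cint mu (fun x => f x * ft w x)))%:E)%E.
  rewrite ft_mult//; rewrite (eq_cint _ hE) cint_real normc_real ger0_norm; last first.
    by apply: Rintegral_ge0 => xi _.
  by rewrite /Rintegral fineK//; exact: integrable_fin_num.
rewrite E1; apply: le_trans (normc_cint_ereal ifw) _.
(* One 2 has been paid to the outer integral. The 2 of the inner integral [G] is absorbed by 2 a b
   <= a^2 + b^2 below, and each of the two squares then contributes (2 pi)^m. *)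
rewrite (_ : 4 * _ = 2 * (2 * (2 * pi) ^+ m)); last by ring.
rewrite [in leRHS]EFinM -muleA; apply: lee_wpmul2l => //.
have mnf : measurable_fun setT (fun x => normc (f x)) by exact: measurable_normc.
have mnf1 : measurable_fun setT (fun z : V * V => normc (f z.1) ^+ 2).
  by apply: measurable_funX; exact: (measurableT_comp mnf measurable_fst).
have mnf2 : measurable_fun setT (fun z : V * V => normc (f z.2) ^+ 2).
  by apply: measurable_funX; exact: (measurableT_comp mnf measurable_snd).
have mK := measurable_pkerV e0.
have p0 (z : V * V) : 0 <= pkerV e z.2 z.1 by exact: pkerV_ge0.
pose I := (\int[mu]_x (normc (f x) ^+ 2)%:E)%E.
(* Schur's test through the arithmetic-geometric mean: the kernel is integrated in the variable that
   the square does not contain, which for [k2] takes an exchange by Tonelli. *)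
pose k1 (z : V * V) := (normc (f z.1) ^+ 2 * pkerV e z.2 z.1)%:E.
pose k2 (z : V * V) := (normc (f z.2) ^+ 2 * pkerV e z.2 z.1)%:E.
have mk1 : measurable_fun setT k1.
  by apply/measurable_EFinP; exact: measurable_funM.
have mk2 : measurable_fun setT k2.
  by apply/measurable_EFinP; exact: measurable_funM.
have k10 (z : V * V) : (0 <= k1 z)%E by rewrite lee_fin mulr_ge0 ?sqr_ge0.
have k20 (z : V * V) : (0 <= k2 z)%E by rewrite lee_fin mulr_ge0 ?sqr_ge0.
have mpx x : measurable_fun setT (fun t => (pkerV e t x)%:E).
  by have [J _] := pkerV_integral x e0; exact: measurable_int J.
have mpt t : measurable_fun setT (fun x => (pkerV e t x)%:E).
  by under eq_fun do rewrite pkerVC; exact: mpx.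
have T0 : 0 <= (2 * pi) ^+ m :> R by rewrite exprn_ge0// mulr_ge0// pi_ge0.
have mI : measurable_fun setT (fun x => (normc (f x) ^+ 2)%:E).
  by apply/measurable_EFinP; exact: measurable_funX.
have I1 : (\int[mu]_x \int[mu]_t k1 (x, t) = ((2 * pi) ^+ m)%:E * I)%E.
  rewrite -ge0_integralZl//; last by move=> x _; rewrite lee_fin sqr_ge0.
  apply: eq_integral => x _; rewrite /k1 /=.
  under eq_integral do rewrite EFinM.
  rewrite ge0_integralZl//; first by rewrite integral_pkerV// muleC.
  - by move=> t _; rewrite lee_fin pkerV_ge0.
  - by rewrite lee_fin sqr_ge0.
have I2 : (\int[mu]_x \int[mu]_t k2 (x, t) = ((2 * pi) ^+ m)%:E * I)%E.
  transitivity (\int[mu]_t \int[mu]_x k2 (x, t))%E; first exact: (fubini_tonelli k2 mk2 k20).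
  rewrite -ge0_integralZl//; last by move=> x _; rewrite lee_fin sqr_ge0.
  apply: eq_integral => t _; rewrite /k2 /=.
  under eq_integral do rewrite EFinM pkerVC.
  rewrite ge0_integralZl//; first by rewrite integral_pkerV// muleC.
  - by move=> x _; rewrite lee_fin pkerV_ge0.
  - by rewrite lee_fin sqr_ge0.
have mk1x x : measurable_fun setT (fun t => k1 (x, t)).
  exact: (measurableT_comp mk1 (measurable_pair1 x)).
have mk2x x : measurable_fun setT (fun t => k2 (x, t)).
  exact: (measurableT_comp mk2 (measurable_pair1 x)).
apply: (@le_trans _ _ (\int[mu]_x (\int[mu]_t k1 (x, t) + \int[mu]_t k2 (x, t)))%E).
  apply: ge0_le_integral => //.
  - by move=> x _; rewrite lee_fin normc_ge0.
  - by apply/measurable_EFinP; apply: measurable_normc; exact: cintg_meas ifw.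
  - apply: emeasurable_funD.
    + exact: (measurable_fun_fubini_tonelli_F k1 mk1 k10).
    + exact: (measurable_fun_fubini_tonelli_F k2 mk2 k20).
  - move=> x _; rewrite normcM ftw normc_conj EFinM.
    have iG : cintg mu (fun t => f t * (pkerV e t x)%:C).
      apply: (@le_cintg _ _ _ _ _ (fun t => (2 / e) ^+ m * normc (f t))).
      + by apply: cmeas_mulr_real => //; apply/measurable_EFinP; exact: mpx.
      + rewrite /comp; under eq_fun do rewrite EFinM.
        by apply: integrableZl => //; exact: cintg_normc.
      + move=> t; rewrite normcM mulrC ler_wpM2r ?normc_ge0// normc_real.
        by rewrite ger0_norm ?pkerV_ge0// pkerV_le.
    have EG : ((normc (f x))%:E * (normc (G x))%:E <=
        (normc (f x))%:E * (2%:E * \int[mu]_t (normc (f t) * pkerV e t x)%:E))%E.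
      apply: lee_wpmul2l; first by rewrite lee_fin normc_ge0.
      apply: le_trans (normc_cint_ereal iG) _; rewrite le_eqVlt; apply/orP; left; apply/eqP.
      by congr (_ * _)%E; apply: eq_integral => t _; rewrite normcM normc_real ger0_norm ?pkerV_ge0.
    apply: le_trans EG _.
    have mfp : measurable_fun setT (fun t => (normc (f t) * pkerV e t x)%:E).
      apply/measurable_EFinP; apply: measurable_funM => //.
      by apply/measurable_EFinP; exact: mpx.
    have fp0 t : (0 <= (normc (f t) * pkerV e t x)%:E)%E.
      by rewrite lee_fin mulr_ge0 ?normc_ge0 ?pkerV_ge0.
    rewrite muleA -EFinM -ge0_integralZl//; last by rewrite lee_fin mulr_ge0 ?normc_ge0.
    rewrite -ge0_integralD//.
    apply: ge0_le_integral => //.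
    + by move=> t _; rewrite mule_ge0// lee_fin mulr_ge0 ?normc_ge0.
    + exact: measurable_funeM.
    + exact: emeasurable_funD.
    + move=> t _; rewrite /k1 /k2 /= -EFinM -EFinD lee_fin -mulrDl mulrA.
      rewrite ler_wpM2r ?pkerV_ge0// -subr_ge0.
      rewrite (_ : _ - _ = (normc (f x) - normc (f t)) ^+ 2) ?sqr_ge0//; ring.
rewrite ge0_integralD//.
- rewrite I1 I2 -ge0_muleDl ?lee_fin// -EFinD (_ : _ + _ = 2 * (2 * pi) ^+ m)//; ring.
- by move=> x _; exact: integral_ge0.
- exact: (measurable_fun_fubini_tonelli_F k1 mk1 k10).
- by move=> x _; exact: integral_ge0.
- exact: (measurable_fun_fubini_tonelli_F k2 mk2 k20).
Qed.

(** As e decreases to 0 the Abel factor increases to 1, and the constant of [bessel_pois] is free of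
    e: monotone convergence removes the damping. *)
Lemma bessel f : moment1 f ->
  (\int[mu]_xi (normc (ft f xi) ^+ 2)%:E <=
    (4 * (2 * pi) ^+ m)%:E * \int[mu]_x (normc (f x) ^+ 2)%:E)%E.
Proof.
move=> f1; have mff := ft_cmeas f1.
pose e (n : nat) : R := n.+1%:R^-1.
have e0 n : 0 < e n by rewrite invr_gt0.
pose g n xi := (normc (ft f xi) ^+ 2 * poisV (e n) xi)%:E.
have mg n : measurable_fun setT (g n).
  apply/measurable_EFinP; apply: measurable_funM.
    by apply: measurable_funX; exact: measurable_normc.
  by apply: measurable_integrable; exact: integrable_poisV.
have g0 n xi : (0 <= g n xi)%E by rewrite lee_fin mulr_ge0 ?sqr_ge0// ltW// poisV_gt0.
have ndg xi : {homo (g ^~ xi) : n k / (n <= k)%N >-> (n <= k)%E}.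
  move=> n k nk; rewrite lee_fin ler_wpM2l ?sqr_ge0// !poisVE ler_expR lerN2.
  apply: ler_wpM2r; first by apply: sumr_ge0.
  by rewrite lef_pV2 ?posrE// ler_nat ltnS.
have lg xi : limn (g ^~ xi) = (normc (ft f xi) ^+ 2)%:E.
  apply/cvg_lim => //; apply: cvg_EFin; first exact: nearW.
  have := cvgM (@cvg_cst _ (normc (ft f xi) ^+ 2) _ \oo _) (poisV_cvg xi).
  by rewrite mulr1; exact.
have := @cvg_monotone_convergence _ _ _ mu setT measurableT g mg (fun n x _ => g0 n x)
  (fun x _ => ndg x).
under eq_integral do rewrite lg.
move=> /cvg_lim <- //; apply: lime_le.
  apply: ereal_nondecreasing_is_cvgn => n k nk.
  by apply: ge0_le_integral => // xi _; exact: ndg.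
by apply: nearW => n; exact: bessel_pois.
Qed.

End bessel.

(** * Smooth and Schwartz functions *)

Section continuous_real_functions.
Context {R : realType} {T : topologicalType}.
Implicit Types f g : T -> R.

Lemma cont_add f g : continuous f -> continuous g -> continuous (fun x => f x + g x).
Proof. by move=> cf cg x; apply: cvgD; [exact: cf | exact: cg]. Qed.

Lemma cont_sub f g : continuous f -> continuous g -> continuous (fun x => f x - g x).
Proof. by move=> cf cg x; apply: cvgB; [exact: cf | exact: cg]. Qed.

Lemma cont_mul f g : continuous f -> continuous g -> continuous (fun x => f x * g x).
Proof. by move=> cf cg x; apply: cvgM; [exact: cf | exact: cg]. Qed.

Lemma cont_norm f : continuous f -> continuous (fun x => `|f x|).
Proof. by move=> cf x; apply: cvg_norm; exact: cf. Qed.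

Lemma cont_comp (h : R -> R) f : continuous h -> continuous f -> continuous (fun x => h (f x)).
Proof. by move=> ch cf x; apply: (@continuous_comp _ _ _ f h); [exact: cf | exact: ch]. Qed.

Lemma cont_sum (I : Type) (r : seq I) (F : I -> T -> R) :
  (forall i, continuous (F i)) -> continuous (fun x => \sum_(i <- r) F i x).
Proof.
move=> cF; elim: r => [|i r IH].
  by under eq_fun do rewrite big_nil; exact: cst_continuous.
by under eq_fun do rewrite big_cons; exact: cont_add.
Qed.

End continuous_real_functions.

Section smooth_functions.
Context {R : realType} {m : nat}.
Local Notation V := 'rV[R]_m.
Local Notation C := R[i].
Implicit Types (f g : V -> C).

Definition cderiv (i : 'I_m) f (x : V) (d : C) :=
  is_derive x (delta_mx ord0 i) (fun y => complex.Re (f y)) (complex.Re d) /\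
  is_derive x (delta_mx ord0 i) (fun y => complex.Im (f y)) (complex.Im d).

Lemma cderiv_cpartial i f x d : cderiv i f x d -> cpartial i f x = d.
Proof. by move=> [[_ r] [_ j]]; apply: complex_ext; rewrite /cpartial /= ?r ?j. Qed.

Lemma has_partialsP f : has_partials f <-> forall i x, cderiv i f x (cpartial i f x).
Proof.
split=> h i x; last by have [[]] := h i x => + _ []; split.
by have [dr di] := h i x; split; exact: DeriveDef.
Qed.

Lemma cderiv_cst i (c : C) x : cderiv i (fun=> c) x 0.
Proof. by split; exact: is_derive_const. Qed.

Lemma cderivD i f g x a b : cderiv i f x a -> cderiv i g x b ->
  cderiv i (fun y => f y + g y) x (a + b).
Proof.
move=> [fr fi] [gr gi]; split.
- by under eq_fun do rewrite Re_add; rewrite Re_add; exact: is_derive_add.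
- by under eq_fun do rewrite Im_add; rewrite Im_add; exact: is_derive_add.
Qed.

Lemma cderivM i f g x a b : cderiv i f x a -> cderiv i g x b ->
  cderiv i (fun y => f y * g y) x (a * g x + f x * b).
Proof.
move=> [fr fi] [gr gi]; split.
- under eq_fun do rewrite Re_mul.
  apply: (is_derive_eq (is_derive_sub (is_derive_mul fr gr) (is_derive_mul fi gi))).
  by rewrite Re_add !Re_mul; ring.
- under eq_fun do rewrite Im_mul.
  apply: (is_derive_eq (is_derive_add (is_derive_mul fr gi) (is_derive_mul fi gr))).
  by rewrite Im_add !Im_mul; ring.
Qed.

Lemma ccontinuous_cst (c : C) : ccontinuous (fun _ : V => c).
Proof. by split; exact: cst_continuous. Qed.

Lemma ccontinuousD f g : ccontinuous f -> ccontinuous g -> ccontinuous (fun x => f x + g x).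
Proof.
move=> [fr fi] [gr gi]; split.
- by under eq_fun do rewrite Re_add; exact: cont_add.
- by under eq_fun do rewrite Im_add; exact: cont_add.
Qed.

Lemma ccontinuousM f g : ccontinuous f -> ccontinuous g -> ccontinuous (fun x => f x * g x).
Proof.
move=> [fr fi] [gr gi]; split.
- by under eq_fun do rewrite Re_mul; apply: cont_sub; exact: cont_mul.
- by under eq_fun do rewrite Im_mul; apply: cont_add; exact: cont_mul.
Qed.

(** The algebra generated by S and the constants. It replaces a Leibniz formula for iterated partial
    derivatives: only the first partials of the generators have to be exhibited. *)
Inductive alg (S : set (V -> C)) : (V -> C) -> Prop :=
| alg_in f : S f -> alg S f
| alg_cst (c : C) : alg S (fun=> c)
| alg_add f g : alg S f -> alg S g -> alg S (fun x => f x + g x)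
| alg_mul f g : alg S f -> alg S g -> alg S (fun x => f x * g x).

(* Coinduction: [alg S] is then stable under partial derivatives. *)
Lemma alg_smooth (S : set (V -> C)) :
  (forall f, S f -> ccontinuous f /\
     forall i, exists2 g, alg S g & forall x, cderiv i f x (g x)) ->
  forall f, alg S f -> smooth f.
Proof.
move=> HS.
have A f : alg S f -> ccontinuous f /\
     forall i, exists2 g, alg S g & forall x, cderiv i f x (g x).
  elim=> {f} [f /HS//|c|f g Sf [cf df] Sg [cg dg]|f g Sf [cf df] Sg [cg dg]].
  - split; first exact: ccontinuous_cst.
    by move=> i; exists (fun=> 0); [exact: alg_cst | move=> x; exact: cderiv_cst].
  - split; first exact: ccontinuousD.
    move=> i; have [f' Sf' df'] := df i; have [g' Sg' dg'] := dg i.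
    by exists (fun x => f' x + g' x); [exact: alg_add | move=> x; exact: cderivD].
  - split; first exact: ccontinuousM.
    move=> i; have [f' Sf' df'] := df i; have [g' Sg' dg'] := dg i.
    exists (fun x => f' x * g x + f x * g' x); last by move=> x; exact: cderivM.
    by apply: alg_add; apply: alg_mul.
have B f : alg S f -> forall s, alg S (cpartials s f).
  move=> Sf; elim=> [//|i s IH] /=; have [_ /(_ i)[g Sg dg]] := A _ IH.
  rewrite (_ : cpartial i _ = g)//; apply/funext => x; exact: cderiv_cpartial.
move=> f Sf s; have [cs ds] := A _ (B _ Sf s); split => //.
by move=> i x; have [g _ /(_ x)[[]]] := ds i => + _ []; split.
Qed.

Lemma smooth_ccontinuous f : smooth f -> ccontinuous f.
Proof. by move=> /(_ [::])[]. Qed.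

Lemma smooth_cderiv f i x : smooth f -> cderiv i f x (cpartial i f x).
Proof. by move=> /(_ [::])[_ /has_partialsP]; exact. Qed.

Lemma cpartials_rcons s i f : cpartials (rcons s i) f = cpartials s (cpartial i f).
Proof. by rewrite /cpartials foldr_rcons. Qed.

Lemma smooth_cpartial f i : smooth f -> smooth (cpartial i f).
Proof. by move=> sf s; rewrite -cpartials_rcons; exact: sf. Qed.

Lemma coord_cderiv (i j : 'I_m) x :
  cderiv j (fun y => (y ord0 i)%:C) x (if i == j then 1 else 0).
Proof.
split => /=; last by case: ifP => _; exact: is_derive_const.
apply/is_derive_line; under eq_fun do rewrite !mxE eqxx /=.
have := is_derive_add (is_derive_mul (is_derive_id (0 : R) 1)
  (is_derive_const (i == j)%:R (0 : R) 1)) (is_derive_const (x ord0 i) (0 : R) 1).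
move=> H; apply: (is_derive_eq H).
by rewrite mul1r mulr0 !addr0; case: ifP.
Qed.

Lemma coord_ccontinuous (i : 'I_m) : ccontinuous (fun y : V => (y ord0 i)%:C).
Proof. by split => /=; [exact: coord_continuous | exact: cst_continuous]. Qed.

End smooth_functions.

Section schwartz_space.
Context {R : realType} {m : nat}.
Local Notation V := 'rV[R]_m.
Local Notation C := R[i].
Implicit Types (f g : V -> C).

Lemma sqr_enorm (x : V) : enorm x ^+ 2 = dotp x x.
Proof. by rewrite sqr_sqrtr//; apply: sumr_ge0 => i _; rewrite -expr2 sqr_ge0. Qed.

Lemma sqr_coord_le (x : V) i : x ord0 i ^+ 2 <= enorm x ^+ 2.
Proof.
rewrite sqr_enorm /dotp (bigD1 i)//= -expr2 lerDl.
by apply: sumr_ge0 => j _; rewrite -expr2 sqr_ge0.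
Qed.

Lemma weight_ge1 (x : V) : 1 <= 1 + enorm x ^+ 2.
Proof. by rewrite lerDl sqr_ge0. Qed.

Lemma weight_ge0 (x : V) : 0 <= 1 + enorm x ^+ 2.
Proof. by rewrite addr_ge0// sqr_ge0. Qed.

Lemma coord_le_weight (x : V) i : `|x ord0 i| <= 1 + enorm x ^+ 2.
Proof.
apply: (@le_trans _ _ (1 + x ord0 i ^+ 2)); last by rewrite lerD2l sqr_coord_le.
rewrite -(real_normK (num_real (x ord0 i))); have := normr_ge0 (x ord0 i).
by move: `|_| => t t0; nra.
Qed.

Definition rapid f := forall N, exists c : R, forall x,
  (1 + enorm x ^+ 2) ^+ N * normc (f x) <= c.

Lemma rapidD f g : rapid f -> rapid g -> rapid (fun x => f x + g x).
Proof.
move=> rf rg N; have [c fc] := rf N; have [d gd] := rg N; exists (c + d) => x.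
apply: le_trans (lerD (fc x) (gd x)); rewrite -mulrDr ler_wpM2l ?normcD//.
by rewrite exprn_ge0// weight_ge0.
Qed.

Lemma rapidZ (a : C) f : rapid f -> rapid (fun x => a * f x).
Proof.
move=> rf N; have [c fc] := rf N; exists (normc a * c) => x.
by rewrite normcM mulrCA ler_wpM2l// normc_ge0.
Qed.

Lemma rapidX i f : rapid f -> rapid (fun x => (x ord0 i)%:C * f x).
Proof.
move=> rf N; have [c fc] := rf N.+1; exists c => x; apply: le_trans (fc x).
rewrite (exprSr _ N) -mulrA ler_wpM2l ?exprn_ge0 ?weight_ge0//.
by rewrite normcM normc_real ler_wpM2r ?normc_ge0// coord_le_weight.
Qed.

Lemma schwartz_rapid f : schwartz f -> rapid f.
Proof. by move=> [_ sf] N; have [c fc] := sf N; exists c => x; exact: (fc [::] x). Qed.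

Lemma schwartz_smooth f : schwartz f -> smooth f.
Proof. by case. Qed.

Lemma schwartz_cpartial f i : schwartz f -> schwartz (cpartial i f).
Proof.
move=> [sf bf]; split; first exact: smooth_cpartial.
move=> N; have [c fc] := bf N.+1; exists c => s x sN.
rewrite -cpartials_rcons; apply: le_trans (fc (rcons s i) x _); last by rewrite size_rcons.
by rewrite ler_wpM2r ?normc_ge0// ler_weXn2l ?weight_ge1.
Qed.

(** Iterated partials never leave S, so each is bounded by the rapid decay of a member of S, and a
    seminorm involves finitely many of them. Closure properties of the Schwartz space thus reduce to
    the choice of a class stable under one derivative. *)
Lemma schwartz_coind (S : set (V -> C)) :
  (forall f, S f -> [/\ ccontinuous f, rapid f &
     forall i, exists2 g, S g & forall x, cderiv i f x (g x)]) ->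
  forall f, S f -> schwartz f.
Proof.
move=> HS.
have B f : S f -> forall s, S (cpartials s f).
  move=> Sf; elim=> [//|i s IH] /=; have [_ _ /(_ i)[g Sg dg]] := HS _ IH.
  rewrite (_ : cpartial i _ = g)//; apply/funext => x; exact: cderiv_cpartial.
move=> f Sf; split.
  apply: (@alg_smooth _ _ S); last exact: alg_in.
  move=> {Sf}f /HS[cf _ df]; split => // i; have [g Sg dg] := df i.
  by exists g => //; exact: alg_in.
move=> N.
have /choice[c Hc] (s : seq 'I_m) : exists c : R, forall x,
    (1 + enorm x ^+ 2) ^+ N * normc (cpartials s f x) <= c.
  by have [_ rs _] := HS _ (B _ Sf s); exact: rs.
have c0 s : 0 <= c s.
  by apply: le_trans (Hc s 0); rewrite mulr_ge0 ?exprn_ge0 ?weight_ge0 ?normc_ge0.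
(* A common bound for all derivatives of order at most N: the sum of the individual nonnegative
   bounds. *)
exists (\sum_(k < N.+1) \sum_(t : k.-tuple 'I_m) c (val t)) => s x sN.
apply: le_trans (Hc s x) _; rewrite -ltnS in sN.
rewrite (bigD1 (Ordinal sN))//= (bigD1 (in_tuple s))//= -addrA lerDl.
by rewrite addr_ge0//; apply: sumr_ge0 => // k _; exact: sumr_ge0.
Qed.

Lemma schwartz_lin (a : C) f g : schwartz f -> schwartz g ->
  schwartz (fun x => a * f x + g x).
Proof.
move=> sf sg.
pose S : set (V -> C) := [set h | exists f g : V -> C,
  [/\ schwartz f, schwartz g & h = fun x => a * f x + g x]].
apply: (@schwartz_coind S); last by exists f, g.
move=> {sf sg f g} _ [f [g [sf sg ->]]]; split.
- apply: ccontinuousD; last exact/smooth_ccontinuous/schwartz_smooth.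
  by apply: ccontinuousM; [exact: ccontinuous_cst | exact/smooth_ccontinuous/schwartz_smooth].
- by apply: rapidD; [exact/rapidZ/schwartz_rapid | exact: schwartz_rapid].
- move=> i; exists (fun x => a * cpartial i f x + cpartial i g x).
    by exists (cpartial i f), (cpartial i g); split => //; exact: schwartz_cpartial.
  move=> x; apply: cderivD; last exact/smooth_cderiv/schwartz_smooth.
  have := cderivM (cderiv_cst i a x) (smooth_cderiv i x (schwartz_smooth sf)).
  by rewrite mul0r add0r.
Qed.

Lemma schwartz0 : schwartz (fun _ : V => 0 : C).
Proof.
apply: (@schwartz_coind [set (fun=> 0)]) => // _ ->; split.
- exact: ccontinuous_cst.
- by move=> N; exists 0 => x; rewrite normc0 mulr0.
- by move=> i; exists (fun=> 0) => // x; exact: cderiv_cst.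
Qed.

Lemma schwartzZ (a : C) f : schwartz f -> schwartz (fun x => a * f x).
Proof.
by move=> sf; have := schwartz_lin a sf schwartz0; under eq_fun do rewrite addr0.
Qed.

Lemma schwartzD f g : schwartz f -> schwartz g -> schwartz (fun x => f x + g x).
Proof.
by move=> sf sg; have := schwartz_lin 1 sf sg; under eq_fun do rewrite mul1r.
Qed.

Lemma schwartz_sum (I : Type) (r : seq I) (F : I -> V -> C) :
  (forall i, schwartz (F i)) -> schwartz (fun x => \sum_(i <- r) F i x).
Proof.
move=> sF; elim: r => [|i r IH].
  by under eq_fun do rewrite big_nil; exact: schwartz0.
by under eq_fun do rewrite big_cons; exact: schwartzD.
Qed.

Lemma schwartzX i f : schwartz f -> schwartz (fun x => (x ord0 i)%:C * f x).
Proof.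
move=> sf.
(* The summand [g] makes the class stable: differentiating x_i f in direction i leaves an extra term
   f. *)
pose S : set (V -> C) := [set h | exists f g : V -> C,
  [/\ schwartz f, schwartz g & h = fun x : V => (x ord0 i)%:C * f x + g x]].
apply: (@schwartz_coind S); last first.
  exists f, (fun=> 0); split => //; first exact: schwartz0.
  by apply/funext => x; rewrite addr0.
move=> {sf f} _ [f [g [sf sg ->]]]; split.
- apply: ccontinuousD; last exact/smooth_ccontinuous/schwartz_smooth.
  by apply: ccontinuousM; [exact: coord_ccontinuous | exact/smooth_ccontinuous/schwartz_smooth].
- by apply: rapidD; [exact/rapidX/schwartz_rapid | exact: schwartz_rapid].
- move=> j; exists (fun x : V => (x ord0 i)%:C * cpartial j f x +
      ((if i == j then 1 else 0) * f x + cpartial j g x)).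
    exists (cpartial j f), (fun x => (if i == j then 1 else 0) * f x + cpartial j g x).
    by split => //; [exact: schwartz_cpartial | apply: schwartz_lin => //; exact: schwartz_cpartial].
  move=> x; rewrite addrA; apply: cderivD; last exact/smooth_cderiv/schwartz_smooth.
  rewrite addrC; apply: cderivM; first exact: coord_cderiv.
  exact/smooth_cderiv/schwartz_smooth.
Qed.

Lemma test_function_schwartz (Omega : set V) f : test_function Omega f -> schwartz f.
Proof.
move=> [sf cK _].
(* The support of [f] is kept as a fixed reference set, which is easier to preserve under
   derivatives than the support of each derivative. *)
pose S : set (V -> C) := [set h | smooth h /\ forall x, ~ fun_supp f x -> h x = 0].
apply: (@schwartz_coind S); last first.
  split => // x; apply: contra_notP => /eqP fx; exact: subset_closure.
move=> h [sh h0]; have ch := smooth_ccontinuous sh; split => //.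
  move=> N.
  (* The modulus is replaced by |Re| + |Im|, which is plainly continuous, so that a maximum over the
     compact support exists. *)
  pose p x := (1 + dotp x x) ^+ N * (`|complex.Re (h x)| + `|complex.Im (h x)|).
  have cp : continuous p.
    have [cr ci] := ch; apply: cont_mul; last by apply: cont_add; exact: cont_norm.
    apply: (@cont_comp _ _ (fun t => t ^+ N)); first exact: exprn_continuous.
    apply: cont_add; first exact: cst_continuous.
    by apply: cont_sum => i; apply: cont_mul; exact: coord_continuous.
  have [K0|/set0P K0] := eqVneq (fun_supp f) set0.
    by exists 0 => x; rewrite h0 ?K0// normc0 mulr0.
  have [c _ cmax] := EVT_max_rV K0 cK (continuous_subspaceT cp).
  have p0 x : 0 <= p x.
    by rewrite mulr_ge0 ?addr_ge0// exprn_ge0// -sqr_enorm weight_ge0.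
  exists (p c) => x; have [Kx|nKx] := pselect (fun_supp f x); last first.
    by rewrite h0// normc0 mulr0.
  apply: le_trans (cmax x (mem_set Kx)); rewrite sqr_enorm ler_wpM2l ?normc_le//.
  by rewrite exprn_ge0// -sqr_enorm weight_ge0.
move=> i; exists (cpartial i h); last by move=> x; exact: smooth_cderiv.
split; first exact: smooth_cpartial.
move=> x nKx; apply: cderiv_cpartial.
have oK : open (~` fun_supp f) by apply: closed_openC; exact: closed_closure.
have nx : \forall y \near x, 0 = h y.
  by apply: filterS (open_nbhs_nbhs (conj oK nKx)) => y /h0.
split.
- have e : complex.Re (0 : C) = 0 by [].
  apply: (@is_derive_near _ _ (fun=> complex.Re 0)); rewrite e.
  by apply: filterS nx => y <-.
- have e : complex.Im (0 : C) = 0 by [].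
  apply: (@is_derive_near _ _ (fun=> complex.Im 0)); rewrite e.
  by apply: filterS nx => y <-.
Qed.

Lemma schwartz_decay f : schwartz f ->
  exists c : R, forall x, normc (f x) <= c * decay x.
Proof.
(* The power m suffices because each of the m factors 1 + x_i^2 is at most 1 + |x|^2. *)
move=> /schwartz_rapid /(_ m)[c fc]; exists c => x.
rewrite /decay /cauchyd prodfV ler_pdivlMr; last first.
  by apply: prodr_gt0 => i _; rewrite ltr_pwDl// sqr_ge0.
apply: le_trans (fc x); rewrite mulrC ler_wpM2r ?normc_ge0//.
rewrite -[X in _ ^+ X](card_ord m) -prodr_const; apply: ler_prod => i _.
by rewrite addr_ge0 ?sqr_ge0//= lerD2l sqr_coord_le.
Qed.

Lemma schwartz_cmeas f : schwartz f -> cmeas f.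
Proof. by move=> sf; exact/ccontinuous_cmeas/smooth_ccontinuous/schwartz_smooth. Qed.

Lemma schwartz_cintg f : schwartz f -> cintg (lebesgue_rV m) f.
Proof.
move=> sf; have [c fc] := schwartz_decay sf.
exact: cintg_decay (schwartz_cmeas sf) fc.
Qed.

Lemma schwartz_moment1 f : schwartz f -> moment1 f.
Proof.
by move=> sf; split; [exact: schwartz_cintg | move=> i; exact/schwartz_cintg/schwartzX].
Qed.

End schwartz_space.

(** * The Fourier transform of Schwartz functions *)

Section integration_by_parts.
Context {R : realType}.
Local Notation C := R[i].
Local Notation leb := (@lebesgue_measure R).

Lemma continuous_to_rV (T : topologicalType) m (f : T -> 'rV[R]_m) :
  (forall i, continuous (fun t => f t ord0 i)) -> continuous f.
Proof.
move=> cf t; apply/cvg_ballP => e e0.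
have : \forall s \near t, forall i, `|f t ord0 i - f s ord0 i| < e.
  by apply: filter_forall => i; move/cvgrPdist_lt : (cf i t); apply.
by apply: filterS => s fs; apply/rV_ballP.
Qed.

Lemma continuous_rV_cons1 m (v : 'rV[R]_m) : continuous (fun x : R => rV_cons (x, v)).
Proof.
apply: continuous_to_rV => i; case: (unliftP ord0 i) => [j ->|->].
- by under eq_fun do rewrite rV_cons_lift; exact: cst_continuous.
- by under eq_fun do rewrite rV_cons_ord0; move=> x; exact: cvg_id.
Qed.

Lemma continuous_rV_cons2 m (x : R) : continuous (fun v : 'rV[R]_m => rV_cons (x, v)).
Proof.
apply: continuous_to_rV => i; case: (unliftP ord0 i) => [j ->|->].
- by under eq_fun do rewrite rV_cons_lift; exact: coord_continuous.
- by under eq_fun do rewrite rV_cons_ord0; exact: cst_continuous.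
Qed.

Lemma rV_cons_delta0 m (t x : R) (v : 'rV[R]_m) :
  t *: delta_mx ord0 ord0 + rV_cons (x, v) = rV_cons (t + x, v).
Proof.
apply/rowP => i; rewrite [LHS]mxE [X in X + _]mxE [X in _ * X + _]mxE.
case: (unliftP ord0 i) => [j ->|->].
- by rewrite !rV_cons_lift andbF mulr0 add0r.
- by rewrite !rV_cons_ord0 !eqxx mulr1.
Qed.

Lemma rV_cons_deltaS m (t x : R) (v : 'rV[R]_m) (j : 'I_m) :
  t *: delta_mx ord0 (lift ord0 j) + rV_cons (x, v) =
  rV_cons (x, t *: delta_mx ord0 j + v).
Proof.
apply/rowP => i; rewrite [LHS]mxE [X in X + _]mxE [X in _ * X + _]mxE.
case: (unliftP ord0 i) => [k ->|->].
- by rewrite !rV_cons_lift !mxE (inj_eq lift_inj).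
- by rewrite !rV_cons_ord0 andbC /= mulr0 add0r.
Qed.

Lemma decay_cons m (x : R) (v : 'rV[R]_m) : decay (rV_cons (x, v)) = cauchyd x * decay v.
Proof.
rewrite /decay big_ord_recl rV_cons_ord0; congr (_ * _).
by apply: eq_bigr => j _; rewrite rV_cons_lift.
Qed.

Lemma cauchyd_nat (n : nat) : cauchyd (n%:R : R) <= n.+1%:R^-1.
Proof.
rewrite /cauchyd lef_pV2 ?posrE ?ltr_pwDl ?sqr_ge0// -natrX -(natrD _ 1).
by rewrite ler_nat add1n ltnS; case: n => // n; rewrite expnS leq_pmulr// expn1.
Qed.

Lemma cauchydN (x : R) : cauchyd (- x) = cauchyd x.
Proof. by rewrite /cauchyd sqrrN. Qed.

(** The bound by [cauchyd] serves twice: it makes [G] integrable and sends [F] to 0 along n and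
    -n. *)
Lemma integral_derive0 (F G : R -> R) (c : R) :
  (forall x : R, is_derive x 1 F (G x)) -> continuous G ->
  (forall x, `|F x| <= c * cauchyd x) -> (forall x, `|G x| <= c * cauchyd x) ->
  \int[leb]_x G x = 0.
Proof.
move=> dF cG Fc Gc.
have c0 : 0 <= c.
  have := le_trans (normr_ge0 _) (Fc 0).
  by rewrite pmulr_lge0// cauchyd_gt0.
have F0 (u : nat -> R) : (forall n, cauchyd (u n) = cauchyd (n%:R : R)) ->
    F (u n) @[n --> \oo] --> (0 : R).
  move=> cu; apply: norm_cvg0.
  apply: (@squeeze_cvgr _ _ _ _ (fun=> 0) (fun n : nat => c * n.+1%:R^-1)).
  - apply: nearW => n; rewrite normr_ge0/=; apply: le_trans (Fc _) _.
    by rewrite cu ler_wpM2l// cauchyd_nat.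
  - exact: cvg_cst.
  - rewrite -[X in _ --> X](mulr0 c); apply: cvgM; [exact: cvg_cst | exact: harm_cvg0].
rewrite (@integral_split_FTC R G F G F G 0 0 _ cG dF _ dF _ _ _)//.
- by rewrite sub0r subr0 addNr.
- exact: integrable_dom cG Gc.
- exact: F0.
- by apply: F0 => n; rewrite cauchydN.
Qed.

Lemma cint_slices m (G : 'rV[R]_m.+1 -> C) (c : R) : cmeas G ->
  (forall x, normc (G x) <= c * decay x) ->
  cint (lebesgue_rV m.+1) G = cint leb (fun x => cint (lebesgue_rV m) (fun v => G (rV_cons (x, v)))) /\
  cint (lebesgue_rV m.+1) G = cint (lebesgue_rV m) (fun v => cint leb (fun x => G (rV_cons (x, v)))).
Proof.
move=> mG Gc.
have mh : cmeas (fun z : measurableTypeR R * 'rV[R]_m => G (rV_cons z)).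
  by apply: (cmeas_comp mG); exact: measurable_rV_cons.
have ia : leb.-integrable setT (EFin \o (fun x => c * cauchyd x)).
  rewrite /comp; under eq_fun do rewrite EFinM.
  by apply: integrableZl => //; exact: integrable_cauchyd.
have hb x v : normc (G (rV_cons (x, v))) <= c * cauchyd x * decay v.
  by apply: le_trans (Gc _) _; rewrite decay_cons mulrA.
have [<- <-] := fubini_tensor mh ia (@integrable_decay R m) hb.
have ih := cintg_tensor mh ia (@integrable_decay R m) hb.
by rewrite -cint_rVS.
Qed.

(** Integration by parts without boundary terms, by induction on the dimension. If coordinate 0 is
    the direction of differentiation, the inner line integral vanishes; otherwise the slices over
    the remaining coordinates vanish by induction. *)
Lemma cint_partial0 m (F G : 'rV[R]_m -> C) (i : 'I_m) (c : R) :
  (forall x, cderiv i F x (G x)) -> ccontinuous G ->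
  (forall x, normc (F x) <= c * decay x) -> (forall x, normc (G x) <= c * decay x) ->
  cint (lebesgue_rV m) G = 0.
Proof.
elim: m F G i c => [|m IH] F G i c dF cG Fc Gc; first by case: i dF => [[]].
have [e1 e2] := cint_slices (ccontinuous_cmeas cG) Gc.
case: (unliftP ord0 i) dF => [j ->|->] dF.
- rewrite e1 (eq_cint _ (g := fun=> 0)).
    by rewrite cint_real Rintegral_cst// mul0r.
  move=> x; apply: (IH (fun v => F (rV_cons (x, v))) _ j (c * cauchyd x)).
  + move=> v; have [dr di] := dF (rV_cons (x, v)).
    split; apply/is_derive_line; [move/is_derive_line : dr | move/is_derive_line : di].
      by under eq_fun do rewrite rV_cons_deltaS.
    by under eq_fun do rewrite rV_cons_deltaS.
  + have [cr ci] := cG; split => v.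
      apply: (@continuous_comp _ _ _ (fun v => rV_cons (x, v)) (fun w => complex.Re (G w))).
        exact: continuous_rV_cons2.
      exact: cr.
    apply: (@continuous_comp _ _ _ (fun v => rV_cons (x, v)) (fun w => complex.Im (G w))).
      exact: continuous_rV_cons2.
    exact: ci.
  + by move=> v; apply: le_trans (Fc _) _; rewrite decay_cons mulrA.
  + by move=> v; apply: le_trans (Gc _) _; rewrite decay_cons mulrA.
- rewrite e2 (eq_cint _ (g := fun=> 0)).
    by rewrite cint_real Rintegral_cst// mul0r.
  move=> v.
  have key (p : C -> R) : (forall z, `|p z| <= normc z) ->
      (forall w, is_derive w (delta_mx ord0 ord0) (fun y => p (F y)) (p (G w))) ->
      continuous (fun w => p (G w)) -> \int[leb]_x p (G (rV_cons (x, v))) = 0.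
    move=> pn dp cp.
    apply: (@integral_derive0 (fun x => p (F (rV_cons (x, v)))) _ (c * decay v)).
    - move=> x; have /is_derive_line := dp (rV_cons (x, v)).
      under eq_fun do rewrite rV_cons_delta0; move=> h; apply/is_derive_line.
      by under eq_fun do rewrite [_ *: 1]mulr1.
    - move=> x; apply: (@continuous_comp _ _ _ (fun x : R => rV_cons (x, v)) (fun w => p (G w))).
        exact: continuous_rV_cons1.
      exact: cp.
    - move=> x; apply: le_trans (pn _) _; apply: le_trans (Fc _) _.
      by rewrite decay_cons mulrA mulrAC.
    - move=> x; apply: le_trans (pn _) _; apply: le_trans (Gc _) _.
      by rewrite decay_cons mulrA mulrAC.
  have [cr ci] := cG; rewrite /cint; apply: complex_ext => /=.
  + by apply: key => //; [exact: ler_Re | move=> w; have [] := dF w].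
  + by apply: key => //; [exact: ler_Im | move=> w; have [] := dF w].
Qed.

End integration_by_parts.

Section fourier_schwartz.
Context {R : realType} {m : nat}.
Local Notation V := 'rV[R]_m.
Local Notation C := R[i].
Local Notation mu := (@lebesgue_rV R m).
Implicit Types (f g : V -> C).

Definition mulix (a : C) (i : 'I_m) f : V -> C := fun x => a * ((x ord0 i)%:C * f x).

Lemma schwartz_mulix a i f : schwartz f -> schwartz (mulix a i f).
Proof. by move=> sf; apply: schwartzZ; exact: schwartzX. Qed.

Lemma kernel_cderiv (i : 'I_m) (xi x : V) :
  cderiv i (fun y => expi (- dotp xi y)) x (- 'i * (xi ord0 i)%:C * expi (- dotp xi x)).
Proof.
have dl : is_derive x (delta_mx ord0 i) (fun y => - dotp xi y) (- xi ord0 i).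
  apply: (@is_derive_quadratic _ _ _ _ _ _ 0) => t; rewrite mul0r.
  rewrite !(dotpC xi) dotpDl dotpZl dotp_delta.
  by rewrite (_ : _ - _ = 0) ?normr0//; ring.
split.
- apply: (is_derive_eq (is_derive_chain (is_derive_cos _) dl)).
  by rewrite /expi /=; ring.
- apply: (is_derive_eq (is_derive_chain (is_derive_sin _) dl)).
  by rewrite /expi /=; ring.
Qed.

Lemma kernel_ccontinuous (xi : V) : ccontinuous (fun y : V => expi (- dotp xi y)).
Proof.
have cd : continuous (fun y : V => - dotp xi y).
  move=> x; apply: (@continuous_comp _ _ _ (fun y => dotp xi y) (fun t : R => - t)).
    apply: cont_sum => i; apply: cont_mul; first exact: cst_continuous.
    exact: coord_continuous.
  exact: opp_continuous.
split => /=; apply: cont_comp => //; [exact: continuous_cos | exact: continuous_sin].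
Qed.

(** The derivative of kernel times f integrates to 0 by [cint_partial0], and the product rule splits
    it into the two sides. *)
Lemma ft_cpartial i f xi : schwartz f ->
  ft (cpartial i f) xi = 'i * (xi ord0 i)%:C * ft f xi.
Proof.
move=> sf; have sdf := schwartz_cpartial i sf.
have [c fc] := schwartz_decay sf; have [d dfd] := schwartz_decay sdf.
pose F x := expi (- dotp xi x) * f x.
pose G x := - 'i * (xi ord0 i)%:C * expi (- dotp xi x) * f x +
  expi (- dotp xi x) * cpartial i f x.
have c0 : 0 <= c by have := le_trans (normc_ge0 _) (fc 0); rewrite pmulr_lge0// decay_gt0.
have d0 : 0 <= d by have := le_trans (normc_ge0 _) (dfd 0); rewrite pmulr_lge0// decay_gt0.
have : cint mu G = 0.
  apply: (@cint_partial0 R m F G i (c + (`|xi ord0 i| * c + d))).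
  - move=> x; apply: cderivM; first exact: kernel_cderiv.
    exact/smooth_cderiv/schwartz_smooth.
  - apply: ccontinuousD.
      apply: ccontinuousM; last exact/smooth_ccontinuous/schwartz_smooth.
      by apply: ccontinuousM; [exact: ccontinuous_cst | exact: kernel_ccontinuous].
    by apply: ccontinuousM; [exact: kernel_ccontinuous | exact/smooth_ccontinuous/schwartz_smooth].
  - move=> x; rewrite normcM normc_expi mul1r; apply: le_trans (fc x) _.
    by rewrite ler_wpM2r ?(ltW (decay_gt0 _))// lerDl addr_ge0// mulr_ge0.
  - move=> x; apply: le_trans (normcD _ _) _; rewrite 2!mulrDl; apply: ler_wpDl.
      by rewrite mulr_ge0// ltW// decay_gt0.
    apply: lerD.
      rewrite !normcM normc_expi mulr1 normcN normc_real.
      rewrite (_ : normc 'i = 1) ?mul1r -?mulrA ?ler_wpM2l//.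
      by rewrite /= expr0n expr1n add0r sqrtr1.
    by rewrite normcM normc_expi mul1r.
rewrite /G cintD; last 2 first.
- under eq_fun do rewrite -mulrA; apply: cintgZ; apply: cintg_kernel.
  exact: schwartz_cintg.
- exact/cintg_kernel/schwartz_cintg.
under eq_cint do rewrite -mulrA.
rewrite cintZ; last exact/cintg_kernel/schwartz_cintg.
rewrite -/(ft f xi) -/(ft (cpartial i f) xi) => /eqP; rewrite addr_eq0 => /eqP H.
by rewrite -[LHS]opprK -H; ring.
Qed.

(** Quantitative differentiation under the integral: the second-order remainder of the exponential
    is at most 2 (t x_i)^2, and a further 2 from [normc_cint] gives 4 I, with [I] a second absolute
    moment of f. *)
Lemma ft_cderiv i f xi : schwartz f -> cderiv i (ft f) xi (ft (mulix (- 'i) i f) xi).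
Proof.
move=> sf; have sg := schwartz_mulix (- 'i) i sf.
have sh := schwartzX i (schwartzX i sf).
have fi := schwartz_cintg sf; have gi := schwartz_cintg sg.
have hi := cintg_normc (schwartz_cintg sh).
pose I := \int[mu]_x normc ((x ord0 i)%:C * ((x ord0 i)%:C * f x)).
have key t : normc (ft f (t *: delta_mx ord0 i + xi) - ft f xi -
    t%:C * ft (mulix (- 'i) i f) xi) <= 4 * I * t ^+ 2.
  rewrite /ft -cintB; [|exact: cintg_kernel|exact: cintg_kernel].
  rewrite -cintZ; last exact: cintg_kernel.
  rewrite -cintB; last 2 first.
  - by apply: cintgB; exact: cintg_kernel.
  - by apply: cintgZ; exact: cintg_kernel.
  rewrite (_ : 4 * I * t ^+ 2 = 2 * ((2 * t ^+ 2) * I)); last by ring.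
  rewrite /I -RintegralZl//; apply: normc_cint.
  - apply: cmeasB; last first.
      by apply: cintg_meas; apply: cintgZ; exact: (cintg_kernel xi gi).
    by apply: cintg_meas; apply: cintgB; exact: cintg_kernel.
  - by rewrite /comp; under eq_fun do rewrite EFinM; exact: integrableZl.
  - move=> x; rewrite /mulix.
    rewrite dotpDl dotpZl dotp_delta opprD expiD.
    rewrite (_ : _ - _ = expi (- dotp xi x) *
      (expi (- (t * x ord0 i)) - 1 - 'i * (- (t * x ord0 i))%:C) * f x); last first.
      by rewrite rmorphN rmorphM; ring.
    rewrite !normcM normc_expi mul1r !normc_real !mulrA ler_wpM2r ?normc_ge0//.
    apply: le_trans (expi_taylor _) _.
    rewrite sqrrN exprMn -[x ord0 i ^+ 2](real_normK (num_real (x ord0 i))).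
    by rewrite expr2 !mulrA.
split; apply: (@is_derive_quadratic _ _ _ _ _ _ (4 * I)) => t;
  apply: le_trans (key t).
- rewrite (_ : _ - _ = complex.Re (ft f (t *: delta_mx ord0 i + xi) - ft f xi -
    t%:C * ft (mulix (- 'i) i f) xi)) ?ler_Re//.
  by rewrite !Re_add !Re_opp Re_mul /= mul0r subr0.
- rewrite (_ : _ - _ = complex.Im (ft f (t *: delta_mx ord0 i + xi) - ft f xi -
    t%:C * ft (mulix (- 'i) i f) xi)) ?ler_Im//.
  by rewrite !Im_add !Im_opp Im_mul /= mul0r addr0.
Qed.

Lemma ftD f g : cintg mu f -> cintg mu g ->
  ft (fun x => f x + g x) = fun xi => ft f xi + ft g xi.
Proof.
move=> fi gi; have := ft_lin 1 fi gi; under eq_fun do rewrite mul1r.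
by move=> ->; apply/funext => xi; rewrite mul1r.
Qed.

Lemma ftZ (a : C) f xi : cintg mu f -> ft (fun x => a * f x) xi = a * ft f xi.
Proof.
move=> fi; rewrite /ft -cintZ; last exact: cintg_kernel.
by apply: eq_cint => x; ring.
Qed.

Lemma ft_sum (I : Type) (r : seq I) (F : I -> V -> C) xi :
  (forall i, cintg mu (F i)) ->
  ft (fun x => \sum_(i <- r) F i x) xi = \sum_(i <- r) ft (F i) xi.
Proof.
move=> iF.
have iS s : cintg mu (fun x => \sum_(i <- s) F i x).
  elim: s => [|i s IH]; under eq_fun do rewrite ?big_nil ?big_cons.
    by split; exact: integrable0.
  exact: cintgD.
elim: r => [|i r IH].
  rewrite big_nil /ft; under eq_cint do rewrite big_nil mulr0.
  by rewrite cint_real Rintegral_cst// mul0r.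
rewrite big_cons -IH -[RHS]/((fun z => ft (F i) z + ft (fun x => \sum_(j <- r) F j x) z) xi).
by rewrite -ftD//; congr (ft _ _); apply/funext => x; rewrite big_cons.
Qed.

(** [L] is f minus its Laplacian, with transform (1 + |xi|^2) times [ft f]. Each step of the
    induction spends one such factor, starting from the boundedness of [ft]. *)
Lemma ft_rapid f : schwartz f -> rapid (ft f).
Proof.
move=> sf N; elim: N f sf => [|N IH] f sf.
  exists (2 * \int[mu]_x normc (f x)) => xi; rewrite expr0 mul1r.
  exact: normc_ft (schwartz_cintg sf).
pose L x := f x + \sum_i (- 1) * cpartial i (cpartial i f) x.
have sdd i : schwartz (fun x => - 1 * cpartial i (cpartial i f) x).
  by apply: schwartzZ; apply: schwartz_cpartial; exact: schwartz_cpartial.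
have sL : schwartz L by apply: schwartzD => //; exact: schwartz_sum.
have [c Lc] := IH L sL; exists c => xi; apply: le_trans (Lc xi).
rewrite exprSr -mulrA ler_wpM2l ?exprn_ge0 ?weight_ge0//.
rewrite le_eqVlt; apply/orP; left; apply/eqP.
have -> : ft L xi = (1 + enorm xi ^+ 2)%:C * ft f xi.
  rewrite /L ftD; [|exact: schwartz_cintg|by apply: schwartz_cintg; exact: schwartz_sum].
  rewrite ft_sum; last by move=> i; exact: schwartz_cintg.
  rewrite sqr_enorm rmorphD rmorph1 mulrDl mul1r; congr (_ + _).
  rewrite rmorph_sum mulr_suml; apply: eq_bigr => i _.
  rewrite ftZ; last by apply: schwartz_cintg; do 2 apply: schwartz_cpartial.
  rewrite ft_cpartial ?ft_cpartial//; last exact: schwartz_cpartial.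
  rewrite rmorphM !mulrA; congr (_ * _).
  transitivity (- ('i * 'i) * (xi ord0 i)%:C * (xi ord0 i)%:C); first by ring.
  by rewrite -expr2 sqr_i opprK mul1r.
by rewrite normcM normc_real ger0_norm ?weight_ge0.
Qed.

Lemma schwartz_ft f : schwartz f -> schwartz (ft f).
Proof.
move=> sf.
apply: (@schwartz_coind R m [set h | exists2 f, schwartz f & h = ft f]); last by exists f.
move=> {sf f} _ [f sf ->]; split.
- exact/ft_ccontinuous/schwartz_moment1.
- exact: ft_rapid.
- move=> i; exists (ft (mulix (- 'i) i f)); last by move=> xi; exact: ft_cderiv.
  by exists (mulix (- 'i) i f) => //; exact: schwartz_mulix.
Qed.

Lemma schwartz_fourier f : schwartz f -> schwartz (fourier f).
Proof. by move=> sf; rewrite fourierE; apply: schwartzZ; exact: schwartz_ft. Qed.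

(** The two normalizing factors multiply to (2 pi)^(-m) and cancel the constant of
    [fourier_inversion_pt], applied at -y because the second transform also carries a minus sign in
    the exponent. *)
Lemma fourier_fourier f y : schwartz f -> fourier (fourier f) y = f (- y).
Proof.
move=> sf.
have [cr ci] := smooth_ccontinuous (schwartz_smooth sf).
have [M fM] := schwartz_rapid sf 0%N.
have ffi := schwartz_cintg (schwartz_ft sf).
have := @fourier_inversion_pt R m f (- y) M (schwartz_cintg sf) ffi _ (cr _) (ci _).
move=> H; have {}H : cint mu (fun xi => ft f xi * expi (dotp (- y) xi)) =
    ((2 * pi) ^+ m)%:C * f (- y).
  by apply: H => x; have := fM x; rewrite expr0 mul1r.
rewrite fourierE fourierE ftZ// mulrA -rmorphM.
have T0 : 0 < 2 * pi :> R by rewrite mulr_gt0// pi_gt0.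
rewrite -powRD; last by apply/implyP => _; rewrite gt_eqF.
rewrite (_ : _ + _ = - m%:R); last by field.
rewrite powRN powR_mulrn ?(ltW T0)//.
rewrite -[RHS](mulKf (_ : ((2 * pi) ^+ m)%:C != 0 :> C)); last first.
  by rewrite (_ : 0 = 0%:C)// (inj_eq (@complexI _)) gt_eqF// exprn_gt0.
rewrite -H fmorphV; congr (_ * _); apply: eq_cint => xi.
by rewrite dotpNl mulrC.
Qed.

Lemma fourier_surjective f : schwartz f ->
  exists2 g, schwartz g & fourier g = f.
Proof.
move=> sf; exists (fourier (fourier (fourier f))); first by do 3 apply: schwartz_fourier.
apply/funext => y; rewrite fourier_fourier; last by do 2 apply: schwartz_fourier.
by rewrite fourier_fourier// opprK.
Qed.

End fourier_schwartz.

(** * Bump functions and uniqueness of locally integrable densities *)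

Section smooth_step.
Context {R : realType}.

(** The flat functions t^(-p) exp(-1/t), extended by 0. The index p closes the family under
    differentiation: the derivative of member p combines members p+1 and p+2. *)
Definition step (p : nat) (t : R) : R :=
  if 0 < t then t^-1 ^+ p * expR (- t^-1) else 0.

Lemma step_ge0 p t : 0 <= step p t.
Proof.
by rewrite /step; case: ifP => // /ltW t0; rewrite mulr_ge0 ?expR_ge0// exprn_ge0// invr_ge0.
Qed.

(** The exponential series gives exp(1/t) >= t^(-p-2) / (p+2)!. The two powers of t gained over the
    pole are what [is_derive_quadratic] asks for at 0. *)
Lemma step_le p t : step p t <= p.+2`!%:R * t ^+ 2.
Proof.
rewrite /step; case: ifPn => [t0|_]; last by rewrite mulr_ge0// sqr_ge0.
have u0 : 0 < t^-1 by rewrite invr_gt0.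
have := expR_ge1Dxn p.+1 (ltW u0) => h.
have {}h : t^-1 ^+ p.+2 <= p.+2`!%:R * expR t^-1.
  rewrite mulrC -ler_pdivrMr ?ltr0n ?fact_gt0//; apply: le_trans h.
  by rewrite lerDr.
rewrite expRN ler_pdivrMr ?expR_gt0// mulrAC.
have -> : t^-1 ^+ p = t^-1 ^+ p.+2 * t ^+ 2.
  by rewrite -addn2 exprD -mulrA -exprMn mulVf ?gt_eqF// expr1n mulr1.
by rewrite ler_wpM2r// sqr_ge0.
Qed.

Lemma step_le1 t : step 0 t <= 1.
Proof.
rewrite /step; case: ifPn => [t0|//]; rewrite expr0 mul1r -expR0 ler_expR.
by rewrite oppr_le0 invr_ge0 ltW.
Qed.

Lemma is_derive_step p (t : R) :
  is_derive t 1 (step p) (step p.+2 t - p%:R * step p.+1 t).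
Proof.
have [t0|t0|->] := ltgtP t 0.
- have -> : step p.+2 t - p%:R * step p.+1 t = 0.
    by rewrite /step ltNge (ltW t0) /= mulr0 subr0.
  apply: (@is_derive_near _ _ (fun=> 0)).
  near=> s; rewrite /step ifF//; apply/negbTE; rewrite -leNgt ltW//.
  by near: s; exact: lt_nbhsl.
(* Near t > 0 the function is h(1/s), which trades the pole for the polynomial u^p. *)
- pose h (u : R) : R := u ^+ p * expR (- u).
  apply: (@is_derive_near R R (fun s : R => h s^-1)).
    near=> s; rewrite /step ifT//.
    by near: s; exact: lt_nbhsr.
  have dV : is_derive t 1 (fun s : R => s^-1) (- t ^- 2).
    have H := @is_deriveV R id t 1 1 (lt0r_neq0 t0) (is_derive_id t 1).
    by apply: (is_derive_eq H); rewrite [_ *: 1]mulr1.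
  have dh : is_derive t^-1 1 h (p%:R * t^-1 ^+ p.-1 * expR (- t^-1) - h t^-1).
    have dN : is_derive (t^-1) 1 (fun u : R => - u) (-1).
      exact: is_derive_opp (is_derive_id _ _).
    have dX : is_derive (t^-1) 1 (fun u : R => u ^+ p) (p%:R * t^-1 ^+ p.-1).
      have -> : (fun u : R => u ^+ p) = (id : R -> R) ^+ p.
        by apply/funext => u; rewrite exprfctE.
      have H := is_deriveX p (is_derive_id t^-1 (1 : R)).
      by apply: (is_derive_eq H); rewrite [_ *: 1]mulr1.
    have := is_derive_mul dX (is_derive_chain (is_derive_expR _) dN).
    by move=> H; apply: (is_derive_eq H); rewrite /h; ring.
  have := is_derive_chain dh dV => H; apply: (is_derive_eq H).
  rewrite /step t0 /h -exprVn; case: p {h dh H} => [|p].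
    by rewrite /=; ring.
  by rewrite [p.+1.-1]/= !exprS; ring.
- have -> : step p.+2 0 - p%:R * step p.+1 0 = 0 by rewrite /step ltxx mulr0 subr0.
  apply: (@is_derive_quadratic _ _ _ _ _ _ p.+2`!%:R) => s.
  rewrite [s *: 1]mulr1 addr0 mulr0 subr0 {2}/step ltxx subr0.
  by rewrite ger0_norm ?step_ge0// step_le.
Unshelve. all: by end_near.
Qed.

Lemma continuous_step p : continuous (step p).
Proof. exact: is_derive_continuous (@is_derive_step p). Qed.

Lemma step_cvg t : step 0 (n.+1%:R * t) @[n --> \oo] --> ((0 < t)%R%:R : R).
Proof.
have [t0|t0] := ltP 0 t; last first.
  apply: cvg_near_cst; apply: nearW => n; rewrite /step ifF//.
  by apply/negbTE; rewrite -leNgt mulr_ge0_le0.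
rewrite (_ : (fun n => _) = (fun n : nat => expR (- (n.+1%:R^-1 * t^-1)))); last first.
  by apply/funext => n; rewrite /step mulr_gt0// expr0 mul1r invfM.
have h : - (n.+1%:R^-1 * t^-1) @[n --> \oo] --> (0 : R).
  rewrite -[X in _ --> X]oppr0; apply: cvgN; rewrite -[X in _ --> X](mul0r t^-1).
  by apply: cvgM; [exact: harm_cvg0 | exact: cvg_cst].
rewrite -[X in _ --> X](@expR0 R).
apply: (@cvg_comp _ _ _ (fun n : nat => - (n.+1%:R^-1 * t^-1)) (@expR R) _ _ _ h).
exact: continuous_expR.
Qed.

End smooth_step.

Section bumps.
Context {R : realType} {m : nat}.
Local Notation V := 'rV[R]_m.
Local Notation C := R[i].

Definition stepV (p : nat) (i : 'I_m) (a b : R) : V -> C :=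
  fun x => (step p (a * x ord0 i + b))%:C.

Definition stepVs : set (V -> C) := [set f | exists p i a b, f = stepV p i a b].

Lemma stepV_smooth (f : V -> C) : alg stepVs f -> smooth f.
Proof.
apply: alg_smooth => {}f [p [i [a [b ->]]]].
have cl : continuous (fun x : V => a * x ord0 i + b).
  apply: cont_add; last exact: cst_continuous.
  by apply: cont_mul; [exact: cst_continuous | exact: coord_continuous].
split.
  split => /=; last exact: cst_continuous.
  by apply: cont_comp => //; exact: continuous_step.
move=> j.
exists (fun x => (if i == j then a else 0)%:C * (stepV p.+2 i a b x + (- p%:R)%:C * stepV p.+1 i a b x)).
  apply: alg_mul; first exact: alg_cst.
  apply: alg_add; first by apply: alg_in; exists p.+2, i, a, b.
  by apply: alg_mul; [exact: alg_cst | apply: alg_in; exists p.+1, i, a, b].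
move=> x; have [dr _] := coord_cderiv i j x.
have dl : is_derive x (delta_mx ord0 j) (fun y : V => a * y ord0 i + b) (if i == j then a else 0).
  apply: (is_derive_eq (is_derive_add (is_derive_scal a dr) (is_derive_const b _ _))).
  by rewrite addr0; case: ifP => _ /=; rewrite ?mulr1 ?mulr0.
split.
- apply: (is_derive_eq (is_derive_chain (@is_derive_step R p _) dl)) => /=.
  by case: ifP => _; ring.
- apply: is_derive_eq; first exact: is_derive_const.
  by rewrite /=; ring.
Qed.

(** As n grows these tend to the indicator of the open box while staying between 0 and 1
    ([bumpR_cvg], [bumpR_le1]), so pairings with them recover integrals over boxes. *)
Definition sbump (n : nat) (a b : 'I_m -> R) : V -> C := fun x =>
  \prod_i (stepV 0 i n.+1%:R (- (n.+1%:R * a i)) x *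
           stepV 0 i (- n.+1%:R) (n.+1%:R * b i) x).

Lemma bump_smooth n a b : smooth (sbump n a b).
Proof.
apply: stepV_smooth; rewrite /sbump.
elim: (index_enum _) => [|i s IH].
  by under eq_fun do rewrite big_nil; exact: alg_cst.
under eq_fun do rewrite big_cons; apply: alg_mul => //.
apply: alg_mul; apply: alg_in.
- by exists 0%N, i, n.+1%:R, (- (n.+1%:R * a i)).
- by exists 0%N, i, (- n.+1%:R), (n.+1%:R * b i).
Qed.

Definition bumpR (n : nat) (a b : 'I_m -> R) (x : V) : R :=
  \prod_i (step 0 (n.+1%:R * (x ord0 i - a i)) * step 0 (n.+1%:R * (b i - x ord0 i))).

Lemma bumpE n a b x : sbump n a b x = (bumpR n a b x)%:C.
Proof.
rewrite /sbump /bumpR rmorph_prod; apply: eq_bigr => i _; rewrite /stepV -rmorphM.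
by congr (step _ _ * step _ _)%:C; ring.
Qed.

Lemma bumpR_ge0 n a b x : 0 <= bumpR n a b x.
Proof. by apply: prodr_ge0 => i _; rewrite mulr_ge0// step_ge0. Qed.

Lemma bumpR_le1 n a b x : bumpR n a b x <= 1.
Proof.
apply: prodr_ile1 => i _; rewrite mulr_ge0 ?step_ge0//=.
by rewrite mulr_ile1// ?step_ge0// step_le1.
Qed.

Definition obox (a b : 'I_m -> R) : set V := [set x | forall i, a i < x ord0 i < b i].
Definition cbox (a b : 'I_m -> R) : set V := [set x | forall i, a i <= x ord0 i <= b i].

Lemma cbox_compact a b : compact (cbox a b).
Proof.
have := @rV_compact R m (fun i => [set t | t \in `[a i, b i]]) (fun i => @segment_compact _ _ _).
congr compact; apply/seteqP; split => x /= h i; have := h i; by rewrite in_itv.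
Qed.

Lemma obox_cbox a b : obox a b `<=` cbox a b.
Proof. by move=> x h i; have /andP[h1 h2] := h i; rewrite !ltW. Qed.

Lemma step_eq0 (t : R) (n : nat) : ~~ (0 < t) -> step 0 (n.+1%:R * t) = 0.
Proof. by move=> t0; rewrite /step ifF//; apply/negbTE; rewrite pmulr_rgt0. Qed.

Lemma bumpR_out n a b x : ~ obox a b x -> bumpR n a b x = 0.
Proof.
move=> /existsNP[i /negP]; rewrite negb_and => h; rewrite /bumpR (bigD1 i)//=.
case/orP: h => h.
- by rewrite (@step_eq0 (x ord0 i - a i)) ?subr_gt0// !mul0r.
- by rewrite (@step_eq0 (b i - x ord0 i)) ?subr_gt0// mulr0 mul0r.
Qed.

Lemma bumpR_cvg a b x : bumpR n a b x @[n --> \oo] --> (\1_(obox a b) x : R).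
Proof.
rewrite indicE; have [/set_mem xab|/negP xab] := boolP (x \in obox a b); last first.
  by apply: cvg_near_cst; apply: nearW => n; rewrite bumpR_out// => /mem_set.
rewrite (_ : true%:R = \prod_(i < m) (1 * 1) :> R); last by rewrite big1// => i _; rewrite mulr1.
rewrite /bumpR; elim: (index_enum _) => [|i s IH].
  by under eq_fun do rewrite big_nil; rewrite big_nil; exact: cvg_cst.
under eq_fun do rewrite big_cons; rewrite big_cons.
apply: cvgM => //; have /andP[h1 h2] := xab i; apply: cvgM.
- by have := @step_cvg R (x ord0 i - a i); rewrite subr_gt0 h1.
- by have := @step_cvg R (b i - x ord0 i); rewrite subr_gt0 h2.
Qed.

Lemma bump_test n a b : test_function setT (sbump n a b).
Proof.
have sub : fun_supp (sbump n a b) `<=` cbox a b.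
  apply: (@subset_trans _ (closure (cbox a b))).
    apply: closure_subset => x /= h; apply: obox_cbox; apply: contrapT => xab.
    by move/eqP: h; apply; rewrite bumpE bumpR_out.
  rewrite -(proj1 (closure_id (cbox a b)))//; apply: rV_compact_closed.
  exact: cbox_compact.
split => //; first exact: bump_smooth.
apply: subclosed_compact sub; first exact: closed_closure.
exact: cbox_compact.
Qed.

End bumps.

(** * Open boxes as a generating class for the measurable sets *)

Section boxes.
Context {R : realType} {m : nat}.
Local Notation V := 'rV[R]_m.
Local Notation mu := (@lebesgue_rV R m).

Definition boxes : set (set V) := [set A | exists a b, A = obox a b].

Lemma obox_measurable (a b : 'I_m -> R) : measurable (obox a b : set V).
Proof.
apply: (rV_box_measurable (Y := fun i => [set t | a i < t < b i])) => i.
rewrite (_ : [set t | _] = `]a i, b i[%classic); first exact: measurable_itv.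
by apply/seteqP; split => t /=; rewrite in_itv.
Qed.

Lemma cbox_measurable (a b : 'I_m -> R) : measurable (cbox a b : set V).
Proof. by apply: rV_compact_measurable; exact: cbox_compact. Qed.

Lemma setI_boxes : setI_closed boxes.
Proof.
move=> _ _ [a [b ->]] [c [d ->]].
exists (fun i => Num.max (a i) (c i)), (fun i => Num.min (b i) (d i)).
apply/seteqP; split => x /=.
- by move=> [ab cd] i; rewrite gt_max lt_min; have /andP[-> ->] := ab i; have /andP[-> ->] := cd i.
- move=> h; split => i; have := h i; rewrite gt_max lt_min => /andP[/andP[h1 h2] /andP[h3 h4]];
    by apply/andP.
Qed.

Lemma boxes_measurable : @measurable _ V = <<s boxes >>.
Proof.
apply/seteqP; split; last first.
  apply: smallest_sub; first exact: sigma_algebra_measurable.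
  by move=> _ [a [b ->]]; exact: obox_measurable.
apply: smallest_sub; first exact: smallest_sigma_algebra.
move=> A; rewrite -bigcup_seq => -[i /= _ [Y mY <-]]; rewrite setTI.
have {}mY : <<s @RGenOpens.G R >> Y by rewrite -[<<s _ >>]RGenOpens.measurableE.
pose H : set (set R) := [set Y | <<s boxes >> ((fun x : V => x ord0 i) @^-1` Y)].
suff : <<s @RGenOpens.G R >> `<=` H by exact.
apply: smallest_sub.
  split.
  - by rewrite /H /= preimage_set0; exact: sigma_algebra0.
  - by move=> B; rewrite /H /= setTD preimage_setC; exact: sigma_algebraC.
  - by move=> F HF; rewrite /H /= preimage_bigcup; exact: sigma_algebra_bigcup.
move=> _ [a [b ->]]; rewrite /H /=.
(* A slab is not a box; it is the union of boxes whose other sides grow to the whole line. *)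
rewrite (_ : _ @^-1` _ = \bigcup_N obox (fun j => if j == i then a else - N%:R)
    (fun j => if j == i then b else N%:R)); last first.
  apply/seteqP; split => x /=.
    rewrite in_itv /= => xab; exists (Num.truncn `|x|).+1 => // j.
    case: ifP => [/eqP ->//|_]; rewrite -ltr_norml.
    apply: le_lt_trans (rV_coord_le x j) _; exact: truncnS_gt.
  by move=> [N _ /(_ i)]; rewrite eqxx in_itv.
apply: sigma_algebra_bigcup => N; apply: sub_sigma_algebra.
by eexists; eexists; reflexivity.
Qed.

Definition cube (N : nat) : set V := cbox (fun=> - N%:R) (fun=> N%:R).

Lemma cube_cover (x : V) : exists N0, forall N, (N0 <= N)%N -> cube N x.
Proof.
exists (Num.truncn `|x|).+1 => N NN i; rewrite -ler_norml.
apply: le_trans (rV_coord_le x i) _; apply: le_trans (ltW (truncnS_gt _)) _.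
by rewrite ler_nat.
Qed.

(** Sets over which a truncation of h integrates to 0 form a Dynkin system containing the boxes,
    which are stable under intersection and generate. Hence it integrates to 0 over every measurable
    set. *)
Lemma ae_null_of_boxes (h : V -> R) : measurable_fun setT h ->
  (forall N, mu.-integrable (cube N) (EFin \o h)) ->
  (forall a b, \int[mu]_(x in obox a b) h x = 0) ->
  {ae mu, forall x, h x = 0}.
Proof.
move=> mh ih h0.
suff key N : {ae mu, forall x, obox (fun=> - N%:R) (fun=> N%:R) x -> h x = 0}.
  have := ae_foralln key; apply: filterS => x hx.
  have [N xN] := cube_cover x; apply: (hx N.+1) => i.
  have := xN N (leqnn N) i => /andP[h1 h2].
  by rewrite (lt_le_trans _ h1) ?(le_lt_trans h2)// ?ltrN2 ltr_nat.
pose B : set V := obox (fun=> - N%:R) (fun=> N%:R).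
have mB : measurable B by exact: obox_measurable.
(* Cutting h to a cube makes it integrable on the whole space, as complements require; a box
   intersected with the cube is again a box. *)
pose k := h \_ B.
have ik : mu.-integrable setT (EFin \o k).
  rewrite /k -restrict_EFin; apply/integrable_restrict => //; rewrite setTI.
  apply: integrableS (ih N) => //; first exact: cbox_measurable.
  exact: obox_cbox.
have mk : measurable_fun setT (EFin \o k) by exact: measurable_int ik.
have ikA A : measurable A -> mu.-integrable A (EFin \o k).
  by move=> mA; exact: integrableS ik.
have kbox a b : \int[mu]_(x in obox a b) k x = 0.
  rewrite /k -Rintegral_mkcondr.
  by have [c [d ->]] := setI_boxes (ex_intro _ a (ex_intro _ b erefl))
    (ex_intro _ (fun=> - N%:R) (ex_intro _ (fun=> N%:R) erefl)).
have kA A : measurable A -> (\int[mu]_(x in A) (k x)%:E = 0)%E.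
  move=> mA.
  have e0 D : measurable D -> \int[mu]_(x in D) k x = 0 -> (\int[mu]_(x in D) (k x)%:E = 0)%E.
    by move=> mD; rewrite /Rintegral => k0; rewrite -[LHS]fineK ?k0//; apply: integrable_fin_num => //; exact: ikA.
  have kT : (\int[mu]_x (k x)%:E = 0)%E.
    apply: e0 => //; rewrite /k -Rintegral_mkcond; exact: h0.
  have := @dynkin_induction _ V boxes (fun A => (\int[mu]_(x in A) (k x)%:E = 0)%E)
    boxes_measurable setI_boxes kT _ _ _ A; apply.
  - by move=> _ [a [b ->]]; apply: e0; [exact: obox_measurable | exact: kbox].
  - move=> S mS kS.
    have := kT; rewrite -(setUv S) integral_setU_EFin//; last 3 first.
    + exact: measurableC.
    + by rewrite setUv; exact/measurable_EFinP.
    + by apply/disj_set2P; rewrite setICr.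
    by rewrite kS add0e.
  - move=> F mF tF kF.
    rewrite integral_bigcup//; last by apply: ikA; exact: bigcupT_measurable.
    by rewrite eseries0// => i _ _; exact: kF.
  - by rewrite -boxes_measurable.
have := @integral_ae_eq _ _ _ mu setT measurableT (cst 0%E) (EFin \o k) ik
  (measurable_cst _) _.
case=> [E _ mE|M [mM M0 sM]]; first by rewrite integral0 -[RHS](kA E mE).
exists M; split => // x /= nx; apply: sM => /= kx; apply: nx => Bx.
by have := kx I; rewrite /k /= patchE mem_set// => -[].
Qed.

End boxes.

Section densities.
Context {R : realType} {m : nat}.
Local Notation V := 'rV[R]_m.
Local Notation C := R[i].
Local Notation mu := (@lebesgue_rV R m).
Implicit Types (f g : V -> C) (K : set V).

Lemma loc_integrable_cmeas g : loc_integrable g -> cmeas g.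
Proof.
move=> lg.
have T : [set: V] = \bigcup_N cube N.
  apply/esym; rewrite -subTset => x _; have [N xN] := cube_cover x.
  by exists N => //; exact: xN.
have mc N : measurable (@cube R m N) by exact: cbox_measurable.
rewrite /cmeas T; split; apply/(measurable_fun_bigcup _ mc) => N.
- have [I _] := lg _ (@cbox_compact R m (fun=> - N%:R) (fun=> N%:R)).
  by apply/measurable_EFinP; exact: measurable_int I.
- have [_ I] := lg _ (@cbox_compact R m (fun=> - N%:R) (fun=> N%:R)).
  by apply/measurable_EFinP; exact: measurable_int I.
Qed.

Lemma loc_integrable_normc g K : loc_integrable g -> compact K ->
  mu.-integrable setT (EFin \o ((fun x => normc (g x)) \_ K)).
Proof.
move=> lg cK; have mK := rV_compact_measurable cK.
have [ir ii] := lg K cK.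
rewrite -restrict_EFin; apply/integrable_restrict => //; rewrite setTI.
apply: le_integrable (integrableD mK (integrable_norm ir) (integrable_norm ii)) => //.
  apply/measurable_EFinP; apply: measurable_funS (measurable_normc (loc_integrable_cmeas lg)) => //.
move=> x _; rewrite /= lee_fin ger0_norm ?normc_ge0//.
by apply: le_trans (normc_le _) _; exact: ler_norm.
Qed.

Lemma compact_cube K : compact K -> exists N, K `<=` cube N.
Proof.
move=> /compact_bounded[M [_ MK]].
exists (Num.truncn (`|M| + 1)).+1 => x Kx i; rewrite -ler_norml.
apply: le_trans (rV_coord_le x i) _; apply: le_trans (ltW (truncnS_gt _)).
by apply: MK => //; rewrite (le_lt_trans (ler_norm _))// ltrDl.
Qed.

(** Compact sets have finite measure because [decay] is at least 1 / M on the cube with sides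
    [-N, N]. *)
Lemma integrable_compact_cst K (c : R) : compact K ->
  mu.-integrable setT (EFin \o ((fun=> c) \_ K)).
Proof.
move=> cK; have [N KN] := compact_cube cK; have mK := rV_compact_measurable cK.
pose M : R := (1 + N%:R ^+ 2) ^+ m.
have M0 : 0 < M by rewrite exprn_gt0// ltr_pwDl// sqr_ge0.
rewrite -restrict_EFin; apply/integrable_restrict => //; rewrite setTI.
apply: le_integrable (integrableS _ mK _ (@integrable_decayZ R m (`|c| * M))) => //.
  by apply/measurable_EFinP; exact: measurable_cst.
move=> x Kx; rewrite /= lee_fin [leRHS]ger0_norm; last first.
  by rewrite mulr_ge0 ?mulr_ge0 ?(ltW M0) ?(ltW (decay_gt0 _)).
rewrite -mulrA ler_peMr// /decay /cauchyd prodfV ler_pdivlMr ?mul1r; last first.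
  by apply: prodr_gt0 => i _; rewrite ltr_pwDl// sqr_ge0.
rewrite /M -[X in _ ^+ X](card_ord m) -prodr_const; apply: ler_prod => i _.
rewrite addr_ge0 ?sqr_ge0//= lerD2l -[leLHS](real_normK (num_real _)).
by rewrite ler_pXn2r ?nnegrE// ler_norml; exact: KN.
Qed.

Lemma test_cintg g f K : loc_integrable g -> compact K -> cmeas f ->
  (forall x, ~ K x -> f x = 0) -> (forall x, normc (f x) <= 1) ->
  cintg mu (fun x => g x * f x) /\
  forall x, normc (g x * f x) <= ((fun x => normc (g x)) \_ K) x.
Proof.
move=> lg cK mf f0 f1.
have b x : normc (g x * f x) <= ((fun x => normc (g x)) \_ K) x.
  rewrite patchE; case: ifPn => [_|/negP xK].
    by rewrite normcM ler_piMr// normc_ge0.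
  by rewrite f0 ?mulr0 ?normc0// => /mem_set.
split => //; apply: le_cintg (loc_integrable_normc lg cK) b.
by apply: cmeasM => //; exact: loc_integrable_cmeas.
Qed.

Lemma reg_distE f phi : schwartz phi -> reg_dist f phi = cint mu (fun x => f x * phi x).
Proof. by move=> sp; rewrite /reg_dist /on_schwartz; case: asboolP. Qed.

(** The difference pairs to 0 with every bump. As n grows, dominated convergence on a compact box
    turns these pairings into integrals over the open box, and [ae_null_of_boxes] applies to real
    and imaginary parts. *)
Lemma density_unique g1 g2 : loc_integrable g1 -> loc_integrable g2 ->
  reg_dist g1 = reg_dist g2 -> {ae mu, forall x, g1 x = g2 x}.
Proof.
move=> l1 l2 e12; have m1 := loc_integrable_cmeas l1; have m2 := loc_integrable_cmeas l2.
pose g x := g1 x - g2 x.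
have mg : cmeas g by exact: cmeasB.
have lg : loc_integrable g.
  move=> K cK; have mK := rV_compact_measurable cK.
  have [r1 i1] := l1 K cK; have [r2 i2] := l2 K cK; split.
  - by under eq_fun do rewrite /g Re_add Re_opp EFinB; exact: integrableB.
  - by under eq_fun do rewrite /g Im_add Im_opp EFinB; exact: integrableB.
have key n a b : cint mu (fun x => g x * sbump n a b x) = 0.
  have bt := bump_test n a b; have sb := test_function_schwartz bt.
  have b0 x : ~ cbox a b x -> sbump n a b x = 0.
    by move=> xab; rewrite bumpE bumpR_out// => /obox_cbox.
  have b1 x : normc (sbump n a b x) <= 1.
    by rewrite bumpE normc_real ger0_norm ?bumpR_ge0// bumpR_le1.
  have [c1 _] := test_cintg l1 (@cbox_compact _ _ a b) (schwartz_cmeas sb) b0 b1.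
  have [c2 _] := test_cintg l2 (@cbox_compact _ _ a b) (schwartz_cmeas sb) b0 b1.
  under eq_cint do rewrite mulrBl.
  by rewrite cintB// -!reg_distE// e12 subrr.
have lim a b : \int[mu]_(x in obox a b) complex.Re (g x) = 0 /\
    \int[mu]_(x in obox a b) complex.Im (g x) = 0.
  have mo : measurable (obox a b : set V) by exact: obox_measurable.
  have L x (p : C -> R) : p (g x) * bumpR n a b x @[n --> \oo] --> ((fun x => p (g x)) \_ (obox a b)) x.
    rewrite (_ : (_ \_ _) x = p (g x) * \1_(obox a b) x).
      by apply: cvgM; [exact: cvg_cst | exact: bumpR_cvg].
    by rewrite patchE indicE; case: ifP => _; rewrite ?mulr1 ?mulr0.
  pose F n x := g x * sbump n a b x.
  pose G x : C := ((fun x => complex.Re (g x)) \_ (obox a b)) x +i*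
    ((fun x => complex.Im (g x)) \_ (obox a b)) x.
  have [] := @cint_dominated _ _ _ mu F G ((fun x => normc (g x)) \_ (cbox a b)).
  - by move=> n; apply: cmeasM => //; exact/schwartz_cmeas/(test_function_schwartz (bump_test n a b)).
  - have [mr mi] := mg; split => /=; apply/(measurable_restrictT _ mo); exact: measurable_funTS.
  - move=> x; have E n : complex.Re (F n x) = complex.Re (g x) * bumpR n a b x.
      by rewrite /F bumpE Re_mul /= mulr0 subr0.
    by rewrite (funext E); exact: (L x (@complex.Re R)).
  - move=> x; have E n : complex.Im (F n x) = complex.Im (g x) * bumpR n a b x.
      by rewrite /F bumpE Im_mul /= mulr0 add0r.
    by rewrite (funext E); exact: (L x (@complex.Im R)).
  - exact: loc_integrable_normc (@cbox_compact _ _ a b).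
  - move=> n x.
    have b0 y : ~ cbox a b y -> sbump n a b y = 0.
      by move=> yab; rewrite bumpE bumpR_out// => /obox_cbox.
    have b1 y : normc (sbump n a b y) <= 1.
      by rewrite bumpE normc_real ger0_norm ?bumpR_ge0// bumpR_le1.
    have sb := test_function_schwartz (bump_test n a b).
    by have [_] := test_cintg lg (@cbox_compact _ _ a b) (schwartz_cmeas sb) b0 b1; exact.
  have Er n : complex.Re (cint mu (F n)) = 0 by rewrite key.
  have Ei n : complex.Im (cint mu (F n)) = 0 by rewrite key.
  rewrite (funext Er) (funext Ei).
  move=> Lr Li; split; rewrite Rintegral_mkcond.
  - exact: (cvg_unique _ Lr (@cvg_cst _ (0 : R) _ \oo _)).
  - exact: (cvg_unique _ Li (@cvg_cst _ (0 : R) _ \oo _)).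
have [mr mi] := mg.
have ir N : mu.-integrable (cube N) (EFin \o (fun x => complex.Re (g x))).
  by have [] := lg _ (@cbox_compact R m (fun=> - N%:R) (fun=> N%:R)).
have ii N : mu.-integrable (cube N) (EFin \o (fun x => complex.Im (g x))).
  by have [] := lg _ (@cbox_compact R m (fun=> - N%:R) (fun=> N%:R)).
have Zr := ae_null_of_boxes mr ir (fun a b => (lim a b).1).
have Zi := ae_null_of_boxes mi ii (fun a b => (lim a b).2).
apply: filterS2 Zr Zi => x gr gi; apply/eqP; rewrite -subr_eq0; apply/eqP.
exact: complex_ext.
Qed.

End densities.

(** * Sobolev norms and densities *)

Section sobolev_norm.
Context {R : realType} {m : nat}.
Local Notation V := 'rV[R]_m.
Local Notation C := R[i].
Local Notation dist := ((V -> C) -> C).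
Local Notation mu := (@lebesgue_rV R m).
Implicit Types (f g : V -> C) (K : set V).

Definition weight (s : R) (x : V) : R := (1 + enorm x ^+ 2) `^ s.

Lemma weight_gt0 s x : 0 < weight s x.
Proof. by rewrite powR_gt0// ltr_pwDl// sqr_ge0. Qed.

Lemma measurable_weight s : measurable_fun setT (weight s).
Proof.
apply: (measurableT_comp (measurable_powR s)).
apply: measurable_funD => //; under eq_fun do rewrite sqr_enorm.
by apply: measurable_sum => i; apply: measurable_funM; exact: measurable_coord.
Qed.

Definition energy s g : \bar R := (\int[mu]_x (weight s x * normc (g x) ^+ 2)%:E)%E.

Lemma energy_ge0 s g : (0 <= energy s g)%E.
Proof.
by apply: integral_ge0 => x _; rewrite lee_fin mulr_ge0 ?sqr_ge0// ltW// weight_gt0.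
Qed.

Lemma measurable_energy s g : cmeas g ->
  measurable_fun setT (fun x => (weight s x * normc (g x) ^+ 2)%:E).
Proof.
move=> mg; apply/measurable_EFinP; apply: measurable_funM; first exact: measurable_weight.
by apply: measurable_funX; exact: measurable_normc.
Qed.

(** By [density_unique] every density has the energy of the chosen one, so norms can be computed
    from explicit transforms. *)
Lemma Hs_norm_density s u g : is_fourier_density u g ->
  Hs_norm s u = (energy s g `^ 2^-1)%E.
Proof.
move=> ug; rewrite /Hs_norm; case: asboolP => [ex|]; last by case; exists g.
have uh : is_fourier_density u (fourier_density u) by exact: xgetPex ex.
have [[lg eg] [lh eh]] := (ug, uh).
congr (_ `^ _)%E; apply: ae_eq_integral => //.
- exact: measurable_energy (loc_integrable_cmeas lh).
- exact: measurable_energy (loc_integrable_cmeas lg).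
- have := density_unique lh lg _; rewrite -eg -eh => /(_ erefl).
  by apply: filterS => x -> .
Qed.

Lemma Hs_norm_ltP s u (e : R) : 0 < e -> (Hs_norm s u < e%:E)%E ->
  exists2 g, is_fourier_density u g & (energy s g < (e ^+ 2)%:E)%E.
Proof.
move=> e0 ue.
have [g ug] : exists g, is_fourier_density u g.
  by move: ue; rewrite /Hs_norm; case: asboolP.
exists g => //; move: ue; rewrite (Hs_norm_density s ug).
have := energy_ge0 s g; case: (energy s g) => [a|//|//]; last first.
  by rewrite poweRyr// invr_eq0.
rewrite lee_fin => a0; rewrite poweR_EFin !lte_fin => h.
rewrite -[ltLHS](sqr_sqrtr a0) ltr_pXn2r ?nnegrE ?(ltW e0)// ?sqrtr_ge0//.
by rewrite -powR12_sqrt.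
Qed.

Lemma energy_Hs_norm_le s u g (e : R) : 0 <= e -> is_fourier_density u g ->
  (energy s g <= (e ^+ 2)%:E)%E -> (Hs_norm s u <= e%:E)%E.
Proof.
move=> e0 ug; rewrite (Hs_norm_density s ug).
have := energy_ge0 s g; case: (energy s g) => [a|//|//].
rewrite lee_fin => a0; rewrite poweR_EFin !lee_fin => h.
by rewrite powR12_sqrt// -[leRHS](ger0_norm e0) -sqrtr_sqr ler_wsqrtr.
Qed.

Local Notation hs := (- 2^-1 : R).

Lemma weight_half_le1 x : weight hs x <= 1.
Proof.
rewrite /weight powRN invf_le1 ?powR_gt0 ?ltr_pwDl ?sqr_ge0//.
rewrite powR12_sqrt ?addr_ge0 ?sqr_ge0//.
by rewrite -[leLHS]sqrtr1 ler_wsqrtr// lerDl sqr_ge0.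
Qed.

Lemma weight_halfV_le (x : V) : (weight hs x)^-1 <= 1 + enorm x ^+ 2.
Proof.
rewrite /weight powRN invrK powR12_sqrt ?addr_ge0 ?sqr_ge0//.
set w := 1 + _; have w1 : 1 <= w by rewrite lerDl sqr_ge0.
have w0 : 0 <= w by rewrite (le_trans _ w1).
rewrite -{2}(sqr_sqrtr w0) expr2 ler_peMr ?sqrtr_ge0//.
by rewrite -[leLHS]sqrtr1 ler_wsqrtr.
Qed.

(** One factor |f| absorbs the inverse weight, which is at most 1 + |x|^2; the other supplies the
    integrable decay. *)
Lemma schwartz_weighted f : schwartz f -> exists c : R,
  forall x, (weight hs x)^-1 * normc (f x) ^+ 2 <= c * decay x.
Proof.
move=> sf; have [c fc] := schwartz_decay sf; have [d fd] := schwartz_rapid sf 1%N.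
have d0 : 0 <= d.
  by apply: le_trans (fd 0); rewrite mulr_ge0 ?exprn_ge0 ?weight_ge0 ?normc_ge0.
exists (d * c) => x; rewrite expr2 mulrA -mulrA.
apply: le_trans (_ : d * normc (f x) <= _); last first.
  by rewrite -mulrA ler_wpM2l.
rewrite mulrA ler_wpM2r ?normc_ge0//; apply: le_trans (fd x); rewrite expr1.
by rewrite ler_wpM2r ?normc_ge0// weight_halfV_le.
Qed.

Lemma amgm (w t a b : R) : 0 < w -> 0 < t ->
  2 * (a * b) <= t * (w * a ^+ 2) + t^-1 * (w^-1 * b ^+ 2).
Proof.
move=> w0 t0; rewrite -subr_ge0.
have -> : t * (w * a ^+ 2) + t^-1 * (w^-1 * b ^+ 2) - 2 * (a * b) =
    (t * w)^-1 * (t * w * a - b) ^+ 2.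
  by field; rewrite !gt_eqF.
by rewrite mulr_ge0 ?sqr_ge0// invr_ge0 ltW// mulr_gt0.
Qed.

Lemma integrable_energy s g : cmeas g -> (energy s g < +oo)%E ->
  mu.-integrable setT (fun x => (weight s x * normc (g x) ^+ 2)%:E).
Proof.
move=> mg gfin; apply/integrableP; split; first exact: measurable_energy.
rewrite (eq_integral (fun x => (weight s x * normc (g x) ^+ 2)%:E))// => x _.
by rewrite /= ger0_norm// mulr_ge0 ?sqr_ge0// ltW// weight_gt0.
Qed.

(** The inequality [amgm] splits |g f| into the energy density of g and the dual weighted square of
    f, the latter below [D]; the factor 2 of [normc_cint] cancels the 1/2. [B] depends on f alone,
    and t is left free to be optimized in [le_sqrt_energy]. *)
Lemma pairing_bound f : schwartz f -> exists2 B : R, 0 <= B &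
  forall g, cmeas g -> (energy hs g < +oo)%E -> cintg mu (fun x => g x * f x) /\
    forall t : R, 0 < t ->
    normc (cint mu (fun x => g x * f x)) <= t * fine (energy hs g) + t^-1 * B.
Proof.
move=> sf; have [c fc] := schwartz_weighted sf.
pose D (x : V) := c * decay x.
have D0 x : 0 <= D x.
  by apply: le_trans (fc x); rewrite mulr_ge0 ?sqr_ge0// invr_ge0 ltW// weight_gt0.
exists (\int[mu]_x D x); first by apply: Rintegral_ge0 => x _.
move=> g mg gfin.
pose A (x : V) := weight hs x * normc (g x) ^+ 2.
have iA : mu.-integrable setT (EFin \o A) by exact: integrable_energy.
have iD : mu.-integrable setT (EFin \o D) by exact: integrable_decayZ.
have iZ (a : R) h : mu.-integrable setT (EFin \o h) ->
    mu.-integrable setT (EFin \o (fun x : V => a * h x)).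
  by move=> ih; rewrite /comp; under eq_fun do rewrite EFinM; exact: integrableZl.
have pt t x : 0 < t -> normc (g x * f x) <= 2^-1 * (t * A x + t^-1 * D x).
  move=> t0; rewrite normcM -ler_pdivrMl ?invr_gt0// invrK.
  apply: le_trans (amgm _ _ (weight_gt0 hs x) t0) _.
  by rewrite lerD2l ler_wpM2l ?invr_ge0 ?(ltW t0).
have mgf : cmeas (fun x => g x * f x) by apply: cmeasM => //; exact: schwartz_cmeas.
have iS t : mu.-integrable setT (EFin \o (fun x => t * A x + t^-1 * D x)).
  rewrite /comp; under eq_fun do rewrite EFinD.
  by apply: integrableD => //; exact: iZ.
split; first by apply: le_cintg (iZ _ _ (iS 1)) (fun x => pt 1 x ltr01).
move=> t t0; apply: le_trans (normc_cint mgf (iZ _ _ (iS t)) (fun x => pt t x t0)) _.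
rewrite RintegralZl// mulrA divff// mul1r RintegralD//; [|exact: iZ|exact: iZ].
by rewrite RintegralZl// RintegralZl.
Qed.

(* Cauchy-Schwarz from the arithmetic-geometric mean inequality: take
   [t = 1 / sqrt energy], or let [t] tend to infinity if the energy is 0. *)
Lemma le_sqrt_energy g f (B : R) : (forall t : R, 0 < t ->
    normc (cint mu (fun x => g x * f x)) <= t * fine (energy hs g) + t^-1 * B) ->
  normc (cint mu (fun x => g x * f x)) <= (1 + B) * Num.sqrt (fine (energy hs g)).
Proof.
move=> H; set a := fine _ in H *; set n := normc _ in H *.
have a0 : 0 <= a by rewrite fine_ge0// energy_ge0.
have [a1|] := ltP 0 a.
  have s0 : 0 < Num.sqrt a by rewrite sqrtr_gt0.
  apply: le_trans (H (Num.sqrt a)^-1 _) _; first by rewrite invr_gt0.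
  have e : a = Num.sqrt a ^+ 2 by rewrite sqr_sqrtr.
  rewrite invrK [X in _ * X + _]e le_eqVlt; apply/orP; left; apply/eqP; field.
  by rewrite gt_eqF.
move=> a1; have {a0 a1} a0 : a = 0 by apply/eqP; rewrite eq_le a1.
rewrite a0 sqrtr0 mulr0; apply/ler_addgt0Pl => e e0; rewrite addr0.
have B1 : 0 < `|B| + 1 by rewrite ltr_wpDl.
apply: le_trans (H ((`|B| + 1) / e) _) _; first by rewrite divr_gt0.
rewrite a0 mulr0 add0r invf_div mulrAC ler_pdivrMr// ler_wpM2l ?(ltW e0)//.
by apply: le_trans (ler_norm _) _; rewrite lerDl.
Qed.

Lemma Hs_eval_bounded f : schwartz f ->
  bounded_functional (Hs hs) (Hs_norm hs) (fun u : dist => u f).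
Proof.
move=> sf; split; first by move=> a u v _ _.
have [p sp <-] := fourier_surjective sf.
have [B B0 HB] := pairing_bound sp.
exists (1 + B) => u [tu ufin].
have [g ug gfin] : exists2 g, is_fourier_density u g & (energy hs g < +oo)%E.
  have [g ug] : exists g, is_fourier_density u g.
    by move: ufin; rewrite /Hs_norm; case: asboolP.
  exists g => //; move: ufin; rewrite (Hs_norm_density _ ug).
  have := energy_ge0 hs g; case: (energy hs g) => [a _ _|//|//]; first exact: ltry.
  by rewrite poweRyr// invr_eq0.
have [lg eg] := ug; have mg := loc_integrable_cmeas lg.
have := le_sqrt_energy (HB g mg gfin).2.
rewrite -reg_distE// -eg /fourier_dist /on_schwartz; case: asboolP => // _.
rewrite (Hs_norm_density _ ug).
have := energy_ge0 hs g; move: gfin; case: (energy hs g) => [a _ a0|//|//] /=.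
by rewrite -EFinM lee_fin powR12_sqrt.
Qed.

End sobolev_norm.

Section regular_densities.
Context {R : realType} {m : nat}.
Local Notation V := 'rV[R]_m.
Local Notation C := R[i].
Local Notation dist := ((V -> C) -> C).
Local Notation mu := (@lebesgue_rV R m).
Local Notation hs := (- 2^-1 : R).
Implicit Types (f g : V -> C) (K : set V).

Lemma bounded_loc_integrable g (c : R) : cmeas g -> (forall x, normc (g x) <= c) ->
  loc_integrable g.
Proof.
move=> [mr mi] gc K cK; have mK := rV_compact_measurable cK.
have := integrable_compact_cst c cK.
rewrite -restrict_EFin => /(integrable_restrict mu mK measurableT (EFin \o cst c)).
rewrite setTI => iK.
split; apply: le_integrable iK => //.
- by apply/measurable_EFinP; exact: measurable_funTS.
- move=> x _; rewrite /= lee_fin; apply: le_trans (ler_Re _) _.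
  by apply: le_trans (gc x) _; exact: ler_norm.
- by apply/measurable_EFinP; exact: measurable_funTS.
- move=> x _; rewrite /= lee_fin; apply: le_trans (ler_Im _) _.
  by apply: le_trans (gc x) _; exact: ler_norm.
Qed.

Lemma compact_support_moment1 f (c : R) K : cmeas f -> compact K ->
  (forall x, normc (f x) <= c) -> (forall x, ~ K x -> f x = 0) -> moment1 f.
Proof.
move=> mf cK fc f0.
have key g (d : R) : cmeas g -> (forall x, K x -> normc (g x) <= d) ->
    (forall x, ~ K x -> g x = 0) -> cintg mu g.
  move=> mg gd g0; apply: le_cintg mg (integrable_compact_cst d cK) _ => x.
  rewrite patchE; case: ifPn => [/set_mem/gd//|/negP xK].
  by rewrite g0 ?normc0// => /mem_set.
have [N KN] := compact_cube cK.
split; first by apply: (key f c).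
move=> i; apply: (key _ (N%:R * c)).
- apply: cmeasM => //; apply: cmeas_real; exact: measurable_coord.
- move=> x /KN xN; rewrite normcM normc_real ler_pM ?normc_ge0//.
  by rewrite ler_norml; exact: xN.
- by move=> x /f0 ->; rewrite mulr0.
Qed.

Lemma cintg_mul_ft f g : cintg mu f -> moment1 g -> cintg mu (fun x => f x * ft g x).
Proof.
move=> fi g1; have [gi _] := g1.
apply: (@le_cintg _ _ _ _ _ (fun x => (2 * \int[mu]_x normc (g x)) * normc (f x))).
- by apply: cmeasM; [exact: cintg_meas fi | exact: ft_cmeas].
- by rewrite /comp; under eq_fun do rewrite EFinM; apply: integrableZl => //; exact: cintg_normc.
- by move=> x; rewrite normcM mulrC ler_wpM2r ?normc_ge0//; exact: normc_ft.
Qed.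

(** Needed for interpolation errors, which are discontinuous; hence the assumption [moment1] rather
    than smoothness. *)
Lemma fourier_density_reg f : moment1 f -> is_fourier_density (reg_dist f) (fourier f).
Proof.
move=> f1; have [fi _] := f1; split.
  apply: (@bounded_loc_integrable _ (normc ((2 * pi) `^ (- (m%:R / 2)))%:C *
      (2 * \int[mu]_x normc (f x)))).
    by rewrite fourierE; apply: cmeasM; [exact: cmeas_cst | exact: ft_cmeas].
  by move=> xi; rewrite fourierE normcM ler_wpM2l ?normc_ge0//; exact: normc_ft.
apply/funext => phi; rewrite /fourier_dist /reg_dist /on_schwartz.
case: asboolP => // sp; rewrite asboolT; last exact: schwartz_fourier.
have ip := schwartz_cintg sp; have p1 := schwartz_cintg (schwartz_ft sp).
pose c : C := ((2 * pi) `^ (- (m%:R / 2)))%:C.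
transitivity (c * cint mu (fun x => f x * ft phi x)).
  rewrite -cintZ; first by apply: eq_cint => x; rewrite fourierE -/c mulrCA.
  exact: (cintg_mul_ft fi (schwartz_moment1 sp)).
rewrite ft_mult// -cintZ; first by apply: eq_cint => x; rewrite fourierE -/c mulrA.
by under eq_fun do rewrite mulrC; exact: (cintg_mul_ft ip f1).
Qed.

(** At the exponent -1/2 the weight is at most 1, so [bessel] applies; the square of the normalizing
    factor cancels its (2 pi)^m and leaves 4. *)
Lemma energy_fourier_le f : moment1 f ->
  (energy hs (fourier f) <= 4%:E * \int[mu]_x (normc (f x) ^+ 2)%:E)%E.
Proof.
move=> f1; have mft := ft_cmeas f1.
set c : R := (2 * pi) `^ (- (m%:R / 2)).
have T0 : 0 < 2 * pi :> R by rewrite mulr_gt0// pi_gt0.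
have c2 : c ^+ 2 * (4 * (2 * pi) ^+ m) = 4.
  rewrite /c expr2 -powRD; last by apply/implyP => _; rewrite gt_eqF.
  rewrite (_ : _ + _ = - m%:R); last by field.
  by rewrite powRN powR_mulrn ?(ltW T0)//; field; rewrite expf_neq0// gt_eqF.
apply: (@le_trans _ _ ((c ^+ 2)%:E * \int[mu]_x (normc (ft f x) ^+ 2)%:E)%E).
  have mm : measurable_fun setT (fun x => (normc (ft f x) ^+ 2)%:E).
    by apply/measurable_EFinP; apply: measurable_funX; exact: measurable_normc.
  have z0 (r : R) : (0 <= (r ^+ 2)%:E)%E by rewrite lee_fin sqr_ge0.
  rewrite -ge0_integralZl//.
  apply: ge0_le_integral => //.
  - by move=> x _; rewrite lee_fin mulr_ge0 ?sqr_ge0// ltW// weight_gt0.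
  - by apply: measurable_energy; rewrite fourierE; apply: cmeasM => //; exact: cmeas_cst.
  - apply/measurable_EFinP; apply: measurable_funM => //.
    by apply: measurable_funX; exact: measurable_normc.
  - move=> x _; rewrite -EFinM lee_fin fourierE normcM normc_real exprMn -/c.
    have q0 : 0 <= c ^+ 2 * normc (ft f x) ^+ 2 by rewrite mulr_ge0 ?sqr_ge0.
    by rewrite (real_normK (num_real c)); exact: (ler_piMl q0 (weight_half_le1 x)).
have -> : (4%:E = (c ^+ 2)%:E * (4 * (2 * pi) ^+ m)%:E :> \bar R)%E.
  by rewrite -[RHS]EFinM c2.
rewrite -muleA; apply: lee_wpmul2l; first by rewrite lee_fin sqr_ge0.
exact: bessel.
Qed.

Lemma energyB s f g : cmeas f -> cmeas g ->
  (energy s (fun x => f x - g x)%R <= 2%:E * energy s f + 2%:E * energy s g)%E.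
Proof.
move=> mf mg.
have p0 h x : (0 <= (weight s x * normc (h x) ^+ 2)%:E :> \bar R)%E.
  by rewrite lee_fin mulr_ge0 ?sqr_ge0// ltW// weight_gt0.
rewrite -!ge0_integralZl//; [|exact: measurable_energy|exact: measurable_energy].
have p1 (h : V -> C) x : (0 <= 2%:E * (weight s x * normc (h x) ^+ 2)%:E :> \bar R)%E.
  by rewrite mule_ge0.
have mm h : cmeas h -> measurable_fun setT (fun x : V => 2%:E * (weight s x * normc (h x) ^+ 2)%:E)%E.
  by move=> mh; apply: measurable_funeM; exact: measurable_energy.
rewrite -ge0_integralD//; [|exact: mm|exact: mm].
apply: ge0_le_integral => //.
- by move=> x _; rewrite lee_fin mulr_ge0 ?sqr_ge0// ltW// weight_gt0.
- exact: measurable_energy (cmeasB mf mg).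
- by apply: emeasurable_funD; exact: mm.
- move=> x _; rewrite -!EFinM -EFinD lee_fin !(mulrCA 2) -mulrDr.
  rewrite ler_wpM2l ?(ltW (weight_gt0 _ _))//.
  apply: (@le_trans _ _ ((normc (f x) + normc (g x)) ^+ 2)).
    by rewrite ler_pXn2r ?nnegrE ?addr_ge0 ?normc_ge0// normcB.
  rewrite -subr_ge0 (_ : _ - _ = (normc (f x) - normc (g x)) ^+ 2) ?sqr_ge0//; ring.
Qed.

Lemma fourier_dist_sub u v : fourier_dist (u - v) = fourier_dist u - fourier_dist v :> dist.
Proof.
by apply/funext => phi; rewrite /fourier_dist /on_schwartz /= !fctE; case: asboolP => //; rewrite subr0.
Qed.

(** A locally integrable function need not be integrable against a Schwartz function, and its
    pairing is then a default value. Finite energy makes both pairings genuine, hence additive. *)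
Lemma density_energy_sub u v g h : is_fourier_density u g -> is_fourier_density v h ->
  (energy hs g < +oo)%E -> (energy hs h < +oo)%E ->
  is_fourier_density (u - v : dist) (fun x => g x - h x).
Proof.
move=> [lg eg] [lh eh] gfin hfin.
have mg := loc_integrable_cmeas lg; have mh := loc_integrable_cmeas lh.
split.
  move=> K cK; have mK := rV_compact_measurable cK.
  have [r1 i1] := lg K cK; have [r2 i2] := lh K cK; split.
  - by under eq_fun do rewrite Re_add Re_opp EFinB; exact: integrableB.
  - by under eq_fun do rewrite Im_add Im_opp EFinB; exact: integrableB.
rewrite fourier_dist_sub eg eh; apply/funext => phi; rewrite !fctE.
have [sp|nsp] := pselect (schwartz phi); last first.
  by rewrite /reg_dist /on_schwartz; case: asboolP => //; rewrite subr0.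
have [B0 _ B] := pairing_bound sp.
rewrite !reg_distE//; have [c1 _] := B g mg gfin; have [c2 _] := B h mh hfin.
by under [RHS]eq_cint do rewrite mulrBl; rewrite cintB.
Qed.

End regular_densities.

(** * Piecewise constant interpolation on meshes *)

Section mesh_interpolation.
Context {R : realType} {m : nat}.
Local Notation V := 'rV[R]_m.
Local Notation C := R[i].
Local Notation mu := (@lebesgue_rV R m).
Context (Omega : set V) (M : preconvex_mesh Omega).
Implicit Types (phi : V -> C).

Definition mesh_pt (l : 'I_(mesh_card M)) : V := projT1 (cid (mesh_cell_nonempty (p := M) l)).

Lemma mesh_ptP l : mesh_cell (p := M) l (mesh_pt l).
Proof. exact: projT2 (cid (mesh_cell_nonempty (p := M) l)). Qed.

Lemma mesh_cell_disjoint k l x : mesh_cell (p := M) k x -> mesh_cell (p := M) l x -> k = l.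
Proof.
move=> xk xl; apply/eqP; apply: contrapT => /negP kl.
have := mesh_cell_hulls (p := M) kl; apply/eqP/set0P; exists x; split; exact: sub_gen_smallest.
Qed.

(** Sampling at one arbitrary point per cell: convergence then follows from continuity of phi, and
    any bound on phi is inherited. Off the cells the value is 0. *)
Definition mesh_interp phi : V -> C := fun x =>
  \sum_l (\1_(mesh_cell (p := M) l) x)%:C * phi (mesh_pt l).

Lemma mesh_interp_cell phi l x : mesh_cell (p := M) l x -> mesh_interp phi x = phi (mesh_pt l).
Proof.
move=> xl; rewrite /mesh_interp (bigD1 l)//= indicE mem_set// mul1r big1 ?addr0// => k kl.
rewrite indicE memNset ?mul0r// => xk.
by move/eqP: kl; apply; exact: mesh_cell_disjoint xk xl.
Qed.

Lemma mesh_interp_out phi x : (forall l, ~ mesh_cell (p := M) l x) -> mesh_interp phi x = 0.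
Proof. by move=> xM; rewrite /mesh_interp big1// => l _; rewrite indicE memNset// mul0r. Qed.

Lemma mesh_interp_le phi (c : R) : (forall x, normc (phi x) <= c) ->
  forall x, normc (mesh_interp phi x) <= c.
Proof.
move=> pc x; have [[l xl]|/forallNP xM] := pselect (exists l, mesh_cell (p := M) l x).
  by rewrite (mesh_interp_cell _ xl).
by rewrite mesh_interp_out// normc0; apply: le_trans (pc 0); exact: normc_ge0.
Qed.

Lemma cmeas_sum (I : Type) (r : seq I) (F : I -> V -> C) :
  (forall i, cmeas (F i)) -> cmeas (fun x => \sum_(i <- r) F i x).
Proof.
move=> mF; elim: r => [|i r IH].
  by under eq_fun do rewrite big_nil; exact: cmeas_cst.
by under eq_fun do rewrite big_cons; exact: cmeasD.
Qed.

Lemma mesh_interp_meas phi : cmeas (mesh_interp phi).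
Proof.
apply: cmeas_sum => l; apply: cmeasM; last exact: cmeas_cst.
apply: cmeas_real; apply: measurable_indic; apply: rV_open_measurable.
exact: mesh_cell_open.
Qed.

Lemma mesh_interp_pc phi : piecewise_constant M (mesh_interp phi).
Proof.
split=> [l x y xl yl|x xO]; first by rewrite !(mesh_interp_cell _ xl, mesh_interp_cell _ yl).
by apply: mesh_interp_out => l /mesh_cell_sub.
Qed.

Lemma mesh_interp_space phi : pc_space M (reg_dist (mesh_interp phi)).
Proof.
exists (mesh_interp phi) => //; split; last exact: mesh_interp_pc.
exact: mesh_interp_meas.
Qed.

Lemma coord_le_enorm (z : V) i : `|z ord0 i| <= enorm z.
Proof.
rewrite -(ler_pXn2r (ltn0Sn 1)) ?nnegrE ?sqrtr_ge0//.
by rewrite (real_normK (num_real _)) sqr_coord_le.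
Qed.

Lemma mesh_cell_close l x y i : bounded_set Omega ->
  mesh_cell (p := M) l x -> mesh_cell (p := M) l y ->
  `|x ord0 i - y ord0 i| <= mesh_size M.
Proof.
move=> [B [_ OB]] xl yl.
have {}OB z : Omega z -> `|z| <= `|B| + 1.
  by apply: OB; rewrite (le_lt_trans (ler_norm _))// ltrDl.
apply: (@le_trans _ _ (diam (mesh_cell (p := M) l))); last first.
  by rewrite /mesh_size; exact: le_bigmax.
apply: (@le_trans _ _ (enorm (x - y))).
  by have := coord_le_enorm (x - y) i; rewrite !mxE.
(* [diam] is a [sup], which dominates the distances only when they are bounded above; boundedness of
   [Omega] provides this. *)
apply: ub_le_sup; last by exists (x, y).
exists (Num.sqrt (\sum_(i < m) (2 * (`|B| + 1)) ^+ 2)) => _ [[u v] [/= ul vl] <-].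
rewrite ler_wsqrtr//; apply: ler_sum => j _; rewrite -expr2 -(real_normK (num_real _)).
rewrite ler_pXn2r ?nnegrE ?mulr_ge0 ?addr_ge0// !mxE.
apply: le_trans (ler_normB _ _) _; rewrite mulr_natl mulr2n.
by apply: lerD; apply: le_trans (rV_coord_le _ _) _; apply: OB;
  [exact: (mesh_cell_sub ul) | exact: (mesh_cell_sub vl)].
Qed.

(** By [mesh_cover] a point of [Omega] lies in the closure of some cell; if it lies in no cell, it
    belongs to one of finitely many null boundaries. *)
Lemma mesh_ae_cover : {ae mu, forall x, Omega x -> exists l, mesh_cell (p := M) l x}.
Proof.
have nb l : mu.-negligible (boundary (mesh_cell (p := M) l)).
  apply/negligibleP; last exact: mesh_cell_boundary.
  apply: measurableD; first by apply: rV_closed_measurable; exact: closed_closure.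
  by apply: rV_open_measurable; exact: open_interior.
have nU : mu.-negligible (\big[setU/set0]_l boundary (mesh_cell (p := M) l)).
  by apply: big_ind => //; [exact: negligible_set0 | exact: negligibleU].
apply: negligibleS nU => x /= /not_implyP[Ox /forallNP xM].
have : (\bigcup_l closure (mesh_cell (p := M) l))° x by rewrite -mesh_cover.
move=> /interior_subset[l _ xl]; rewrite -bigcup_seq; exists l.
  by rewrite /= mem_index_enum.
split => // /interior_subset; exact: xM.
Qed.

End mesh_interpolation.

(** * Convergence of the interpolants in L^2 and in H^(-1/2) *)

Section approximation.
Context {R : realType} {m : nat}.
Local Notation V := 'rV[R]_m.
Local Notation C := R[i].
Local Notation dist := ((V -> C) -> C).
Local Notation mu := (@lebesgue_rV R m).
Local Notation hs := (- 2^-1 : R).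
Context (Gamma_ : nat -> set V) (M : forall j, preconvex_mesh (Gamma_ j)).
Context (Omega K : set V).
Hypothesis Gamma_bounded : forall j, bounded_set (Gamma_ j).
Hypothesis mesh_size_cvg : mesh_size (M j) @[j --> \oo] --> (0 : R).
Hypothesis Omega_eventually : forall x, Omega x -> \forall j \near \oo, Gamma_ j x.
Hypothesis K_compact : compact K.
Hypothesis Gamma_sub : forall j, Gamma_ j `<=` K.
Hypothesis Omega_sub : Omega `<=` K.

Section test.
Variable phi : V -> C.
Hypothesis phi_test : test_function Omega phi.
Let f j := mesh_interp (M j) phi.

Let phi_out x : ~ Omega x -> phi x = 0.
Proof.
move=> xO; apply: contrapT => /eqP px; apply: xO.
by have [_ _] := phi_test; apply; exact: subset_closure.
Qed.

Let phi_sch : schwartz phi.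
Proof. exact: test_function_schwartz phi_test. Qed.

Let phi_le : exists2 c : R, 0 <= c & forall x, normc (phi x) <= c.
Proof.
have [c fc] := schwartz_rapid phi_sch 0%N.
have {}fc x : normc (phi x) <= c by have := fc x; rewrite expr0 mul1r.
by exists c => //; apply: le_trans (fc 0); exact: normc_ge0.
Qed.

Lemma interp_out j x : ~ K x -> f j x = 0.
Proof. by move=> xK; apply: mesh_interp_out => l /mesh_cell_sub/Gamma_sub. Qed.

Lemma phi_outK x : ~ K x -> phi x = 0.
Proof. by move=> xK; apply: phi_out => /Omega_sub. Qed.

Lemma interp_sub_moment1 j : moment1 (fun x => f j x - phi x).
Proof.
have [c c0 pc] := phi_le.
apply: (@compact_support_moment1 _ _ _ (c + c) K) => //.
- by apply: cmeasB; [exact: mesh_interp_meas | exact: schwartz_cmeas].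
- by move=> x; apply: le_trans (normcB _ _) _; apply: lerD; [exact: mesh_interp_le | exact: pc].
- by move=> x xK; rewrite interp_out// phi_outK// subr0.
Qed.

Lemma interp_cvg : {ae mu, forall x, normc (f j x - phi x) @[j --> \oo] --> (0 : R)}.
Proof.
have := ae_foralln (fun j => mesh_ae_cover (M j)); apply: filterS => x xM.
have [cr ci] := smooth_ccontinuous (schwartz_smooth phi_sch).
apply/cvgrPdist_le => e e0.
have e20 : 0 < e / 2 by rewrite divr_gt0.
have /nbhs_ballP[d1 /= d10 D1] : \forall y \near x, `|complex.Re (phi x) - complex.Re (phi y)| < e / 2.
  by have /cvgrPdist_lt := cr x; apply.
have /nbhs_ballP[d2 /= d20 D2] : \forall y \near x, `|complex.Im (phi x) - complex.Im (phi y)| < e / 2.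
  by have /cvgrPdist_lt := ci x; apply.
pose d := Num.min d1 d2.
have d0 : 0 < d by rewrite lt_min d10.
(* Where phi x is non-zero, x lies in [Omega] and so eventually in [Gamma_ j]. Where phi x = 0, x
   may fall outside [Gamma_ j], but then the interpolant vanishes there too. *)
have near1 : \forall j \near \oo, phi x != 0 -> Gamma_ j x.
  have [px|px] := eqVneq (phi x) 0; first exact: nearW.
  have Ox : Omega x by apply: contrapT => /phi_out; exact/eqP.
  by apply: filterS (Omega_eventually Ox).
near=> j; rewrite sub0r normrN ger0_norm ?normc_ge0//.
have [xj|xj] := pselect (Gamma_ j x); last first.
  rewrite /f mesh_interp_out; last by move=> l /mesh_cell_sub.
  have [->|px] := eqVneq (phi x) 0; first by rewrite subr0 normc0 ltW.
  by case: xj; move: px; near: j.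
have [l xl] := xM j xj.
rewrite /f (mesh_interp_cell _ xl); set y := mesh_pt l.
have xy i : `|x ord0 i - y ord0 i| < d.
  apply: le_lt_trans (mesh_cell_close i (Gamma_bounded j) xl (mesh_ptP l)) _.
  near: j; have /cvgrPdist_lt /(_ d d0) := mesh_size_cvg.
  by apply: filterS => j; rewrite sub0r normrN; apply: le_lt_trans; exact: ler_norm.
apply: le_trans (normc_le _) _; rewrite Re_add Re_opp Im_add Im_opp (splitr e).
apply: lerD; rewrite distrC ltW//.
- by apply: D1; apply/rV_ballP => // i; have := xy i; rewrite lt_min => /andP[].
- by apply: D2; apply/rV_ballP => // i; have := xy i; rewrite lt_min => /andP[].
Unshelve. all: by end_near.
Qed.

Lemma interp_L2 (e : R) : 0 < e -> \forall j \near \oo,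
  (\int[mu]_x (normc (f j x - phi x) ^+ 2)%:E <= e%:E)%E.
Proof.
move=> e0; have [c c0 pc] := phi_le.
have mf j : cmeas (fun x => f j x - phi x).
  by apply: cmeasB; [exact: mesh_interp_meas | exact: schwartz_cmeas].
have mF j : measurable_fun setT (fun x => (normc (f j x - phi x) ^+ 2)%:E).
  by apply/measurable_EFinP; apply: measurable_funX; exact: measurable_normc.
have cF : {ae mu, forall x, setT x ->
    (normc (f j x - phi x) ^+ 2)%:E @[j --> \oo] --> (cst 0%E) x}.
  apply: filterS interp_cvg => x cx _; apply: cvg_EFin; first exact: nearW.
  rewrite -[X in _ --> X](mulr0 0) /=; exact: cvgM.
have bF : {ae mu, forall x j, setT x ->
    (`|(normc (f j x - phi x) ^+ 2)%:E| <= (EFin \o ((fun=> ((c + c) ^+ 2)%R) \_ K)) x)%E}.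
  apply: aeW => x j _; rewrite /= lee_fin ger0_norm ?sqr_ge0// patchE.
  case: ifPn => [_|/negP xK]; last first.
    have nK : ~ K x by move=> /mem_set.
    by rewrite interp_out// phi_outK// subr0 normc0 expr0n.
  rewrite ler_pXn2r ?nnegrE ?addr_ge0 ?normc_ge0//.
  by apply: le_trans (normcB _ _) _; apply: lerD; [exact: mesh_interp_le | exact: pc].
have [_ _] := dominated_convergence measurableT mF (measurable_cst _) cF
  (integrable_compact_cst _ K_compact) bF.
rewrite integral0 => /fine_cvgP[finF /cvgrPdist_lt/(_ e e0)].
apply: filterS2 finF => j fj /=; rewrite sub0r normrN => h.
have -> : (\int[mu]_x (normc (f j x - phi x) ^+ 2)%:E =
    (fine (\int[mu]_x (normc (f j x - phi x) ^+ 2)%:E))%:E)%E by rewrite fineK.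
rewrite lee_fin; apply: le_trans (ler_norm _) _; exact: ltW.
Qed.

End test.

Lemma pc_space_approx (w : dist) (e : R) : Hs_tilde hs Omega w -> 0 < e ->
  \forall j \near \oo, exists2 v, pc_space (M j) v & (Hs_norm hs (v - w)%R < e%:E)%E.
Proof.
move=> [_ wO] e0; have e40 : 0 < e / 4 by rewrite divr_gt0.
have [phi tphi /(Hs_norm_ltP e40)[g dg ge]] := wO _ e40.
have sphi := test_function_schwartz tphi.
(* [energy_fourier_le] multiplies this by 4, giving e^2/16, which is also the bound (e/4)^2 for w -
   phi. [energyB] doubles both, and the total e^2/4 is the square of e/2 < e. *)
have e60 : 0 < e ^+ 2 / 64 by rewrite divr_gt0// exprn_gt0.
have := interp_L2 tphi e60; apply: filterS => j fj.
pose f := mesh_interp (M j) phi; pose h x := f x - phi x.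
exists (reg_dist f); first exact: mesh_interp_space.
have h1 : moment1 h by exact: interp_sub_moment1 tphi j.
have dh := fourier_density_reg h1.
have Eh : (energy hs (fourier h) <= (e ^+ 2 / 16)%:E)%E.
  apply: le_trans (energy_fourier_le h1) _.
  rewrite (_ : e ^+ 2 / 16 = 4 * (e ^+ 2 / 64)); last by field.
  by rewrite EFinM; exact: lee_wpmul2l.
have hfin : (energy hs (fourier h) < +oo)%E by apply: le_lt_trans Eh _; exact: ltry.
have gfin : (energy hs g < +oo)%E by apply: lt_trans ge _; exact: ltry.
(* The error is written as (f - phi) - (w - phi), since densities and energies are controlled for
   these two differences. *)
have E : reg_dist f - w = reg_dist h - (w - reg_dist phi) :> dist.
  have -> : reg_dist h = reg_dist f - reg_dist phi :> dist; last first.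
    by rewrite opprB addrA subrK.
  apply/funext => psi; rewrite !fctE.
  have [sp|nsp] := pselect (schwartz psi); last first.
    by rewrite /reg_dist /on_schwartz; case: asboolP => //; rewrite subr0.
  rewrite !reg_distE//; have ip := schwartz_cintg sp.
  have [c pc] := schwartz_rapid sphi 0%N.
  have {}pc x : normc (phi x) <= c by have := pc x; rewrite expr0 mul1r.
  have ib k : cmeas k -> (forall x, normc (k x) <= c) -> cintg mu (fun x => k x * psi x).
    move=> mk kc; apply: (@le_cintg _ _ _ _ _ (fun x => c * normc (psi x))).
    - by apply: cmeasM => //; exact: cintg_meas ip.
    - by rewrite /comp; under eq_fun do rewrite EFinM; apply: integrableZl => //; exact: cintg_normc.
    - by move=> x; rewrite normcM ler_wpM2r ?normc_ge0.
  under [LHS]eq_cint do rewrite mulrBl.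
  rewrite cintB//; apply: ib => //; first exact: mesh_interp_meas.
    exact: mesh_interp_le.
  exact: schwartz_cmeas.
rewrite E; apply: (@le_lt_trans _ _ (e / 2)%:E); last first.
  by rewrite lte_fin ltr_pdivrMr// mulr_natr mulr2n ltrDl.
apply: (energy_Hs_norm_le _ (density_energy_sub dh dg hfin gfin)).
  by rewrite divr_ge0// ltW.
have [[lh _] [lg _]] := (dh, dg).
apply: le_trans (energyB _ (loc_integrable_cmeas lh) (loc_integrable_cmeas lg)) _.
rewrite (_ : (e / 2) ^+ 2 = 2 * (e ^+ 2 / 16) + 2 * (e / 4) ^+ 2); last by field.
rewrite [leRHS]EFinD; apply: leeD; rewrite [leRHS]EFinM; apply: lee_wpmul2l => //.
exact: ltW.
Qed.

End approximation.

Section selection.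
Context {R : realType} {E : lmodType R[i]} (nrm : E -> \bar R).
Hypothesis nrm_ge0 : forall u, (0 <= nrm u)%E.

(** The approximants depend on the precision e, whereas one sequence must serve all e. At index j
    the element chosen meets the best precision 1/(k+1) attainable in [W_ j] among k <= j, or is
    arbitrary if none is. *)
Lemma select_cvg (W_ : nat -> set E) (w : E) :
  (forall j, W_ j !=set0) ->
  (forall e : R, 0 < e -> \forall j \near \oo, exists2 v, W_ j v & (nrm (v - w)%R < e%:E)%E) ->
  exists2 w_ : nat -> E, forall j, W_ j (w_ j) & nrm (w_ j - w) @[j --> \oo] --> 0%E.
Proof.
move=> W0 HW.
pose P j k v := W_ j v /\ (nrm (v - w)%R < (k.+1%:R^-1)%:E)%E.
(* [sel j n]: an element of [W_ j] that is as good as possible, up to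
   precision [1 / n.+1] *)
have sel j n : exists2 v, W_ j v & forall k, (k <= n)%N -> (exists v, P j k v) -> P j k v.
  elim: n => [|n [v Wv IH]].
    have [[v Pv]|nP] := pselect (exists v, P j 0%N v).
      by exists v; [case: Pv | move=> k; rewrite leqn0 => /eqP ->].
    by have [v Wv] := W0 j; exists v => // k; rewrite leqn0 => /eqP -> /nP.
  have [[u Pu]|nP] := pselect (exists v, P j n.+1 v).
    exists u; first by case: Pu.
    move=> k kn _; have [Wu un] := Pu; split => //; apply: lt_le_trans un _.
    by rewrite lee_fin lef_pV2 ?posrE// ler_nat ltnS.
  exists v => // k; rewrite leq_eqVlt => /predU1P[-> /nP//|]; rewrite ltnS; exact: IH.
have /choice[w_ Hw] j := let: ex_intro2 v a b := sel j j in
  ex_intro (fun v => W_ j v /\ forall k, (k <= j)%N -> (exists v, P j k v) -> P j k v) v (conj a b).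
exists w_ => [j|]; first by have [] := Hw j.
have small (e : R) : 0 < e -> \forall j \near \oo, (nrm (w_ j - w)%R < e%:E)%E.
  move=> e0; have [k ke] : exists k : nat, k.+1%:R^-1 < e.
    have [n _ /(_ n (leqnn n))] := near_infty_natSinv_lt (PosNum e0).
    by exists n.
  have k0 : 0 < k.+1%:R^-1 :> R by rewrite invr_gt0.
  near=> j; have [_ Hj] := Hw j.
  have kj : (k <= j)%N by near: j; exact: nbhs_infty_ge.
  have [_] : P j k (w_ j).
    apply: Hj => //.
    have [v Wv vk] : exists2 v, W_ j v & (nrm (v - w)%R < (k.+1%:R^-1)%:E)%E.
      by near: j; exact: HW.
    by exists v.
  by move=> /lt_trans; apply; rewrite lte_fin.
apply/fine_cvgP; split.
  apply: filterS (small 1 ltr01) => j j1; rewrite ge0_fin_numE ?nrm_ge0//.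
  by apply: lt_trans j1 _; exact: ltry.
apply/cvgrPdist_lt => e e0; apply: filterS (small e e0) => j je.
have jf : nrm (w_ j - w) \is a fin_num.
  by rewrite ge0_fin_numE ?nrm_ge0//; apply: lt_trans je _; exact: ltry.
rewrite sub0r normrN ger0_norm ?fine_ge0 ?nrm_ge0//.
by rewrite -lte_fin fineK.
Unshelve. all: by end_near.
Qed.

End selection.

(** * Mosco convergence *)

Section supports.
Context {R : realType} {m : nat}.
Local Notation V := 'rV[R]_m.
Local Notation dist := ((V -> R[i]) -> R[i]).
Local Notation hs := (- 2^-1 : R).

Lemma weak_limit_supp (Gamma_ Gp : nat -> set V) (M : forall j, preconvex_mesh (Gamma_ j))
    (sigma : nat -> nat) (w_ : nat -> dist) (w : dist) :
  (forall j, compact (Gp j)) -> (forall j, Gp j.+1 `<=` Gp j) ->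
  (forall j, Gamma_ j `<=` Gp j) ->
  {homo sigma : i j / (i < j)%N} ->
  (forall k, pc_space (M (sigma k)) (w_ k)) ->
  weakly_converges (Hs hs) (Hs_norm hs) w_ w ->
  dist_supp w `<=` \bigcap_j Gp j.
Proof.
move=> cG dG GG homos Ww [_ _ wk] x xw j _; apply: contrapT => xj; apply: xw.
exists (~` Gp j) => //; split.
  by apply: closed_openC; exact: rV_compact_closed.
move=> phi tphi; have sphi := test_function_schwartz tphi.
have L := wk _ (Hs_eval_bounded sphi).
(* Strictly increasing indices dominate the identity, so [Gp (sigma k)] lies in [Gp j] once k >=
   j. *)
have sk k : (k <= sigma k)%N.
  by elim: k => // k IH; apply: leq_ltn_trans IH _; exact: homos.
have dec i k : (i <= k)%N -> Gp k `<=` Gp i.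
  by move=> /subnK <-; elim: (k - i)%N => // n IH; exact: subset_trans (dG _) IH.
(* For large k the function representing [w_ k] vanishes off [Gamma_ (sigma k)], which lies in
   [Gp j], and phi vanishes on [Gp j]. So w_k(phi) = 0, and weak convergence makes the constant
   |w(phi)| tend to 0. *)
have w0 : \forall k \near \oo, normc (w_ k phi - w phi) = normc (w phi).
  near=> k; have [f [_ [_ f0]] <-] := Ww k.
  rewrite reg_distE// (eq_cint _ (g := fun=> 0)).
    by rewrite cint_real Rintegral_cst// mul0r sub0r normcN.
  move=> y; have [yG|yG] := pselect (Gamma_ (sigma k) y); last by rewrite f0 ?mul0r.
  suff -> : phi y = 0 by rewrite mulr0.
  have [_ _ sub] := tphi; apply: contrapT => /eqP py.
  have /sub : fun_supp phi y by exact: subset_closure.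
  apply; apply: (dec j (sigma k)); last exact: GG.
  by apply: leq_trans (sk k); near: k; exact: nbhs_infty_ge.
have L' : normc (w phi) @[k --> \oo] --> (0 : R).
  apply: cvg_trans L; apply: near_eq_cvg; apply: filterS w0 => k -> //.
apply/eqP; rewrite -normc_eq0; apply/eqP.
exact: (cvg_unique _ (cvg_cst _) L').
Unshelve. all: by end_near.
Qed.

End supports.

Theorem theorem5p2 (R : realType) (n : nat) (hn : n = 2%N \/ n = 3%N)
  (Gamma : set 'rV[R]_(n.-1)) (Gamma_ : nat -> set 'rV[R]_(n.-1))
  (Gamma_nonempty : Gamma !=set0) (Gamma_bounded : bounded_set Gamma)
  (Gamma_open : open Gamma)
  (Gammaj_nonempty : forall j, Gamma_ j !=set0)
  (Gammaj_bounded : forall j, bounded_set (Gamma_ j))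
  (Gammaj_open : forall j, open (Gamma_ j))
  (Gamma_regular : Hs_tilde (- 2^-1) Gamma = Hs_supp (- 2^-1) (closure Gamma))
  (Gamma_approx : exists Gm Gp : nat -> set 'rV[R]_(n.-1),
    [/\ forall j, [/\ Gm j !=set0, bounded_set (Gm j) & open (Gm j)],
        forall j, Gp j !=set0 /\ compact (Gp j),
        forall j, [/\ Gm j `<=` Gm j.+1, Gp j.+1 `<=` Gp j,
                      Gm j `<=` Gamma_ j & Gamma_ j `<=` Gp j],
        Gamma = \bigcup_j Gm j &
        closure Gamma = \bigcap_j Gp j])
  (M : forall j, preconvex_mesh (Gamma_ j))
  (mesh_size_cvg : mesh_size (M j) @[j --> \oo] --> (0 : R)) :
  mosco_converges (Hs (- 2^-1)) (Hs_norm (- 2^-1))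
    (fun j => pc_space (M j)) (Hs_tilde (- 2^-1) Gamma).
Proof.
have [Gm [Gp [_ HGp Hincl GmE GpE]]] := Gamma_approx.
have cG j : compact (Gp j) by have [] := HGp j.
have dG j : Gp j.+1 `<=` Gp j by have [] := Hincl j.
have iG j : Gm j `<=` Gm j.+1 by have [] := Hincl j.
have mG j : Gm j `<=` Gamma_ j by have [] := Hincl j.
have GG j : Gamma_ j `<=` Gp j by have [] := Hincl j.
have Gp0 j : Gp j `<=` Gp 0%N.
  by elim: j => // j; exact: subset_trans (dG j).
have GpC : Gamma `<=` Gp 0%N.
  by move=> x xG; have : closure Gamma x by [exact: subset_closure]; rewrite GpE; exact.
split.
- move=> w wG.
  have nn (u : ('rV[R]_(n.-1) -> R[i]) -> R[i]) : (0 <= Hs_norm (- 2^-1) u)%E.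
    by rewrite /Hs_norm; case: asboolP => _; [exact: poweR_ge0 | exact: leey].
  apply: (@select_cvg R _ _ nn (fun j => pc_space (M j)) w).
  (* Interpolating the zero function only witnesses that the space is non-empty. *)
  + by move=> j; exists (reg_dist (mesh_interp (M j) (fun=> 0))); exact: mesh_interp_space.
  (* [Gp 0] contains [Gamma] and every [Gamma_ j], so it is the compact set on which the domination
     takes place. *)
  + move=> e e0; apply: (@pc_space_approx R _ Gamma_ M Gamma (Gp 0%N)) => //.
    * move=> x; rewrite {1}GmE => -[i _ xi].
      near=> j; apply: mG.
      have : (i <= j)%N by near: j; exact: nbhs_infty_ge.
      by move=> /subnK <-; elim: (j - i)%N => // k IH; exact: iG.
    * by move=> j; exact: subset_trans (GG j) (Gp0 j).
- move=> sigma w_ w homos Ww wk; rewrite Gamma_regular; split.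
    by have [] := wk.
  rewrite GpE; exact: weak_limit_supp cG dG GG homos Ww wk.
Unshelve. all: by end_near.
Qed.
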